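(* Let $U\subset\mathbb{C}^2$ be a nonempty connected open subset and let $L$ be a nonzero finite dimensional complex Lie subalgebra of the Lie algebra of complex analytic vector fields on $U$. If $L$ is semisimple, then $L$ is of type $A_1$, $A_2$ or $A_1\times A_1$; that is, $L$ is isomorphic, as a complex Lie algebra, to one of $\mathfrak{sl}(2,\mathbb{C})$, $\mathfrak{sl}(3,\mathbb{C})$ or $\mathfrak{sl}(2,\mathbb{C})\times\mathfrak{sl}(2,\mathbb{C})$.
   Context: A complex analytic vector field on an open subset $U\subset\mathbb{C}^2$ is an expression $V=a_1\,\partial/\partial x_1+a_2\,\partial/\partial x_2$ with $a_1,a_2$ complex analytic functions on $U$, acting on analytic functions by $V(f)=\sum_i a_i\,\partial f/\partial x_i$. The bracket is $[V,W](f)=V(W(f))-W(V(f))$, which makes the space of all such vector fields a complex Lie algebra. $A_n$ denotes the Lie algebra $\mathfrak{sl}(n+1,\mathbb{C})$ of $\mathrm{SL}(n+1,\mathbb{C})$. *)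

(* Defs.v *)
From HB Require Import structures.
From mathcomp Require Import all_boot all_order all_algebra complex ring.
From mathcomp Require Import all_classical all_reals all_analysis.

Set Implicit Arguments.
Unset Strict Implicit.
Unset Printing Implicit Defensive.

Import Order.TTheory GRing.Theory Num.Theory numFieldNormedType.Exports.

Local Open Scope classical_set_scope.
Local Open Scope ring_scope.

(* Lie algebras are given by a linear subset [L] of an ambient vector space [E]
   together with a binary operation [br] on [E]; only the restriction of [br]
   to [L] matters. *)
Section LieAlgebra.
Variables (K : fieldType) (E : lmodType K) (br : E -> E -> E).
Implicit Types S L I : set E.

Definition subspace S : Prop :=
  S 0 /\ forall (a : K) (u v : E), S u -> S v -> S (a *: u + v).

Definition linear_span S : set E := smallest subspace S.

Definition finite_dimensional S : Prop :=
  exists s : seq E, S = linear_span [set` s].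

Definition lie_subalgebra L : Prop :=
  subspace L /\ forall x y, L x -> L y -> L (br x y).

Definition lie_ideal L I : Prop :=
  [/\ subspace I, I `<=` L & forall x y, L x -> I y -> I (br x y)].

Definition derived_algebra L : set E :=
  linear_span [set br x y | x in L & y in L].

Definition lie_solvable L : Prop :=
  exists n : nat, iter n derived_algebra L `<=` [set 0].

Definition lie_semisimple L : Prop :=
  forall I, lie_ideal L I -> lie_solvable I -> I `<=` [set 0].

End LieAlgebra.

Definition lie_isomorphic (K : fieldType) (E1 E2 : lmodType K)
    (br1 : E1 -> E1 -> E1) (L1 : set E1) (br2 : E2 -> E2 -> E2) (L2 : set E2) :
    Prop :=
  exists phi : E1 -> E2,
    [/\ forall (a : K) (u v : E1), L1 u -> L1 v ->
          phi (a *: u + v) = a *: phi u + phi v,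
        forall u v : E1, L1 u -> L1 v -> phi (br1 u v) = br2 (phi u) (phi v)
      & set_bij L1 L2 phi].

Definition mx_bracket (K : fieldType) (n : nat) (A B : 'M[K]_n) : 'M[K]_n :=
  A *m B - B *m A.

Definition sl (K : fieldType) (n : nat) : set 'M[K]_n := [set A | \tr A = 0].
Arguments sl : clear implicits.

Definition prod_bracket (K : fieldType) (E1 E2 : lmodType K)
    (br1 : E1 -> E1 -> E1) (br2 : E2 -> E2 -> E2) (u v : E1 * E2) : E1 * E2 :=
  (br1 u.1 v.1, br2 u.2 v.2).

(* [K] is meant to be the field [R[i]] of complex numbers, for [R : realType]. *)
Section VectorFields.
Variable K : numFieldType.
Implicit Types (U : set 'rV[K]_2) (p z : 'rV[K]_2) (f : 'rV[K]_2 -> K)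
  (V W : 'rV[K]_2 -> 'rV[K]_2) (c : nat -> nat -> K) (r : K).

Definition polydisc p r : set 'rV[K]_2 :=
  [set z | forall i, `|z 0 i - p 0 i| < r].

Definition double_sum (u : nat -> nat -> K) (n : nat) : K :=
  \sum_(i < n) \sum_(j < n) u i j.

Definition monomial c p z (i j : nat) : K :=
  c i j * (z 0 0 - p 0 0) ^+ i * (z 0 1 - p 0 1) ^+ j.

(* For an absolutely convergent double series the order of summation is
   irrelevant; here the partial sums run over squares. *)
Definition power_series_at f p c r : Prop :=
  forall z, polydisc p r z ->
    (exists M : K, forall n : nat,
       double_sum (fun i j => `|monomial c p z i j|) n <= M) /\
    double_sum (monomial c p z) n @[n --> \oo] --> f z.

Definition analytic_at f p : Prop :=
  exists c, exists2 r, 0 < r & power_series_at f p c r.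

Definition analytic_on U f : Prop := forall p, U p -> analytic_at f p.

Definition partial (i : 'I_2) f p : K := 'D_(delta_mx 0 i) f p.

(* A vector field on [U] is represented by the map [p |-> (a_1 p, a_2 p)],
   extended by zero outside [U], so that two vector fields on [U] are equal iff
   their representatives are. *)
Definition vector_field U V : Prop :=
  (forall i, analytic_on U (fun p => V p 0 i)) /\ (forall p, ~ U p -> V p = 0).

Definition act V f : 'rV[K]_2 -> K :=
  fun p => \sum_(i < 2) V p 0 i * partial i f p.

Definition coordinate (i : 'I_2) : 'rV[K]_2 -> K := fun p => p 0 i.

(* A vector field [X] has components [X(x_1)] and [X(x_2)], so the rule
   [V,W](f) = V(W(f)) - W(V(f)), applied to the coordinate functions,
   determines the bracket; lemma [act_bracket] below shows that the rule then
   holds for every analytic [f]. *)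
Definition bracket V W : 'rV[K]_2 -> 'rV[K]_2 :=
  fun p => \row_(i < 2)
    (act V (act W (coordinate i)) p - act W (act V (coordinate i)) p).

End VectorFields.

Section DoubleSums.
Variable K : numFieldType.
Implicit Types (u v : nat -> nat -> K) (l M : K).

Definition absolutely_complete := forall u M,
  (forall n, double_sum (fun i j => `|u i j|) n <= M) ->
  exists l, double_sum u n @[n --> \oo] --> l.

Lemma double_sum_transpose u n :
  double_sum (fun i j => u j i) n = double_sum u n.
Proof. by rewrite /double_sum exchange_big. Qed.

Lemma eq_double_sum u v n : (forall i j, u i j = v i j) ->
  double_sum u n = double_sum v n.
Proof. by move=> uv; apply: eq_bigr => i _; apply: eq_bigr. Qed.

Lemma double_sumD u v n :
  double_sum (fun i j => u i j + v i j) n = double_sum u n + double_sum v n.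
Proof. by rewrite /double_sum -big_split; apply: eq_bigr => i _; rewrite big_split. Qed.

Lemma double_sumZ (a : K) u n :
  double_sum (fun i j => a * u i j) n = a * double_sum u n.
Proof. by rewrite /double_sum mulr_sumr; apply: eq_bigr => i _; rewrite mulr_sumr. Qed.

Lemma double_sumB u v n :
  double_sum (fun i j => u i j - v i j) n = double_sum u n - double_sum v n.
Proof.
by rewrite /double_sum -sumrB; apply: eq_bigr => i _; rewrite sumrB.
Qed.

Lemma ler_double_sum u v n : (forall i j, u i j <= v i j) ->
  double_sum u n <= double_sum v n.
Proof. by move=> uv; apply: ler_sum => i _; apply: ler_sum. Qed.

Lemma ler_norm_double_sum u n :
  `|double_sum u n| <= double_sum (fun i j => `|u i j|) n.
Proof.
rewrite (le_trans (ler_norm_sum _ _ _))//; apply: ler_sum => i _.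
exact: ler_norm_sum.
Qed.

Lemma double_sumS u n : double_sum u n.+1 = double_sum u n +
  (\sum_(i < n) u i n + \sum_(j < n.+1) u n j).
Proof.
rewrite /double_sum big_ord_recr/=.
under eq_bigr do rewrite big_ord_recr/=.
by rewrite big_split/= addrA.
Qed.

Lemma double_sum_recl u n : (forall j, u 0 j = 0) ->
  double_sum u n.+1 = double_sum (fun i j => u i.+1 j) n + \sum_(i < n) u i.+1 n.
Proof.
move=> u0; rewrite /double_sum big_ord_recl.
rewrite [X in X + _]big1 ?add0r; last by move=> j _; exact: u0.
under eq_bigr do rewrite big_ord_recr/=.
by rewrite big_split.
Qed.

Lemma cvg_norm_bound (s : nat -> K) l M :
  (forall n, `|s n| <= M) -> s n @[n --> \oo] --> l -> `|l| <= M.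
Proof.
move=> sM sl; apply/ler_addgt0Pr => e e0.
have /cvgrPdist_le /(_ _ e0) [N _ /(_ N (leqnn _)) /= h] := sl.
rewrite -(subrK (s N) l) (le_trans (ler_normD _ _))// addrC lerD//.
Qed.

Lemma taylor2_monomial (x h d : K) i : 0 < d -> `|h| <= d ->
  `|(x + h) ^+ i - x ^+ i - h * (x ^+ i.-1 *+ i)| <=
  (`|h| / d) ^+ 2 * (`|x| + d) ^+ i.
Proof.
move=> d0 hd.
pose G n := (`|x| + d) ^+ n - `|x| ^+ n - d * (`|x| ^+ n.-1 *+ n).
have step (a k : K) n : (a + k) ^+ n.+1 - a ^+ n.+1 - k * (a ^+ n *+ n.+1)
   = (a + k) * ((a + k) ^+ n - a ^+ n - k * (a ^+ n.-1 *+ n))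
     + (a ^+ n.-1 *+ n) * k ^+ 2.
  case: n => [|n] /=; first by rewrite !expr0 !expr1 mulr1n mulr0n; ring.
  by rewrite !exprS; ring.
suff : `|(x + h) ^+ i - x ^+ i - h * (x ^+ i.-1 *+ i)| <=
  (`|h| / d) ^+ 2 * G i.
  move/le_trans; apply; apply: ler_wpM2l.
    by rewrite exprn_ge0// divr_ge0// ltW.
  rewrite /G -addrA gerDl -opprD oppr_le0 addr_ge0 ?exprn_ge0//.
  by apply: mulr_ge0; [exact: ltW|rewrite mulrn_wge0// exprn_ge0].
elim: i => [|i IH]; first by rewrite /G !expr0 !mulr0n !mulr0 !subr0 subrr normr0 mulr0.
rewrite /G !step/= -/(G i) (le_trans (ler_normD _ _))// [leRHS]mulrDr.
have dn0 : d != 0 by rewrite gt_eqF.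
apply: lerD.
  rewrite normrM mulrCA; apply: ler_pM => //.
  by rewrite (le_trans (ler_normD _ _))// lerD2l.
have -> : (`|h| / d) ^+ 2 * ((`|x| ^+ i.-1 *+ i) * d ^+ 2) =
  (`|x| ^+ i.-1 *+ i) * `|h| ^+ 2 by field.
by rewrite normrM normrMn !normrX.
Qed.

Lemma deriv_monomial_bound (x d : K) i : 0 < d ->
  d * (`|x| ^+ i.-1 *+ i) <= (`|x| + d) ^+ i.
Proof.
move=> d0; elim: i => [|i IH]; first by rewrite mulr0n mulr0 expr0 ler01.
rewrite exprS mulrDl; case: i IH => [|i] /= IH.
  by rewrite !expr0 !mulr1 lerDr.
rewrite mulrSr mulrDr lerD//.
  rewrite exprS -mulrnAr mulrCA.
  by apply: ler_wpM2l.
apply: ler_wpM2l; first exact: ltW.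
by rewrite lerXn2r ?nnegrE ?addr_ge0 ?lerDl// ltW.
Qed.

Hypothesis absolutely_convergent : absolutely_complete.

Lemma termwise_derivation (b : nat -> nat -> K) (x rho M : K) :
  `|x| < rho ->
  (forall n, double_sum (fun i j => `|b i j| * rho ^+ i) n <= M) ->
  exists G : K,
  [/\ exists M', forall n,
        double_sum (fun i j => `|(b i.+1 j *+ i.+1) * x ^+ i|) n <= M',
      double_sum (fun i j => (b i.+1 j *+ i.+1) * x ^+ i) n @[n --> \oo] --> G
    & forall h F0 Fh : K, `|h| <= rho - `|x| ->
        double_sum (fun i j => b i j * x ^+ i) n @[n --> \oo] --> F0 ->
        double_sum (fun i j => b i j * (x + h) ^+ i) n @[n --> \oo] --> Fh ->
        `|Fh - F0 - h * G| <= `|h| ^+ 2 * (M / (rho - `|x|) ^+ 2)].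
Proof.
move=> xrho bM; pose d := rho - `|x|.
have d0 : 0 < d by rewrite subr_gt0.
have dn0 : d != 0 by rewrite gt_eqF.
have rhoE : rho = `|x| + d by rewrite /d addrC subrK.
pose D i j := (b i.+1 j *+ i.+1) * x ^+ i.
pose u i j := b i j * (x ^+ i.-1 *+ i).
have u0 j : u 0 j = 0 by rewrite /u mulr0n mulr0.
have uS i j : u i.+1 j = D i j by rewrite /u /D/= mulrnAl mulrnAr.
have uM n : double_sum (fun i j => `|u i j|) n <= M / d.
  rewrite ler_pdivlMr// mulrC -double_sumZ (le_trans _ (bM n))//.
  apply: ler_double_sum => i j; rewrite /u normrM mulrCA ler_wpM2l//.
  by rewrite normrMn normrX rhoE deriv_monomial_bound.
have [G uG] := absolutely_convergent uM.
have [A uA] : exists l, double_sum (fun i j => `|u i j|) n @[n --> \oo] --> l.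
  apply: (@absolutely_convergent _ (M / d)) => n.
  by rewrite (le_trans _ (uM n))//; apply: ler_double_sum => i j; rewrite normr_id.
pose T n := \sum_(i < n) u i.+1 n.
have DE n : double_sum D n = double_sum u n.+1 - T n.
  rewrite double_sum_recl// addrK; apply: eq_double_sum => i j.
  by rewrite uS.
have T0 : T n @[n --> \oo] --> (0 : K).
  have uAS : double_sum (fun i j => `|u i j|) n.+1 @[n --> \oo] --> A.
    by rewrite (cvg_shiftS (double_sum (fun i j => `|u i j|))).
  have AA : (double_sum (fun i j => `|u i j|) n.+1 -
      double_sum (fun i j => `|u i j|) n) @[n --> \oo] --> (0 : K).
    by rewrite -[X in _ --> X](subrr A); exact: cvgB.
  move/cvgr0Pnorm_le: AA => AA.
  apply/cvgr0Pnorm_le => e /AA; apply: filterS => n /=; apply: le_trans.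
  rewrite (double_sumS (fun i j => `|u i j|)) addrC addKr.
  rewrite [leRHS]ger0_norm ?addr_ge0 ?sumr_ge0//.
  rewrite /T (le_trans (ler_norm_sum _ _ _)) //.
  have -> : \sum_(i < n) `|u i.+1 n| = \sum_(1 <= i < n.+1) `|u i n|.
    by rewrite big_add1/= big_mkord.
  rewrite (@le_trans _ _ (\sum_(0 <= i < n.+1) `|u i n|))//.
    by rewrite [leRHS]big_ltn// lerDr.
  by rewrite big_nat_recr//= big_mkord lerD2l big_ord_recr/= lerDr sumr_ge0.
exists G; split.
- exists (M / d) => n; rewrite (le_trans _ (uM n.+1))//.
  rewrite (@double_sum_recl (fun i j => `|u i j|)) ?u0 ?normr0//; last first.
    by move=> j; rewrite u0 normr0.
  rewrite -[leLHS]addr0 lerD ?sumr_ge0//.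
  by apply: ler_double_sum => i j; rewrite uS.
- have uGS : double_sum u n.+1 @[n --> \oo] --> G.
    by rewrite (cvg_shiftS (double_sum u)).
  rewrite -[G]subr0.
  rewrite (_ : double_sum _ = fun n => double_sum u n.+1 - T n); last first.
    by apply/funext => n; exact: DE.
  exact: cvgB.
- move=> h F0 Fh hd c0 ch.
  have cc : (double_sum (fun i j => b i j * (x + h) ^+ i) n -
      double_sum (fun i j => b i j * x ^+ i) n - h * double_sum u n)
      @[n --> \oo] --> Fh - F0 - h * G.
    by apply: cvgB; [exact: cvgB|exact: cvgMr].
  apply: (cvg_norm_bound _ cc) => n.
  rewrite -double_sumZ -!double_sumB (le_trans (ler_norm_double_sum _ _))//.
  set w := `|h| ^+ 2 * (M / d ^+ 2).
  have -> : w = (`|h| / d) ^+ 2 * M by rewrite /w; field.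
  rewrite (le_trans _ (ler_wpM2l _ (bM n))) ?exprn_ge0 ?divr_ge0 ?(ltW d0)//.
  rewrite -double_sumZ; apply: ler_double_sum => i j.
  have -> : b i j * (x + h) ^+ i - b i j * x ^+ i - h * u i j =
    b i j * ((x + h) ^+ i - x ^+ i - h * (x ^+ i.-1 *+ i)).
    by rewrite /u; ring.
  rewrite normrM mulrCA ler_wpM2l// rhoE.
  exact: taylor2_monomial.
Qed.
End DoubleSums.

Section ComplexCompleteness.
Variable R : realType.

Lemma cvg_double_sum_ge0 (w : nat -> nat -> R) (M : R) :
  (forall i j, 0 <= w i j) -> (forall n, double_sum w n <= M) ->
  exists l : R, double_sum w n @[n --> \oo] --> l.
Proof.
move=> w0 wM; exists (limn (double_sum w)).
apply: nondecreasing_is_cvgn; last by exists M => _ [n _ <-].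
apply/nondecreasing_seqP => n; rewrite double_sumS lerDl.
by rewrite addr_ge0// sumr_ge0.
Qed.

Lemma cvg_double_sum_dominated (v w : nat -> nat -> R) (M : R) :
  (forall i j, `|v i j| <= w i j) -> (forall n, double_sum w n <= M) ->
  exists l : R, double_sum v n @[n --> \oo] --> l.
Proof.
move=> vw wM.
have w0 i j : 0 <= w i j by rewrite (le_trans _ (vw i j)).
have [l1 wl1] := cvg_double_sum_ge0 w0 wM.
have [||l2 vwl2] := @cvg_double_sum_ge0 (fun i j => v i j + w i j) (M + M).
- by move=> i j; have := vw i j; rewrite ler_norml => /andP[+ _]; rewrite -lerBlDr sub0r.
- move=> n; rewrite double_sumD lerD// (le_trans _ (wM n))//.
  by apply: ler_double_sum => i j; rewrite (le_trans (ler_norm _)).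
exists (l2 - l1).
rewrite (_ : double_sum v =
  fun n => double_sum (fun i j => v i j + w i j) n - double_sum w n).
  exact: cvgB.
by apply/funext => n; rewrite double_sumD addrK.
Qed.

Lemma Re_double_sum (u : nat -> nat -> R[i]) n :
  complex.Re (double_sum u n) = double_sum (fun i j => complex.Re (u i j)) n.
Proof.
have ReD : {morph @complex.Re R : x y / x + y} by move=> [? ?] [? ?].
by rewrite /double_sum (big_morph _ ReD erefl); apply: eq_bigr => i _;
  rewrite (big_morph _ ReD erefl).
Qed.

Lemma Im_double_sum (u : nat -> nat -> R[i]) n :
  complex.Im (double_sum u n) = double_sum (fun i j => complex.Im (u i j)) n.
Proof.
have ImD : {morph @complex.Im R : x y / x + y} by move=> [? ?] [? ?].
by rewrite /double_sum (big_morph _ ImD erefl); apply: eq_bigr => i _;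
  rewrite (big_morph _ ImD erefl).
Qed.

Lemma norm_Re_le (z : R[i]) : `|complex.Re z| <= complex.Re `|z|.
Proof. by rewrite normc_def /= -sqrtr_sqr ler_wsqrtr// lerDl sqr_ge0. Qed.

Lemma norm_Im_le (z : R[i]) : `|complex.Im z| <= complex.Re `|z|.
Proof. by rewrite normc_def /= -sqrtr_sqr ler_wsqrtr// lerDr sqr_ge0. Qed.

Lemma norm_le_ReIm (z : R[i]) :
  `|z| <= (`|complex.Re z| + `|complex.Im z|)%:C%C.
Proof.
rewrite normc_def lecR -[leRHS]ger0_norm ?addr_ge0// -sqrtr_sqr ler_wsqrtr//.
rewrite sqrrD !real_normK ?num_real// addrAC lerDl.
by rewrite mulrn_wge0// mulr_ge0.
Qed.

Lemma complex_absolutely_convergent : absolutely_complete R[i].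
Proof.
move=> u M uM.
have wM n : double_sum (fun i j => complex.Re `|u i j|) n <= complex.Re M.
  by rewrite -Re_double_sum; have := uM n; rewrite lecE => /andP[].
have [a aP] := cvg_double_sum_dominated (fun i j => norm_Re_le (u i j)) wM.
have [b bP] := cvg_double_sum_dominated (fun i j => norm_Im_le (u i j)) wM.
exists (a +i* b)%C; apply/cvgrPdist_le => e e0.
have eE : e = (complex.Re e)%:C%C.
  by move: e0; case: e => x y; rewrite ltcE/= => /andP[/eqP -> _].
have r0 : 0 < complex.Re e / 2.
  by rewrite divr_gt0//; move: e0; rewrite ltcE => /andP[].
move/cvgrPdist_le : aP => /(_ _ r0) aP.
move/cvgrPdist_le : bP => /(_ _ r0) bP.
apply: filterS2 aP bP => n an bn.
rewrite eE (le_trans (norm_le_ReIm _))// lecR [leRHS]splitr.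
have ReB (x y : R[i]) : complex.Re (x - y) = complex.Re x - complex.Re y.
  by case: x y => ? ? [].
have ImB (x y : R[i]) : complex.Im (x - y) = complex.Im x - complex.Im y.
  by case: x y => ? ? [].
by rewrite ReB ImB/= Re_double_sum Im_double_sum lerD.
Qed.
End ComplexCompleteness.

Section PowerSeries.
Variable K : numFieldType.
Hypothesis Kc : absolutely_complete K.
Implicit Types (f : 'rV[K]_2 -> K) (p z : 'rV[K]_2).

Lemma shift_coord (k k' : 'I_2) (h : K) z :
  (h *: delta_mx 0 k + z) 0 k' = h *+ (k == k') + z 0 k'.
Proof. by rewrite !mxE eqxx/= eq_sym; case: eqP; rewrite ?mulr1 ?mulr0. Qed.

Lemma is_derive_bound f z v (G d B : K) : 0 < d -> 0 <= B ->
  (forall h, `|h| <= d -> `|f (h *: v + z) - f z - h * G| <= `|h| ^+ 2 * B) ->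
  is_derive z v f G.
Proof.
move=> d0 B0 H.
have cG : h^-1 *: ((f \o shift z) (h *: v) - f z) @[h --> 0^'] --> G.
  apply/cvgrPdist_le => e e0.
  have e1 : 0 < e / (B + 1) by rewrite divr_gt0// ltr_wpDl.
  near=> h.
  have h0 : h != 0 by near: h; exact: nbhs_dnbhs_neq.
  have -> : G - h^-1 *: ((f \o shift z) (h *: v) - f z) =
     - (h^-1 * (f (h *: v + z) - f z - h * G)).
    rewrite /GRing.scale/= [in RHS]mulrBr [h^-1 * (h * G)]mulKf//.
    by rewrite opprB.
  rewrite normrN normrM normfV ler_pdivrMl ?normr_gt0//.
  have hd : `|h| <= d by near: h; exact: dnbhs0_le.
  rewrite (le_trans (H h hd))// expr2 -mulrA ler_wpM2l//.
  have he : `|h| <= e / (B + 1) by near: h; exact: dnbhs0_le.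
  rewrite (le_trans (ler_wpM2r B0 he))// mulrAC ler_pdivrMr ?ltr_wpDl//.
  by rewrite ler_wpM2l// ?lerDl// ltW.
split; first by apply/cvg_ex; exists G.
exact: cvg_lim.
Unshelve. all: by end_near. Qed.

Lemma termwise_partial (k k' : 'I_2) f p z (r : K) (c : nat -> nat -> K) :
  k != k' -> polydisc p r z ->
  (forall z', polydisc p r z' ->
    (exists M, forall n, double_sum (fun i j =>
      `|c i j * (z' 0 k' - p 0 k') ^+ j * (z' 0 k - p 0 k) ^+ i|) n <= M) /\
    double_sum (fun i j => c i j * (z' 0 k' - p 0 k') ^+ j *
                           (z' 0 k - p 0 k) ^+ i) n @[n --> \oo] --> f z') ->
  exists G,
  [/\ is_derive z (delta_mx 0 k : 'rV[K]_2) f G,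
      exists M, forall n, double_sum (fun i j =>
        `|(c i.+1 j *+ i.+1) * (z 0 k' - p 0 k') ^+ j *
          (z 0 k - p 0 k) ^+ i|) n <= M
    & double_sum (fun i j =>
        (c i.+1 j *+ i.+1) * (z 0 k' - p 0 k') ^+ j *
          (z 0 k - p 0 k) ^+ i) n @[n --> \oo] --> G].
Proof.
move=> kk' zpr H.
pose x := z 0 k - p 0 k; pose y := z 0 k' - p 0 k'.
pose b i j := c i j * y ^+ j.
have xr : `|x| < r by exact: zpr.
pose rho := (`|x| + r) / 2.
have xrho : `|x| < rho by rewrite midf_lt.
have rhor : rho < r by rewrite midf_lt.
have rho0 : 0 <= rho by rewrite (le_trans _ (ltW xrho)).
have inpd h : `|x + h| < r -> polydisc p r (h *: delta_mx 0 k + z).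
  move=> xh i; rewrite shift_coord; case: eqP => [<-|_].
    by rewrite mulr1n -addrA addrC.
  by rewrite mulr0n add0r; exact: zpr.
have ek h : (h *: delta_mx 0 k + z) 0 k - p 0 k = x + h.
  by rewrite shift_coord eqxx mulr1n -addrA addrC.
have ek' h : (h *: delta_mx 0 k + z) 0 k' - p 0 k' = y.
  by rewrite shift_coord (negbTE kk') mulr0n add0r.
have [|[M HM] _] := H ((rho - x) *: delta_mx 0 k + z).
  by apply: inpd; rewrite addrC subrK ger0_norm.
have bM n : double_sum (fun i j => `|b i j| * rho ^+ i) n <= M.
  rewrite (le_trans _ (HM n))//; apply: ler_double_sum => i j.
  by rewrite ek ek' (addrC x) subrK [leRHS]normrM normrX (ger0_norm rho0).
have [G [GM GD Gb]] := termwise_derivation Kc xrho bM.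
have DE : (fun i j => (c i.+1 j *+ i.+1) * y ^+ j * x ^+ i) =
   (fun i j => (b i.+1 j *+ i.+1) * x ^+ i).
  by apply/funext => i; apply/funext => j; congr (_ * _); rewrite /b mulrnAl.
exists G; split; last 2 first.
- case: GM => M' GM; exists M' => n; rewrite (le_trans _ (GM n))//.
  by apply: ler_double_sum => i j; rewrite /b -[in leRHS]mulrnAl.
- by rewrite -/x -/y DE.
have M0 : 0 <= M by have := bM 0; rewrite /double_sum big_ord0.
apply: (@is_derive_bound _ _ _ _ (rho - `|x|) (M / (rho - `|x|) ^+ 2)).
- by rewrite subr_gt0.
- by rewrite divr_ge0// exprn_ge0// subr_ge0 ltW.
- move=> h hd; apply: Gb => //.
    by have [] := H z zpr.
  have [|_] := H (h *: delta_mx 0 k + z).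
    apply: inpd; rewrite (le_lt_trans _ rhor)// (le_trans (ler_normD _ _))//.
    by rewrite addrC -lerBrDr.
  by rewrite ek ek'.
Qed.

Lemma power_series_partial0 f p c (r : K) : power_series_at f p c r ->
  (forall z, polydisc p r z -> derivable f z (delta_mx 0 0)) /\
  power_series_at (partial 0 f) p (fun i j => c i.+1 j *+ i.+1) r.
Proof.
move=> fc.
have E : forall (c' : nat -> nat -> K) z, monomial c' p z = fun i j =>
    c' i j * (z 0 1 - p 0 1) ^+ j * (z 0 0 - p 0 0) ^+ i.
  by move=> c' z; apply/funext => i; apply/funext => j; rewrite /monomial mulrAC.
split=> z zpr; have [|G [dG GM GD]] := @termwise_partial 0 1 f p z r c isT zpr.
- by move=> z' /fc; rewrite E.
- by case: dG.
- by move=> z' /fc; rewrite E.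
- by rewrite /partial (@derive_val _ _ _ _ _ _ _ dG) E; split.
Qed.

Lemma power_series_partial1 f p c (r : K) : power_series_at f p c r ->
  (forall z, polydisc p r z -> derivable f z (delta_mx 0 1)) /\
  power_series_at (partial 1 f) p (fun i j => c i j.+1 *+ j.+1) r.
Proof.
move=> fc.
have H z' : polydisc p r z' ->
    (exists M, forall n, double_sum (fun i j =>
      `|c j i * (z' 0 0 - p 0 0) ^+ j * (z' 0 1 - p 0 1) ^+ i|) n <= M) /\
    double_sum (fun i j => c j i * (z' 0 0 - p 0 0) ^+ j *
                           (z' 0 1 - p 0 1) ^+ i) n @[n --> \oo] --> f z'.
  move=> /fc[[M HM] cv]; split.
    by exists M => n; rewrite -double_sum_transpose; exact: HM.
  rewrite (_ : double_sum _ = double_sum (monomial c p z'))//.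
  by apply/funext => n; rewrite -double_sum_transpose.
split=> z zpr; have [G [dG [M GM] GD]] :=
  @termwise_partial 1 0 f p z r (fun i j => c j i) isT zpr H.
  by case: dG.
rewrite /partial (@derive_val _ _ _ _ _ _ _ dG); split.
  by exists M => n; rewrite -double_sum_transpose; exact: GM.
move: GD; rewrite [X in X @ _ --> _ -> _](_ : _ =
  double_sum (monomial (fun i j => c i j.+1 *+ j.+1) p z))//.
by apply/funext => n; rewrite -double_sum_transpose.
Qed.

Lemma power_series_center f p c (r : K) : 0 < r -> power_series_at f p c r ->
  f p = c 0 0.
Proof.
move=> r0 fc; have [|_ fp] := fc p; first by move=> i; rewrite subrr normr0.
have fp' : double_sum (monomial c p p) n.+1 @[n --> \oo] --> f p.
  by rewrite (cvg_shiftS (double_sum (monomial c p p))).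
rewrite -(cvg_lim (@norm_hausdorff _ _) fp').
rewrite (_ : (fun n => _) = fun=> c 0 0); first by rewrite lim_cst.
apply/funext => n; rewrite /double_sum big_ord_recl big_ord_recl.
rewrite !big1 ?addr0.
- by rewrite /monomial !expr0 !mulr1.
- by move=> i _; rewrite big1// => j _; rewrite /monomial subrr expr0n/= mulr0 mul0r.
- by move=> j _; rewrite /monomial !subrr !expr0n/= mulr0.
Qed.

Lemma polydisc_center p (r : K) : 0 < r -> polydisc p r p.
Proof. by move=> r0 i; rewrite subrr normr0. Qed.

Lemma ord2P (P : 'I_2 -> Prop) : P 0 -> P 1 -> forall i, P i.
Proof.
move=> P0 P1 [[|[|//]] lt2].
- by rewrite (_ : Ordinal lt2 = 0) //; exact: val_inj.
- by rewrite (_ : Ordinal lt2 = 1) //; exact: val_inj.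
Qed.

Lemma analytic_derivable f p k : analytic_at f p ->
  derivable f p (delta_mx 0 k).
Proof.
move=> [c [r r0 fc]]; have pp := polydisc_center p r0.
by move: k; apply: ord2P;
  [have [+ _] := power_series_partial0 fc|have [+ _] := power_series_partial1 fc];
  apply.
Qed.

Lemma analytic_partial f p k : analytic_at f p -> analytic_at (partial k f) p.
Proof.
move=> [c [r r0 fc]]; move: k; apply: ord2P.
  by have [_ ?] := power_series_partial0 fc; eexists; exists r; eauto.
by have [_ ?] := power_series_partial1 fc; eexists; exists r; eauto.
Qed.

Lemma partial_comm f p : analytic_at f p ->
  partial 0 (partial 1 f) p = partial 1 (partial 0 f) p.
Proof.
move=> [c [r r0 fc]].
have [_ f0] := power_series_partial0 fc; have [_ f1] := power_series_partial1 fc.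
have [_ f01] := power_series_partial1 f0; have [_ f10] := power_series_partial0 f1.
by rewrite (power_series_center r0 f01) (power_series_center r0 f10).
Qed.

Lemma act_coordinate (V : 'rV[K]_2 -> 'rV[K]_2) i :
  act V (coordinate i) = fun p => V p 0 i.
Proof.
apply/funext => p.
have d k : is_derive p (delta_mx 0 k : 'rV[K]_2) (coordinate i) ((k == i)%:R : K).
  apply: (@is_derive_bound _ _ _ _ 1 0) => // h _.
  by rewrite /coordinate shift_coord addrK -[h *+ _]mulr_natr subrr normr0 mulr0.
rewrite /act (bigD1 i)//= big1 ?addr0 => [|k ki].
  by rewrite /partial (@derive_val _ _ _ _ _ _ _ (d i)) eqxx mulr1.
by rewrite /partial (@derive_val _ _ _ _ _ _ _ (d k)) (negbTE ki) mulr0.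
Qed.

Lemma partial_act (V : 'rV[K]_2 -> 'rV[K]_2) f p k :
  (forall i, analytic_at (fun z => V z 0 i) p) -> analytic_at f p ->
  partial k (act V f) p =
    \sum_(i < 2) (V p 0 i * partial k (partial i f) p +
                  partial i f p * partial k (fun z => V z 0 i) p).
Proof.
move=> Va fa.
have -> : act V f = \sum_(i < 2) ((fun z => V z 0 i) * partial i f).
  by apply/funext => z; rewrite fct_sumE.
rewrite /partial derive_sum; last first.
  move=> i; apply: derivableM; apply: analytic_derivable => //.
  exact: analytic_partial.
apply: eq_bigr => i _; rewrite deriveM//; apply: analytic_derivable => //.
exact: analytic_partial.
Qed.

Lemma act_bracket_at (V W : 'rV[K]_2 -> 'rV[K]_2) f p :
  (forall i, analytic_at (fun z => V z 0 i) p) ->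
  (forall i, analytic_at (fun z => W z 0 i) p) -> analytic_at f p ->
  act (bracket V W) f p = act V (act W f) p - act W (act V f) p.
Proof.
move=> Va Wa fa; rewrite {1 2 4}/act.
under eq_bigr do rewrite mxE !act_coordinate.
under [in RHS]eq_bigr do rewrite partial_act//.
under [X in _ = _ - X]eq_bigr do rewrite partial_act//.
rewrite /act !big_ord_recl !big_ord0.
have -> : lift ord0 ord0 = 1 :> 'I_2 by exact: val_inj.
have -> : ord0 = 0 :> 'I_2 by [].
rewrite (partial_comm fa) !addr0.
move: (partial 0 (fun z => V z 0 0) p) (partial 0 (fun z => W z 0 0) p) (partial 0 (fun z => V z 0 1) p)
  => a0 a1 a2.
move: (partial 0 (fun z => W z 0 1) p) (partial 1 (fun z => V z 0 0) p) (partial 1 (fun z => W z 0 0) p)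
  => a3 a4 a5.
move: (partial 1 (fun z => V z 0 1) p) (partial 1 (fun z => W z 0 1) p) (partial 0 (partial 0 f) p)
  => a6 a7 a8.
move: (partial 1 (partial 0 f) p) (partial 1 (partial 1 f) p) (partial 0 f p)
  => a9 a10 a11.
move: (partial 1 f p) (V p 0 0) (V p 0 1) => a12 a13 a14.
move: (W p 0 0) (W p 0 1) => a15 a16.
ring.
Qed.

End PowerSeries.

Lemma act_bracket (R : realType) (U : set 'rV[R[i]^o]_2)
    (V W : 'rV[R[i]]_2 -> 'rV[R[i]]_2) (f : 'rV[R[i]]_2 -> R[i]) :
  vector_field U V -> vector_field U W -> analytic_on U f ->
  forall p, U p ->
    act (bracket V W) f p = act V (act W f) p - act W (act V f) p.
Proof.
move=> [Va _] [Wa _] fa p Up.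
by apply: (act_bracket_at (@complex_absolutely_convergent R)) => [i|i|];
  [exact: Va|exact: Wa|exact: fa].
Qed.

(* Main.v *)
Require Import Defs.
From HB Require Import structures.
From mathcomp Require Import all_boot all_order all_algebra complex.
From mathcomp Require Import all_classical all_reals all_analysis.
From mathcomp Require Import ring.

(* Let L be semisimple.  By Cartan's criterion its Killing form is nondegenerate,
   so every ideal has a complementary ideal commuting with it.  Evaluation at a
   point p of U is a linear map from L to the tangent space whose kernel K, the
   isotropy algebra, is a subalgebra.

   If L spans the tangent space at some p, then K has codimension 2 and contains
   no nonzero ideal I of L: a field of I commutes with a local frame taken from
   the complement of I and vanishes at p, hence to infinite order.  Filter K by
   K_1 = {x in K | [x, L] <= K}, K_2 = {x in K_1 | [x, L] <= K_1}.  The Killing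
   form vanishes on K_2 x L and on K_1 x K, so K_2 = 0 and K_1 embeds in the dual
   of L / K.
   - If K acts irreducibly on L / K, its image in gl_2 contains sl_2.  A weight
     argument gives K_1 <> 0, so K_1 is dual to L / K, and sl_2-invariance
     determines the brackets [K_1, L]; they contain an Euler element, whose
     eigenspaces grade L as sl_3.
   - Otherwise K lies in a subalgebra M of codimension 1.  The same filtration
     shows that an ideal with a subalgebra of codimension 1 containing no nonzero
     ideal of L is sl_2.  This applies to the complement of the largest ideal J
     in M and, if J is not zero, to J and its intersection with K.

   If L nowhere spans the tangent space, all fields of L are parallel.  At a
   point where L does not vanish K has codimension 1, and the complement S of the
   largest ideal J in K is sl_2.  The Pluecker relation for parallel fields shows
   that fields of J, which commute with S, vanish on an open set, so J = 0. *)

Set Implicit Arguments.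
Unset Strict Implicit.
Unset Printing Implicit Defensive.

Import Order.TTheory GRing.Theory Num.Theory numFieldNormedType.Exports.

Local Open Scope classical_set_scope.
Local Open Scope ring_scope.

(** * Linear algebra *)

(** All Lie theory takes place on row vectors with an abstract bracket: a basis of L transports the
    bracket there, where subspaces have dimensions and [ad] is a matrix.

    Cartan's criterion is reached without Jordan decomposition or Lie's theorem. For x in the span
    of brackets with the Killing radical, the map D acting on each generalized eigenspace of ad x by
    the conjugate eigenvalue is a derivation. The product of ad x and D has trace 0, while its
    eigenvalues are numbers of the form z times conjugate of z, which are nonnegative. Hence ad x is
    nilpotent, and Engel's theorem excludes a minimal ideal in the radical. This is why the scalars
    form a [numClosedFieldType], which carries a conjugation. *)

Lemma vspace_of_pred (F : fieldType) (vT : vectType F) (P : vT -> Prop) :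
  P 0 -> (forall a u v, P u -> P v -> P (a *: u + v)) ->
  exists V : {vspace vT}, forall x, x \in V <-> P x.
Proof.
move=> P0 PZ.
have PD u v : P u -> P v -> P (u + v).
  by move=> Pu Pv; rewrite -[u]scale1r; apply: PZ.
have PS a u : P u -> P (a *: u).
  by move=> Pu; rewrite -[_ *: _]addr0; apply: PZ.
(* [V] will be a subspace inside [P] of maximal dimension; a vector of [P] outside it would enlarge
   it. *)
pose Q d := `[< exists V : {vspace vT}, (forall x, x \in V -> P x) /\ \dim V = d >].
have exQ : exists d, Q d.
  exists 0%N; apply/asboolP; exists 0%VS; split; last by rewrite dimv0.
  by move=> x; rewrite memv0 => /eqP ->.
have ubQ d : Q d -> (d <= dim vT)%N.
  by move=> /asboolP[V [_ <-]]; rewrite -dimvf dimvS ?subvf.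
case: (ex_maxnP exQ ubQ) => d /asboolP[V [VP Vd]] dmax.
exists V => x; split=> [/VP//|Px].
have QV : Q (\dim (V + <[x]>)).
  apply/asboolP; exists (V + <[x]>)%VS; split=> // y /memv_addP[v Vv [w]].
  by move=> /vlineP[k ->] ->; apply: PD; [exact: VP|exact: PS].
have /eqP -> : V == (V + <[x]>)%VS by rewrite eqEdim addvSl/= Vd dmax.
by rewrite (subvP (addvSr _ _))// memv_line.
Qed.

(** Derives an identity from a known one by exhibiting the factor [k]; what remains is a goal for
    [ring] or [field]. *)
Lemma eq_lin (R : comPzRingType) (k a b c d : R) :
  c = d -> a - b = k * (c - d) -> a = b.
Proof. by move=> ->; rewrite subrr mulr0 => /eqP; rewrite subr_eq0 => /eqP. Qed.
Arguments eq_lin {R} k {a b c d}.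

Lemma mxtraceB (V : zmodType) n (A B : 'M[V]_n) : \tr (A - B) = \tr A - \tr B.
Proof. exact: raddfB. Qed.

(** * Spectra and generalized eigenspaces *)

Section Spectrum.
Variable F : numClosedFieldType.

Lemma mxtrace_roots n (A : 'M[F]_n.+1) : exists r : seq F,
  [/\ forall z, z \in r -> eigenvalue A z, char_poly A = \prod_(z <- r) ('X - z%:P)
    & \tr A = \sum_(z <- r) z].
Proof.
have [r] := closed_field_poly_normal (char_poly A).
rewrite (monicP (char_poly_monic A)) scale1r => rE.
have sr : size r = n.+1.
  by have := size_char_poly A; rewrite rE size_prod_XsubC => -[].
exists r; split=> // [z zr|]; first by rewrite eigenvalue_root_char rE root_prod_XsubC.
have := @char_poly_trace _ _ A isT; rewrite rE.
by have := @coefPn_prod_XsubC _ r; rewrite sr => -> // /oppr_inj.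
Qed.

Lemma mxtrace_eigenvalue0 n (A : 'M[F]_n.+1) :
  (forall z, eigenvalue A z -> z = 0) -> \tr A = 0.
Proof.
move=> A0; have [r [rA _ ->]] := mxtrace_roots A.
by rewrite big_seq big1// => z /rA /A0.
Qed.

Lemma nilpotent_trace n (A : 'M[F]_n.+1) (k : nat) :
  (forall v, iter k (mulmx^~ A) v = 0 :> 'rV_n.+1) -> \tr A = 0.
Proof.
move=> Ak; apply: mxtrace_eigenvalue0 => z /eigenvalueP[v vA v0].
have E m : iter m (mulmx^~ A) v = z ^+ m *: v.
  elim: m => [|m /= ->]; first by rewrite scale1r.
  by rewrite -scalemxAl vA scalerA -exprSr.
have /eqP := Ak v; rewrite E scaler_eq0 (negbTE v0) orbF expf_eq0.
by move=> /andP[_ /eqP].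
Qed.

Lemma eigenvalue0_nilpotent n (A : 'M[F]_n.+1) :
  (forall z, eigenvalue A z -> z = 0) -> A ^+ n.+1 = 0.
Proof.
move=> A0; have [r [rA rE _]] := mxtrace_roots A.
have sr : size r = n.+1.
  by have := size_char_poly A; rewrite rE size_prod_XsubC => -[].
have := Cayley_Hamilton A; rewrite rE big_seq.
rewrite (eq_bigr (fun=> 'X)) => [|z /rA /A0 ->]; last by rewrite subr0.
rewrite -big_seq big_const_seq count_predT iter_mulr_1 sr.
by rewrite rmorphXn/= horner_mx_X.
Qed.

(** Apply the linear factors one at a time: each keeps the vector in [W], and the last nonzero
    vector is an eigenvector. With [W] an eigenspace of a commuting matrix this gives a common
    eigenvector. *)
Lemma mx_split_eigenvector n (A : 'M[F]_n.+1) (W : 'rV[F]_n.+1 -> Prop) v (r : seq F) :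
  (forall a u, W u -> W (u *m A - a *: u)) -> W v -> v != 0 ->
  v *m horner_mx A (\prod_(z <- r) ('X - z%:P)) = 0 ->
  exists2 u, W u /\ u != 0 & exists2 z, z \in r & u *m A = z *: u.
Proof.
move=> WA; elim: r v => [|z r IH] v Wv v0.
  by rewrite big_nil rmorph1 mulmx1 => /eqP; rewrite (negbTE v0).
rewrite big_cons rmorphM/= -mulmxE mulmxA rmorphB/= horner_mx_X horner_mx_C.
rewrite mulmxBr.
have [/eqP|N0 vr] := eqVneq (v *m A - v *m z%:M) 0.
  rewrite subr_eq0 => /eqP vA _; exists v => //; exists z; first exact: mem_head.
  by rewrite vA mul_mx_scalar.
have [|||u uW [y yr uA]] := IH (v *m A - v *m z%:M) => //.
  by rewrite mul_mx_scalar; apply: WA.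
by exists u => //; exists y => //; rewrite in_cons yr orbT.
Qed.

(** Chinese remainder theorem for powers of distinct linear factors. With conjugation for [f], it
    makes the conjugate derivation a polynomial in [ad x]. *)
Lemma poly_crt (s : seq F) (f : F -> F) (k : nat) : uniq s ->
  exists q : {poly F}, forall z, z \in s -> ('X - z%:P) ^+ k %| q - (f z)%:P.
Proof.
elim: s => [|y s IH] /=; first by exists 0.
move=> /andP[ys us]; have [q qs] := IH us.
pose P := \prod_(z <- s) ('X - z%:P) ^+ k.
have : coprimep P (('X - y%:P) ^+ k).
  rewrite /P big_seq; elim/big_ind: _ => [|p p' cp cp'|z zs].
  - exact: coprime1p.
  - by rewrite coprimepMl cp.
  - rewrite coprimep_expl// coprimep_expr// coprimep_XsubC root_XsubC.
    by apply: contraNneq ys => ->.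
move=> /Bezout_eq1_coprimepP[[u v] /= uv].
(* [P * u] is divisible by the old powers and congruent to 1 modulo the new one. *)
exists (q + P * u * ((f y)%:P - q)) => z; rewrite in_cons => /predU1P[->|zs].
  have -> : q + P * u * ((f y)%:P - q) - (f y)%:P = (1 - u * P) * (q - (f y)%:P) by ring.
  by rewrite -uv [u * P + _]addrC addrK mulrAC dvdp_mull.
rewrite addrAC dvdp_addr ?qs// -mulrA dvdp_mulr// /P (big_rem z)//= dvdp_mulr//.
Qed.

(** By Cayley-Hamilton the space is the sum of the kernels of the coprime factors of the
    characteristic polynomial. Multiplicities are at most [n.+1], which serves as a uniform
    exponent. *)
Lemma gen_eigen_ind n (A : 'M[F]_n.+1) (r : seq F) (P : 'rV[F]_n.+1 -> Prop) :
  char_poly A = \prod_(z <- r) ('X - z%:P) ->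
  P 0 -> (forall u v, P u -> P v -> P (u + v)) ->
  (forall z v, z \in r -> v *m (A - z%:M) ^+ n.+1 = 0 -> P v) ->
  forall v, P v.
Proof.
move=> rE P0 PD Pg v.
have sr : size r = n.+1.
  by have := size_char_poly A; rewrite rE size_prod_XsubC => -[].
pose s := undup r.
pose p (i : 'I_(size s)) := ('X - (s`_i)%:P) ^+ count_mem s`_i r.
have cp : {in xpredT &, forall i j, j != i -> coprimep (p i) (p j)}.
  move=> i j _ _ ij; rewrite coprimep_expl// coprimep_expr// coprimep_XsubC root_XsubC.
  by rewrite nth_uniq ?undup_uniq.
have : (v <= kermxpoly A (\prod_(i | xpredT i) p i))%MS.
  apply/sub_kermxP; rewrite /p -(big_mkord xpredT (fun i => ('X - (s`_i)%:P) ^+ count_mem s`_i r)).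
  rewrite -(big_nth 0 xpredT (fun z => ('X - z%:P) ^+ count_mem z r)).
  by rewrite prodr_undup_exp_count -rE Cayley_Hamilton mulmx0.
rewrite (kermxpoly_prod A cp) => /sub_sumsmxP[w ->].
elim/big_ind: _ => // i _.
have si : s`_i \in r by rewrite -mem_undup mem_nth.
apply: (Pg s`_i) => //.
have : (w i *m kermxpoly A (p i) <= kermxpoly A (p i))%MS by rewrite submxMl.
move/sub_kermxP; rewrite {2}/p rmorphXn/= rmorphB/= horner_mx_X horner_mx_C => h.
have: leq (count_mem s`_i r) n.+1 by rewrite -sr count_size.
by move=> /subnKC kE; rewrite -[X in _ ^+ X]kE exprD -mulmxE mulmxA h mul0mx.
Qed.

End Spectrum.

Lemma ord2_cases (i : 'I_2) : i = 0 \/ i = 1.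
Proof. by case: i => [[|[|//]] ?]; [left|right]; apply: val_inj. Qed.

Lemma big_ord2 (V : nmodType) (f : 'I_2 -> V) : \sum_i f i = f 0 + f 1.
Proof.
rewrite !big_ord_recl big_ord0 addr0; congr (f _ + f _); exact: val_inj.
Qed.

Lemma mulmx2E (R : pzRingType) m p (A : 'M[R]_(m, 2)) (B : 'M[R]_(2, p)) i j :
  (A *m B) i j = A i 0 * B 0 j + A i 1 * B 1 j.
Proof. by rewrite mxE big_ord2. Qed.

Lemma mxaddE (V : nmodType) m p (A B : 'M[V]_(m, p)) i j : (A + B) i j = A i j + B i j.
Proof. by rewrite mxE. Qed.

Lemma mxoppE (V : zmodType) m p (A : 'M[V]_(m, p)) i j : (- A) i j = - A i j.
Proof. by rewrite mxE. Qed.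

Lemma mxscaleE (R : pzRingType) m p a (A : 'M[R]_(m, p)) i j : (a *: A) i j = a * A i j.
Proof. by rewrite mxE. Qed.

Definition mx2E := (mxaddE, mxoppE, mxscaleE, mulmx2E).

(** * Irreducible Lie algebras of 2x2 matrices *)

Section IrreducibleMatrices.
Variable F : numClosedFieldType.
Implicit Types (A B P : 'M[F]_2) (W : 'M[F]_2 -> Prop).

Lemma det_mx22 A : \det A = A 0 0 * A 1 1 - A 0 1 * A 1 0.
Proof.
rewrite (expand_det_row _ 0) big_ord2 /cofactor !det_mx11 !mxE/=.
have -> : lift 0 0 = 1 :> 'I_2 by apply: val_inj.
have -> : lift 1 0 = 0 :> 'I_2 by apply: val_inj.
by rewrite expr0 expr1 mul1r mulN1r mulrN.
Qed.

Definition mx2 (a b c d : F) : 'M[F]_2 :=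
  \matrix_(i, j) if i == 0 then if j == 0 then a else b
                 else if j == 0 then c else d.

Lemma mx2P A B : A 0 0 = B 0 0 -> A 0 1 = B 0 1 -> A 1 0 = B 1 0 -> A 1 1 = B 1 1 ->
  A = B.
Proof.
move=> *; apply/matrixP => i j.
by case: (ord2_cases i) => ->; case: (ord2_cases j) => ->.
Qed.

(** The inequality says that [A *m u] is not proportional to [u]: no line is stable under all of
    [W]. *)
Definition irreducible W := forall u : 'cV[F]_2, u != 0 ->
  exists2 A, W A & (A *m u) 0 0 * u 1 0 != (A *m u) 1 0 * u 0 0.

Lemma sl2_of_diag W A :
  (forall a A B, W A -> W B -> W (a *: A + B)) ->
  (forall A B, W A -> W B -> W (A *m B - B *m A)) ->
  irreducible W -> W A -> A 0 1 = 0 -> A 1 0 = 0 -> A 0 0 != A 1 1 ->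
  forall B, \tr B = 0 -> W B.
Proof.
move=> Wl Wb Wi WA A01 A10 dA B trB.
have d0 : A 0 0 - A 1 1 != 0 by rewrite subr_eq0.
have W0 : W 0.
  have -> : 0 = (-1) *: A + A by rewrite scaleN1r addNr.
  exact: Wl.
have WZ a C : W C -> W (a *: C) by move=> WC; rewrite -[_ *: _]addr0; apply: Wl.
have nzcol i : (delta_mx i 0 : 'cV[F]_2) != 0.
  by apply/negP => /eqP/matrixP/(_ i 0); rewrite !mxE !eqxx => /eqP; rewrite oner_eq0.
have [Y WY] := Wi _ (nzcol 0); rewrite !mulmx2E !mxE/= !mulr0 !mulr1 !addr0 eq_sym => Y10.
have [Z WZ'] := Wi _ (nzcol 1); rewrite !mulmx2E !mxE/= !mulr0 !mulr1 !add0r => Z01.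
(* Bracketing with [A] multiplies the entries 01 and 10 by d and -d, where d = A 0 0 - A 1 1, and
   kills the diagonal. So [A, [A, Y]] - d [A, Y] retains only the entry 10, multiplied by 2 d^2. *)
have W10 : W (mx2 0 0 1 0).
  have := Wl (- (A 0 0 - A 1 1)) _ _ (Wb _ _ WA WY) (Wb _ _ WA (Wb _ _ WA WY)).
  move/(WZ ((2 * (A 0 0 - A 1 1) ^+ 2 * Y 1 0)^-1)).
  set X := (X in W X -> _); have -> // : X = mx2 0 0 1 0.
  by rewrite /X; apply: mx2P; rewrite !mx2E ?A01 ?A10 !mxE/=; field; rewrite ?Y10 ?d0.
have W01 : W (mx2 0 1 0 0).
  have := Wl (A 0 0 - A 1 1) _ _ (Wb _ _ WA WZ') (Wb _ _ WA (Wb _ _ WA WZ')).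
  move/(WZ ((2 * (A 0 0 - A 1 1) ^+ 2 * Z 0 1)^-1)).
  set X := (X in W X -> _); have -> // : X = mx2 0 1 0 0.
  by rewrite /X; apply: mx2P; rewrite !mx2E ?A01 ?A10 !mxE/=; field; rewrite ?Z01 ?d0.
have -> : B = B 0 1 *: mx2 0 1 0 0 + (B 1 0 *: mx2 0 0 1 0 +
    B 0 0 *: (mx2 0 1 0 0 *m mx2 0 0 1 0 - mx2 0 0 1 0 *m mx2 0 1 0 0)).
  have B11 : B 1 1 = - B 0 0.
    by move: trB; rewrite /mxtrace big_ord2 addrC => /eqP; rewrite addr_eq0 => /eqP.
  by apply: mx2P; rewrite !mx2E !mxE/= ?B11; ring.
by apply: (Wl) => //; apply: Wl => //; apply: WZ; exact: Wb.
Qed.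

(* If every element had a vanishing discriminant, a non-zero column of the
   nilpotent part of a non-scalar element would be a common eigenvector. *)
Lemma irreducible_disc W :
  (forall a A B, W A -> W B -> W (a *: A + B)) -> irreducible W ->
  exists2 A, W A & (A 0 0 - A 1 1) ^+ 2 + 4 * A 0 1 * A 1 0 != 0.
Proof.
move=> Wl Wi; pose disc A := (A 0 0 - A 1 1) ^+ 2 + 4 * A 0 1 * A 1 0.
have [//|nA] := pselect (exists2 A, W A & disc A != 0); exfalso.
have disc0 A : W A -> disc A = 0.
  by move=> WA; apply/eqP; apply: contraT => dA; case: nA; exists A.
have polar A B : W A -> W B ->
    (A 0 0 - A 1 1) * (B 0 0 - B 1 1) + 2 * A 0 1 * B 1 0 + 2 * A 1 0 * B 0 1 = 0.
  move=> WA WB; have := disc0 _ (Wl 1 _ _ WA WB); rewrite /disc !mx2E => E.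
  have := disc0 _ WA; have := disc0 _ WB; rewrite /disc => EB EA.
  apply: (mulfI (_ : 2 != 0 :> F)); first by rewrite pnatr_eq0.
  move: E; rewrite mulr0 => <-.
  apply: (eq_lin (-1) (_ : disc A + disc B = 0)).
    by rewrite !disc0 ?addr0.
  by rewrite /disc; ring.
have nzcol : (delta_mx 0 0 : 'cV[F]_2) != 0.
  by apply/negP => /eqP/matrixP/(_ 0 0); rewrite !mxE !eqxx => /eqP; rewrite oner_eq0.
have [N WN] := Wi _ nzcol.
rewrite !mulmx2E !mxE/= !mulr0 !mulr1 !addr0 eq_sym => N10.
pose u : 'cV[F]_2 := \col_i if i == 0 then N 0 0 - N 1 1 else 2 * N 1 0.
have u0 : u != 0.
  apply/negP => /eqP/matrixP/(_ 1 0); rewrite !mxE/= => /eqP.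
  by rewrite mulf_eq0 pnatr_eq0/= (negbTE N10).
have [B WB] := Wi _ u0; rewrite !mulmx2E !mxE/= => /eqP; apply.
apply: (eq_lin (2 * N 1 0) (polar _ _ WN WB)).
have := disc0 _ WN; rewrite /disc => dN.
apply: (eq_lin (- B 1 0) dN); ring.
Qed.

Lemma disc_diagonalizable A : (A 0 0 - A 1 1) ^+ 2 + 4 * A 0 1 * A 1 0 != 0 ->
  exists2 P, P \in unitmx & exists2 D, A *m P = P *m D &
    [/\ D 0 1 = 0, D 1 0 = 0 & D 0 0 != D 1 1].
Proof.
set d := (X in X != 0) => d0; pose s := sqrtC d.
have s2 : s ^+ 2 = d by rewrite sqrtCK.
have s0 : s != 0 by rewrite sqrtC_eq0.
pose t := A 0 0 - A 1 1.
have st : s ^+ 2 = t ^+ 2 + 4 * A 0 1 * A 1 0 by rewrite s2.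
pose l1 := (A 0 0 + A 1 1 + s) / 2; pose l2 := (A 0 0 + A 1 1 - s) / 2.
have l12 : l1 != l2.
  rewrite -subr_eq0 (_ : l1 - l2 = s)//.
  by rewrite /l1 /l2; field.
suff [P Pd AP] : exists2 P : 'M[F]_2, P 0 0 * P 1 1 - P 0 1 * P 1 0 != 0 &
    A *m P = P *m mx2 l1 0 0 l2.
  exists P; last by exists (mx2 l1 0 0 l2) => //; rewrite !mxE/=.
  by rewrite unitmxE det_mx22 unitfE.
(* The eigenvectors with entries t + s or t - s over 2 A 1 0 degenerate when A 1 0 = 0, so the
   triangular case is separate. *)
have [c0|c0] := eqVneq (A 1 0) 0.
  have [st1|st1] : s = t \/ s = - t.
    move: st; rewrite c0 mulr0 addr0 => /eqP; rewrite eqf_sqr.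
    by move=> /orP[]/eqP; [left|right].
  - exists (mx2 1 (- A 0 1) 0 s); first by rewrite !mxE/= mulr0 subr0 mul1r.
    by apply: mx2P; rewrite !mx2E !mxE/= /l1 /l2 st1 /t ?c0; field.
  - exists (mx2 (A 0 1) 1 s 0); first by rewrite !mxE/= mulr0 sub0r mul1r oppr_eq0.
    by apply: mx2P; rewrite !mx2E !mxE/= /l1 /l2 st1 /t ?c0; field.
exists (mx2 (t + s) (t - s) (2 * A 1 0) (2 * A 1 0)).
  rewrite !mxE/= (_ : _ - _ = 4 * A 1 0 * s); last by ring.
  by rewrite !mulf_neq0// pnatr_eq0.
apply: mx2P; rewrite !mx2E !mxE/= /l1 /l2 /t; last 2 first.
- by field.
- by field.
- by apply: (eq_lin (- 2^-1) st); rewrite /t; field.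
- by apply: (eq_lin (- 2^-1) st); rewrite /t; field.
Qed.

Lemma irreducible_sl2 W :
  (forall a A B, W A -> W B -> W (a *: A + B)) ->
  (forall A B, W A -> W B -> W (A *m B - B *m A)) ->
  irreducible W -> forall B, \tr B = 0 -> W B.
Proof.
move=> Wl Wb Wi B trB; have [A WA /disc_diagonalizable[P Pu [D AP [D01 D10 D0]]]] :=
  irreducible_disc Wl Wi.
pose W' C := W (P *m C *m invmx P).
have PK C : P *m (invmx P *m C *m P) *m invmx P = C.
  by rewrite !mulmxA mulmxV// mul1mx -mulmxA mulmxV// mulmx1.
suff : W' (invmx P *m B *m P) by rewrite /W' PK.
apply: (@sl2_of_diag W' D) => //.
- by move=> a X Y WX WY; rewrite /W' mulmxDr mulmxDl -scalemxAr -scalemxAl; apply: Wl.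
- move=> X Y WX WY; rewrite /W' mulmxBr mulmxBl.
  have E U V : P *m (U *m V) *m invmx P = (P *m U *m invmx P) *m (P *m V *m invmx P).
    by rewrite !mulmxA mulmxKV.
  by rewrite !E; apply: Wb.
- move=> u u0; have Pu0 : P *m u != 0.
    by apply: contraNneq u0 => Pu0; rewrite -[u](mulKmx Pu) Pu0 mulmx0.
  have [X WX XP] := Wi _ Pu0; exists (invmx P *m X *m P); first by rewrite /W' PK.
  apply: contraNneq XP; set v := _ *m u => v01.
  have -> : X *m (P *m u) = P *m v.
    by rewrite /v !mulmxA mulmxV// mul1mx.
  clearbody v; rewrite !mulmx2E; apply/eqP; apply: (eq_lin (\det P) v01).
  by rewrite det_mx22; ring.
- by rewrite /W' -AP -mulmxA mulmxV// mulmx1.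
- by rewrite mxtrace_mulC mulmxA mulmxV// mul1mx.
Qed.

End IrreducibleMatrices.

(** * Semisimple Lie algebras *)

Record lie_axioms (F : fieldType) (V : lmodType F) (br : V -> V -> V) : Prop := LieAxioms {
  lie_linl : forall a x y z, br (a *: x + y) z = a *: br x z + br y z;
  lie_linr : forall a x y z, br z (a *: x + y) = a *: br z x + br z y;
  lie_alt : forall x, br x x = 0;
  lie_jacobi : forall x y z, br x (br y z) = br (br x y) z + br y (br x z) }.

Section LieTheory.
Variables (F : numClosedFieldType) (n : nat).
Local Notation g := 'rV[F]_n.+1.
Variable br : g -> g -> g.
Hypothesis brP : lie_axioms br.
Implicit Types (x y z v : g) (I J S T U V : {vspace g}).

Lemma brDl x y z : br (x + y) z = br x z + br y z.
Proof. by have := lie_linl brP 1 x y z; rewrite !scale1r. Qed.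

Lemma brDr x y z : br z (x + y) = br z x + br z y.
Proof. by have := lie_linr brP 1 x y z; rewrite !scale1r. Qed.

Lemma br0l x : br 0 x = 0.
Proof. by apply: (addrI (br 0 x)); rewrite -brDl !addr0. Qed.

Lemma br0r x : br x 0 = 0.
Proof. by apply: (addrI (br x 0)); rewrite -brDr !addr0. Qed.

Lemma brZl a x y : br (a *: x) y = a *: br x y.
Proof. by have := lie_linl brP a x 0 y; rewrite !addr0 br0l addr0. Qed.

Lemma brZr a x y : br x (a *: y) = a *: br x y.
Proof. by have := lie_linr brP a y 0 x; rewrite !addr0 br0r addr0. Qed.

Lemma brNl x y : br (- x) y = - br x y.
Proof. by rewrite -scaleN1r brZl scaleN1r. Qed.

Lemma brNr x y : br x (- y) = - br x y.
Proof. by rewrite -scaleN1r brZr scaleN1r. Qed.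

Lemma brBl x y z : br (x - y) z = br x z - br y z.
Proof. by rewrite brDl brNl. Qed.

Lemma brBr x y z : br z (x - y) = br z x - br z y.
Proof. by rewrite brDr brNr. Qed.

Lemma br_anti x y : br x y = - br y x.
Proof.
have := lie_alt brP (x + y); rewrite brDl !brDr !(lie_alt brP) add0r addr0.
by move/eqP; rewrite addr_eq0 => /eqP.
Qed.

Lemma jacl x y z : br (br x y) z = br x (br y z) - br y (br x z).
Proof. by rewrite (lie_jacobi brP) addrK. Qed.

(** Vectors are rows and matrices act on the right, so composition is reversed:
    [v *m (ad x *m ad z)] is [br z (br x v)]. This explains the order of the factors in [ad_br]. *)
Definition ad x : 'M[F]_n.+1 := \matrix_i br x (delta_mx 0 i).

Lemma mul_ad v x : v *m ad x = br x v.
Proof.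
rewrite mulmx_sum_row [in RHS](row_sum_delta v).
rewrite (big_morph _ (fun y z => brDr y z x) (br0r x)).
by apply: eq_bigr => i _; rewrite rowK brZr.
Qed.

Lemma ad_lin a x y : ad (a *: x + y) = a *: ad x + ad y.
Proof.
apply/row_matrixP => i; rewrite linearD linearZ/= !rowK.
by rewrite brDl brZl.
Qed.

Lemma ad0 : ad 0 = 0.
Proof. by apply/row_matrixP => i; rewrite rowK br0l row0. Qed.

Lemma ad_br x y : ad (br x y) = ad y *m ad x - ad x *m ad y.
Proof.
apply/row_matrixP => i; rewrite !rowE mulmxBr !mulmxA !mul_ad.
exact: jacl.
Qed.

Definition killing x y := \tr (ad x *m ad y).

Lemma killingC x y : killing x y = killing y x.
Proof. by rewrite /killing mxtrace_mulC. Qed.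

Lemma killing_linl a x y z :
  killing (a *: x + y) z = a * killing x z + killing y z.
Proof. by rewrite /killing ad_lin mulmxDl -scalemxAl mxtraceD mxtraceZ. Qed.

Lemma killing0l x : killing 0 x = 0.
Proof. by rewrite /killing ad0 mul0mx mxtrace0. Qed.

Lemma killingDl x y z : killing (x + y) z = killing x z + killing y z.
Proof. by have := killing_linl 1 x y z; rewrite scale1r mul1r. Qed.

Lemma killingZl a x z : killing (a *: x) z = a * killing x z.
Proof. by have := killing_linl a x 0 z; rewrite killing0l !addr0. Qed.

Lemma killingNl x z : killing (- x) z = - killing x z.
Proof. by rewrite -scaleN1r killingZl mulN1r. Qed.

Lemma killing0r x : killing x 0 = 0.
Proof. by rewrite killingC killing0l. Qed.

Lemma killingDr x y z : killing z (x + y) = killing z x + killing z y.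
Proof. by rewrite !(killingC z) killingDl. Qed.

Lemma killingZr a x z : killing z (a *: x) = a * killing z x.
Proof. by rewrite !(killingC z) killingZl. Qed.

Lemma killing_inv x y z : killing (br x y) z = killing x (br y z).
Proof.
rewrite /killing !ad_br mulmxBl mulmxBr !mxtraceB -!mulmxA; congr (_ - _).
by rewrite mxtrace_mulC -mulmxA.
Qed.

Definition ideal I := forall x y, y \in I -> br x y \in I.

Lemma ideal_r I x y : ideal I -> x \in I -> br x y \in I.
Proof. by move=> Ii xI; rewrite br_anti memvN Ii. Qed.

(** * Derivations and generalized weights *)

Definition derivation (D : 'M[F]_n.+1) :=
  forall a b, br a b *m D = br (a *m D) b + br a (b *m D).

Lemma ad_derivation D a : derivation D -> ad (a *m D) = ad a *m D - D *m ad a.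
Proof.
move=> Dd; apply/row_matrixP => i; rewrite !rowE mulmxBr !mulmxA !mul_ad Dd.
by rewrite addrK.
Qed.

(** By the Leibniz rule one factor of the power turns [a, b] into two brackets, in each of which one
    of the exponents has dropped. *)
Lemma derivation_weight x i j a b (z w : F) :
  a *m (ad x - z%:M) ^+ i = 0 -> b *m (ad x - w%:M) ^+ j = 0 ->
  br a b *m (ad x - (z + w)%:M) ^+ (i + j) = 0.
Proof.
have [m] := ubnP (i + j); elim: m i j a b => // m IH [|i] [|j] a b.
- by rewrite !expr0 !mulmx1 => _ -> _; rewrite br0l.
- by rewrite !expr0 mulmx1 => _ ->; rewrite br0l mul0mx.
- by rewrite !expr0 mulmx1 => _ _ ->; rewrite br0r mul0mx.
rewrite addSn !exprS -!mulmxE !mulmxA => ijm az bw.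
have -> : br a b *m (ad x - (z + w)%:M) =
    br (a *m (ad x - z%:M)) b + br a (b *m (ad x - w%:M)).
  rewrite !mulmxBr !mul_mx_scalar !mul_ad brBl brBr brZl brZr scalerDl.
  rewrite (lie_jacobi brP) opprD addrACA; congr (_ + _).
rewrite mulmxDl.
have -> : br (a *m (ad x - z%:M)) b *m (ad x - (z + w)%:M) ^+ (i + j.+1) = 0.
  by apply: IH => //; rewrite exprS -mulmxE mulmxA.
rewrite add0r -addSnnS; apply: IH => //; first by rewrite addSnnS.
by rewrite exprS -mulmxE mulmxA.
Qed.

Lemma mx_expr_kernel (A : 'M[F]_n.+1) (v : g) (z : F) k : v != 0 ->
  v *m (A - z%:M) ^+ k = 0 -> eigenvalue A z.
Proof.
elim: k v => [|k IH] v v0; first by rewrite expr0 mulmx1 => /eqP; rewrite (negbTE v0).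
rewrite exprS -mulmxE mulmxA => vk.
have [vA|N0] := eqVneq (v *m (A - z%:M)) 0; last exact: IH vk.
apply/eigenvalueP; exists v => //; apply/eqP; rewrite -subr_eq0 -mul_mx_scalar -mulmxBr.
by rewrite vA.
Qed.

(* On the generalized eigenspace of [ad x] for [z] this derivation acts as the
   conjugate of [z]; it is a polynomial in [ad x], hence commutes with it. *)
Lemma conj_derivation x : exists D : 'M[F]_n.+1,
  [/\ derivation D, ad x *m D = D *m ad x
    & forall (z : F) v, v *m ad x = z *: v -> v != 0 -> v *m D = z^* *: v].
Proof.
have [r [rA rE _]] := mxtrace_roots (ad x).
(* The exponent is doubled because a bracket of two generalized eigenvectors is only known to be
   killed by the sum of their exponents. *)
have [q qr] := poly_crt (fun z : F => z^*) (n.+1 + n.+1) (undup_uniq r).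
pose D := horner_mx (ad x) q.
have rP (z : F) : eigenvalue (ad x) z = (z \in undup r).
  by rewrite eigenvalue_root_char rE root_prod_XsubC mem_undup.
have DE (z : F) v : v *m (ad x - z%:M) ^+ (n.+1 + n.+1) = 0 -> v *m D = z^* *: v.
  move=> vz; have [->|v0] := eqVneq v 0; first by rewrite mul0mx scaler0.
  have := mx_expr_kernel v0 vz; rewrite rP => /qr /dvdpP[w qw].
  have : v *m horner_mx (ad x) (q - (z^*)%:P) = 0.
    rewrite qw mulrC rmorphM/= -mulmxE mulmxA rmorphXn/= rmorphB/=.
    by rewrite horner_mx_X horner_mx_C vz mul0mx.
  rewrite rmorphB/= horner_mx_C mulmxBr mul_mx_scalar => /eqP.
  by rewrite subr_eq0 => /eqP.
have DE1 (z : F) v : v *m (ad x - z%:M) ^+ n.+1 = 0 -> v *m D = z^* *: v.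
  by move=> vz; apply: DE; rewrite exprD -mulmxE mulmxA vz mul0mx.
exists D; split.
- move=> a b; pose P1 a b := br a b *m D = br (a *m D) b + br a (b *m D).
  rewrite -/(P1 a b); move: a.
  apply: (gen_eigen_ind rE) => [|a a'|z a _ az].
  + by rewrite /P1 mul0mx !br0l mul0mx addr0.
  + rewrite /P1 => h h'.
    by rewrite brDl !mulmxDl h h' !brDl addrACA.
  move: b; apply: (gen_eigen_ind rE) => [|b b'|w b _ bw].
  + by rewrite /P1 mul0mx !br0r mul0mx addr0.
  + rewrite /P1 => h h'.
    by rewrite brDr !mulmxDl h h' !brDr addrACA.
  have abzw := derivation_weight az bw.
  rewrite /P1 (DE1 _ _ az) (DE1 _ _ bw) (DE _ _ abzw) rmorphD/=.
  by rewrite scalerDl brZl brZr.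
- exact/comm_mx_horner.
- move=> z v vz _; apply: DE1.
  rewrite exprS -mulmxE mulmxA mulmxBr mul_mx_scalar vz subrr mul0mx//.
Qed.

(** The hypothesis puts [x] in the span of [g, R], for R the radical of the Killing form. The trace
    of [ad x *m D] vanishes there because [ad (a *m D)] is the commutator of [ad a] and [D], which
    turns the trace for [a, b] into the Killing product of [b] and [a *m D]. *)
Lemma killing_radical_nilpotent x :
  (forall Z : {vspace g},
    (forall a b, (forall c, killing b c = 0) -> br a b \in Z) -> x \in Z) ->
  ad x ^+ n.+1 = 0.
Proof.
move=> xZ; have [D [Dd DC DE]] := conj_derivation x.
have [||Z ZP] := @vspace_of_pred F g (fun y => \tr (ad y *m D) = 0).
- by rewrite ad0 mul0mx mxtrace0.
- move=> a u v uD vD.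
  by rewrite ad_lin mulmxDl -scalemxAl mxtraceD mxtraceZ uD vD mulr0 addr0.
have : x \in Z.
  apply: xZ => a b b0; apply/ZP.
  have := b0 (a *m D); rewrite /killing (ad_derivation _ Dd) mulmxBr.
  rewrite ad_br mulmxBl !mxtraceB -!mulmxA.
  by rewrite [in X in _ = _ -> _ - X = _]mxtrace_mulC -!mulmxA.
move=> /ZP tr0; have [r [rA rE]] := mxtrace_roots (ad x *m D).
rewrite tr0 => sr0.
have Mz (z : F) (u : g) : u *m ad x = z *: u -> u != 0 ->
    u *m (ad x *m D) = (z * z^*) *: u.
  by move=> uz u0; rewrite mulmxA uz -scalemxAl (DE z)// scalerA.
(* [ad x] commutes with [D], so it has an eigenvector inside each eigenspace of [ad x *m D]; its
   eigenvalue w gives z as w times its conjugate. *)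
have r_ge0 (z : F) : z \in r -> 0 <= z.
  move=> /rA /eigenvalueP[v vz v0].
  have [s [_ sE _]] := mxtrace_roots (ad x).
  have [||u [uW u0] [w _ uw]] := @mx_split_eigenvector F n (ad x)
    (fun u => u *m (ad x *m D) = z *: u) v s _ vz v0.
  - move=> a u uz; rewrite mulmxBl -!scalemxAl uz -mulmxA.
    have -> : ad x *m (ad x *m D) = (ad x *m D) *m ad x by rewrite DC mulmxA DC.
    by rewrite mulmxA uz -scalemxAl scalerBr !scalerA mulrC.
  - by rewrite -sE Cayley_Hamilton mulmx0.
  move: uW; rewrite (Mz w)// => /eqP.
  rewrite -subr_eq0 -scalerBl scaler_eq0 (negbTE u0) orbF subr_eq0 => /eqP <-.
  exact: mul_conjC_ge0.
apply: eigenvalue0_nilpotent => z /eigenvalueP[v vz v0].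
have : eigenvalue (ad x *m D) (z * z^*) by apply/eigenvalueP; exists v => //; exact: Mz.
rewrite eigenvalue_root_char rE root_prod_XsubC => zr.
move/esym/eqP: sr0; rewrite big_seq psumr_eq0// => /allP /(_ _ zr).
by rewrite zr/= mul_conjC_eq0 => /eqP.
Qed.

(** * Engel's theorem and Cartan's criterion *)

Definition subalgebra S := forall x y, x \in S -> y \in S -> br x y \in S.

Lemma subalgebra_addline T s a b t t' : subalgebra T ->
  (forall t, t \in T -> br t s \in T) -> t \in T -> t' \in T ->
  br (t + a *: s) (t' + b *: s) \in T.
Proof.
move=> Tsub Ts tT tT'; rewrite brDl !brDr !brZl !brZr (lie_alt brP) !scaler0 addr0.
apply: memvD; first by apply: memvD; [exact: Tsub|apply: memvZ; exact: Ts].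
by apply: memvZ; rewrite br_anti memvN; exact: Ts.
Qed.

(** Take [T] a maximal proper subalgebra; Engel for [T] acting on S / T gives [s] normalizing [T],
    and T + <s> is all of [S] by maximality. Engel for smaller subalgebras is a premise, so the
    lemma serves inside the induction and again after it. *)
Lemma engel_step S : subalgebra S -> S != 0%VS ->
  (forall T U' U, subalgebra T -> (T <= S)%VS -> (\dim T < \dim S)%N ->
    (forall s u, s \in T -> u \in U -> br s u \in U) ->
    (forall s u, s \in T -> u \in U' -> br s u \in U') ->
    (exists2 u, u \in U & u \notin U') ->
    exists2 u, u \in U & u \notin U' /\ forall s, s \in T -> br s u \in U') ->
  exists T s, [/\ subalgebra T, (T <= S)%VS, (\dim T < \dim S)%N,
      [/\ s \in S, s \notin T & S = (T + <[s]>)%VS] & forall t, t \in T -> br t s \in T].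
Proof.
move=> Ssub S0 IH.
pose Q d := `[< exists T, [/\ subalgebra T, (T <= S)%VS, (\dim T < \dim S)%N & \dim T = d] >].
have exQ : exists d, Q d.
  exists 0%N; apply/asboolP; exists 0%VS; rewrite dimv0 sub0v lt0n dimv_eq0; split=> //.
  by move=> x y; rewrite !memv0 => /eqP -> _; rewrite br0l.
have ubQ d : Q d -> (d <= \dim S)%N by move=> /asboolP[T [_ _ /ltnW + <-]].
case: (ex_maxnP exQ ubQ) => d /asboolP[T [Tsub TS Td dT]] dmax.
have [|||s sS [sT Ts]] := IH T T S Tsub TS Td.
- by move=> s u /(subvP TS) sS; exact: Ssub.
- exact: Tsub.
- by apply/subvPn; apply: contraL Td => ST; rewrite -leqNgt dimvS.
have sub' : subalgebra (T + <[s]>).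
  move=> x y /memv_addP[t tT [_ /vlineP[a ->] ->]] /memv_addP[t' tT' [_ /vlineP[b ->] ->]].
  by apply: (subvP (addvSl _ _)); exact: subalgebra_addline.
have le' : (T + <[s]> <= S)%VS by rewrite subv_add TS -memvE.
exists T, s; split=> //; split=> //; apply/eqP; rewrite eq_sym eqEdim le' leqNgt; apply/negP => lt'.
have := dmax (\dim (T + <[s]>)).
rewrite leqNgt -dT => /(_ _)/negP; apply; first by apply/asboolP; exists (T + <[s]>)%VS.
rewrite ltnNge; apply: contra sT => le_dim.
have /eqP -> : T == (T + <[s]>)%VS by rewrite eqEdim addvSl.
by rewrite (subvP (addvSr _ _))// memv_line.
Qed.

(** The action is on [U] modulo [U'], which avoids quotient spaces. *)
Lemma engel S U' U : subalgebra S -> (forall s, s \in S -> ad s ^+ n.+1 = 0) ->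
  (forall s u, s \in S -> u \in U -> br s u \in U) ->
  (forall s u, s \in S -> u \in U' -> br s u \in U') ->
  (exists2 u, u \in U & u \notin U') ->
  exists2 u, u \in U & u \notin U' /\ forall s, s \in S -> br s u \in U'.
Proof.
have [d] := ubnP (\dim S); elim: d S U' U => // d IH S U' U Sd Ssub Snil SU SU' [u uU uU'].
have [S0|S0] := eqVneq S 0%VS.
  by exists u => //; split=> // s; rewrite S0 memv0 => /eqP ->; rewrite br0l mem0v.
have [|T [s [Tsub TS Td [sS sT SE] Ts]]] := engel_step Ssub S0.
  move=> T V' V Tsub TS Td; apply: IH => //; first exact: leq_trans Td Sd.
  by move=> t /(subvP TS); exact: Snil.
(* [W] consists of the vectors that [T] sends into [U']. Since [s] normalizes [T], it preserves [W],
   and the last iterate of [ad s] outside [U'] is the vector sought. *)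
have [||W WP] := @vspace_of_pred F g
    (fun v => v \in U /\ forall t, t \in T -> br t v \in U').
- by split=> [|t _]; rewrite ?br0r mem0v.
- move=> a v w [vU vT] [wU wT]; split=> [|t tT]; first by rewrite memvD// memvZ.
  by rewrite brDr brZr memvD ?memvZ ?vT ?wT.
have [||||v vU [vU' vT]] := IH T U' U (leq_trans Td Sd) Tsub.
- by move=> t /(subvP TS); exact: Snil.
- by move=> t w /(subvP TS); exact: SU.
- by move=> t w /(subvP TS); exact: SU'.
- by exists u.
have sW w : w \in W -> br s w \in W.
  move=> /WP[wU wT]; apply/WP; split; first exact: SU.
  move=> t tT; rewrite (lie_jacobi brP) memvD//; last by apply: SU' => //; apply: wT.
  by apply: wT; exact: Ts.
have ex_k : exists k, v *m ad s ^+ k \in U'.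
  by exists n.+1; rewrite Snil ?mulmx0 ?mem0v.
have vW k : v *m ad s ^+ k \in W.
  elim: k => [|k IHk]; first by rewrite expr0 mulmx1; apply/WP.
  by rewrite exprSr -mulmxE mulmxA mul_ad sW.
case: (ex_minnP ex_k) => -[|k]; first by rewrite expr0 mulmx1 (negbTE vU').
move=> kU' kmin; have /WP[kU kT] := vW k.
exists (v *m ad s ^+ k) => //; split.
  by apply/negP => /kmin; rewrite ltnn.
move=> y; rewrite SE => /memv_addP[t tT [_ /vlineP[a ->] ->]].
rewrite brDl brZl memvD ?kT// memvZ//.
by move: kU'; rewrite exprSr -mulmxE mulmxA mul_ad.
Qed.

Definition no_abelian_ideal :=
  forall I, ideal I -> (forall x y, x \in I -> y \in I -> br x y = 0) -> I = 0%VS.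

Hypothesis ss : no_abelian_ideal.

(** A minimal nonzero ideal [I] in the radical is not abelian, so it equals [I, I] and all its
    elements are ad-nilpotent. [engel_step] then yields a proper subspace [T] of [I] containing
    [I, I], a contradiction. *)
Lemma killing_nondegenerate x : (forall y, killing x y = 0) -> x = 0.
Proof.
have [||R RP] := @vspace_of_pred F g (fun x => forall y, killing x y = 0).
- by move=> y; rewrite killing0l.
- by move=> a u v u0 v0 y; rewrite killing_linl u0 v0 mulr0 addr0.
suff R0 : R = 0%VS by move=> /RP; rewrite R0 memv0 => /eqP.
apply/eqP; apply: contraT => Rn0.
have Ri : ideal R.
  move=> a b /RP b0; apply/RP => y.
  by rewrite br_anti killingNl killing_inv b0 oppr0.
pose Q d := `[< exists I, [/\ ideal I, (I <= R)%VS, I != 0%VS & \dim I = d] >].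
have exQ : exists d, Q d by exists (\dim R); apply/asboolP; exists R.
case: (ex_minnP exQ) => d /asboolP[I [Ii IR I0 Id]] dmin.
(* [J] is [I, I], as the intersection of the subspaces containing all brackets; membership then acts
   as an induction principle. *)
have [||J JP] := @vspace_of_pred F g (fun x => forall Z : {vspace g},
    (forall a b, a \in I -> b \in I -> br a b \in Z) -> x \in Z).
- by move=> Z _; rewrite mem0v.
- by move=> a u v uZ vZ Z ZP; rewrite memvD ?memvZ ?uZ ?vZ.
have JI : (J <= I)%VS.
  by apply/subvP => y /JP; apply => a b _; exact: Ii.
have Ji : ideal J.
  move=> a b /JP bJ; apply/JP => Z ZP.
  have [||W WP] := @vspace_of_pred F g (fun x => br a x \in Z).
  - by rewrite br0r mem0v.
  - by move=> c u v uZ vZ; rewrite brDr brZr memvD ?memvZ.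
  apply/WP; apply: bJ => u v uI vI; apply/WP.
  by rewrite (lie_jacobi brP) memvD// ZP// Ii.
have [J0|Jn0] := eqVneq J 0%VS.
  have I00 : I = 0%VS.
    apply: ss => // a b aI bI; apply/eqP; rewrite -memv0 -J0.
    by apply/JP => Z; apply.
  by rewrite I00 eqxx in I0.
have IJ : I = J.
  apply/eqP; rewrite eq_sym eqEdim JI Id dmin//.
  by apply/asboolP; exists J; split=> //; exact: subv_trans JI IR.
have Inil y : y \in I -> ad y ^+ n.+1 = 0.
  rewrite IJ => /JP yJ; apply: killing_radical_nilpotent => Z ZP; apply: yJ => a b _.
  by move=> /(subvP IR)/RP; exact: ZP.
have Isub : subalgebra I by move=> a b _; exact: Ii.
have [|T [s [Tsub TI Td [sI sT IE] Ts]]] := engel_step Isub I0.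
  move=> T V' V Tsub TI _ TV TV' VV'; apply: engel => //.
  by move=> t /(subvP TI); exact: Inil.
have : s \in J by rewrite -IJ.
move=> /JP /(_ T); rewrite (negbTE sT); apply=> a b.
rewrite IE => /memv_addP[t tT [_ /vlineP[c ->] ->]] /memv_addP[t' tT' [_ /vlineP[e ->] ->]].
exact: subalgebra_addline.
Qed.

Lemma killing_sumr m (f : 'I_m -> g) x :
  killing x (\sum_i f i) = \sum_i killing x (f i).
Proof. exact: (big_morph (killing x) (fun u v => killingDr u v x) (killing0r x)). Qed.

(** [S] is the Killing-orthogonal of [I]. By invariance and nondegeneracy their intersection is an
    abelian ideal, so it is 0; the Gram matrix on a basis of [I] is therefore invertible and yields
    the projection to [I]. *)
Lemma ideal_complement I : ideal I -> exists S,
  [/\ ideal S, forall s x, s \in S -> x \in I -> br s x = 0,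
      forall x, x \in I -> x \in S -> x = 0
    & forall x, exists2 s, s \in S & exists2 i, i \in I & x = s + i].
Proof.
move=> Ii; have [||S SP] := @vspace_of_pred F g
    (fun x => forall y, y \in I -> killing x y = 0).
- by move=> y _; rewrite killing0l.
- by move=> a u v u0 v0 y yI; rewrite killing_linl u0// v0// mulr0 addr0.
have Si : ideal S.
  move=> a x /SP x0; apply/SP => y yI.
  by rewrite br_anti killingNl killing_inv x0 ?oppr0//; exact: Ii.
have IS0 x : x \in I -> x \in S -> x = 0.
  move=> xI xS; apply/eqP; rewrite -memv0.
  have <- : (I :&: S)%VS = 0%VS; last by rewrite memv_cap xI.
  apply: ss => [a u|u v]; rewrite !memv_cap => /andP[uI uS].
    by rewrite Ii ?Si.
  move=> /andP[vI vS]; apply: killing_nondegenerate => w; rewrite killing_inv.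
  by move/SP: uS; apply; exact: ideal_r.
exists S; split=> // [s x sS xI|x].
  by apply: IS0; [exact: Ii|exact: ideal_r].
pose b i := (vbasis I)`_i.
pose G : 'M[F]_(\dim I) := \matrix_(i, j) killing (b i) (b j).
have bI (i : 'I_(\dim I)) : b i \in I by rewrite vbasis_mem// mem_nth// size_tuple.
have sumI (c : 'rV_(\dim I)) : \sum_i c 0 i *: b i \in I.
  by apply: memv_suml => i _; apply: memvZ.
have killing_sum (c : 'rV_(\dim I)) y :
    killing (\sum_i c 0 i *: b i) y = \sum_i c 0 i * killing (b i) y.
  rewrite (big_morph (fun u => killing u y) (fun u v => killingDl u v y) (killing0l y)).
  by apply: eq_bigr => i _; rewrite killingZl.
have Gu : G \in unitmx.
  rewrite -row_free_unit; apply: inj_row_free => c /rowP cG.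
  have c0 : \sum_i c 0 i *: b i = 0.
    apply: IS0 => //; apply/SP => y /coord_vbasis ->.
    rewrite killing_sumr big1// => j _; rewrite killingZr killing_sum.
    have := cG j; rewrite !mxE => cGj.
    rewrite (_ : \sum_i _ = 0) ?mulr0// -[RHS]cGj.
    by apply: eq_bigr => i _; rewrite mxE.
  have /freeP bfree := basis_free (vbasisP I).
  by apply/rowP => i; rewrite mxE; apply: bfree c0 i.
pose c := (\row_j killing x (b j)) *m invmx G.
have cE (j : 'I_(\dim I)) : killing (\sum_i c 0 i *: b i) (b j) = killing x (b j).
  rewrite killing_sum; have : (c *m G) 0 j = killing x (b j).
    by rewrite /c mulmxKV// mxE.
  by rewrite mxE => <-; apply: eq_bigr => i _; rewrite [G i j]mxE.
exists (x - \sum_i c 0 i *: b i); last by exists (\sum_i c 0 i *: b i); rewrite ?subrK.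
apply/SP => y /coord_vbasis ->.
rewrite killing_sumr big1// => j _.
by rewrite killingZr killingDl killingNl cE subrr mulr0.
Qed.

Lemma ideal_core M : exists J, [/\ ideal J, (J <= M)%VS &
  forall I, ideal I -> (I <= M)%VS -> (I <= J)%VS].
Proof.
pose Q d := `[< exists J, [/\ ideal J, (J <= M)%VS & \dim J = d] >].
have exQ : exists d, Q d.
  exists 0%N; apply/asboolP; exists 0%VS; rewrite dimv0 sub0v; split=> //.
  by move=> x y; rewrite !memv0 => /eqP ->; rewrite br0r.
have ubQ d : Q d -> (d <= \dim M)%N by move=> /asboolP[J [_ /dimvS + <-]].
case: (ex_maxnP exQ ubQ) => d /asboolP[J [Ji JM dJ]] dmax.
exists J; split=> // I Ii IM.
have /eqP -> : J == (J + I)%VS; last exact: addvSr.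
rewrite eqEdim addvSl dJ dmax//; apply/asboolP; exists (J + I)%VS; split=> //.
  move=> x y /memv_addP[u uJ [v vI ->]]; rewrite brDr memv_add//; [exact: Ji|exact: Ii].
by rewrite subv_add JM.
Qed.

(** * The filtration defined by a subalgebra *)

Section Filtration.
Variables (S C F0 : {vspace g}).
Hypotheses (Si : ideal S) (SC : forall s c, s \in S -> c \in C -> br s c = 0).
Hypothesis SCdec : forall x, exists2 s, s \in S & exists2 c, c \in C & x = s + c.
Hypotheses (F0sub : subalgebra F0) (F0S : (F0 <= S)%VS).
Hypothesis core0 : forall I, ideal I -> (I <= F0)%VS -> I = 0%VS.

(** Brackets are taken with the ideal [S] only, since those with its complement [C] vanish; thus one
    filtration serves both the whole algebra and a proper ideal. *)
Fixpoint fil (j : nat) x : Prop :=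
  if j is j'.+1 then fil j' x /\ forall s, s \in S -> fil j' (br x s) else x \in F0.

Lemma fil_lin j a x y : fil j x -> fil j y -> fil j (a *: x + y).
Proof.
elim: j x y => [|j IH] x y /=; first by move=> *; rewrite memvD ?memvZ.
move=> [xj xS] [yj yS]; split=> [|s sS]; first exact: IH.
by rewrite (lie_linl brP); apply: IH; [exact: xS|exact: yS].
Qed.

Lemma fil0 j : fil j 0.
Proof. by elim: j => [|j IH] /=; [exact: mem0v|split=> // s _; rewrite br0l]. Qed.

Lemma filZ j a x : fil j x -> fil j (a *: x).
Proof. by move=> xj; rewrite -[_ *: _]addr0; apply: fil_lin => //; exact: fil0. Qed.

Lemma filD j x y : fil j x -> fil j y -> fil j (x + y).
Proof. by move=> xj; rewrite -[x]scale1r; exact: fil_lin. Qed.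

Lemma filN j x : fil j x -> fil j (- x).
Proof. by rewrite -scaleN1r; exact: filZ. Qed.

Lemma filB j x y : fil j x -> fil j y -> fil j (x - y).
Proof. by move=> xj yj; apply: filD => //; exact: filN. Qed.

Lemma fil_mem j x : fil j x -> x \in S.
Proof. by elim: j => [/(subvP F0S)|j IH [/IH]]. Qed.

Lemma fil_br_eq m i j x y : (i + j)%N = m -> fil i x -> fil j y -> fil m (br x y).
Proof.
elim: m i j x y => [|m IH] i j x y.
  by move/eqP; rewrite addn_eq0 => /andP[/eqP -> /eqP ->]; exact: F0sub.
move=> ij xi yj; split=> [|s sS].
  case: i ij xi => [|i] ij xi; last by case: xi => xi _; apply: (IH i j) => //; case: ij.
  by case: j ij yj => // j [jm] [yj _]; apply: (IH 0%N j).
rewrite jacl; apply: filB.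
  case: j ij yj => [|j] ij yj; last first.
    by case: yj => _ yS; apply: (IH i j) => //; [move: ij; rewrite addnS => -[]|exact: yS].
  case: i ij xi => // i; rewrite addn0 => -[->] [_]; apply.
  by apply: ideal_r => //; exact: fil_mem yj.
case: i ij xi => [|i] ij xi; last first.
  by case: xi => _ xS; apply: (IH j i) => //; [move: ij; rewrite addSn addnC => -[]|exact: xS].
case: j ij yj => // j [->] [_]; apply.
by apply: ideal_r => //; exact: fil_mem xi.
Qed.

Lemma fil_br i j x y : fil i x -> fil j y -> fil (i + j) (br x y).
Proof. exact: fil_br_eq. Qed.

(** If two consecutive levels agree, that level is an ideal inside [F0], because [C] commutes with
    it, hence is 0. Otherwise dimensions would drop forever. *)
Lemma fil_separated : exists N, forall x, fil N x -> x = 0.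
Proof.
have filV j : exists V : {vspace g}, forall x, x \in V <-> fil j x.
  by apply: vspace_of_pred; [exact: fil0|move=> *; exact: fil_lin].
have [[j jstab]|nstab] := pselect (exists j, forall x, fil j x -> fil j.+1 x).
  exists j; have [V VP] := filV j => x /VP; rewrite (core0 (I := V)) ?memv0 => [/eqP//| |].
    move=> a y /VP yj; have [s sS [c cC ->]] := SCdec a.
    rewrite brDl [br c _]br_anti (SC (fil_mem yj) cC) oppr0 addr0 br_anti memvN.
    by apply/VP; have [_] := jstab _ yj; apply.
  by apply/subvP => y /VP; elim: (j) => // k IH [/IH].
have filW j : exists2 V : {vspace g}, forall x, x \in V <-> fil j x & (\dim V + j <= \dim F0)%N.
  elim: j => [|j [V VP Vd]]; first by exists F0; rewrite ?addn0.
  have [W WP] := filV j.+1; exists W => //; rewrite addnS (leq_trans _ Vd)// ltn_add2r.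
  have WV : (W <= V)%VS by apply/subvP => x /WP[xj _]; apply/VP.
  rewrite ltn_neqAle dimvS// andbT; apply/eqP => dWV; apply: nstab; exists j.
  have /eqP WVE : W == V by rewrite eqEdim WV dWV leqnn.
  by move=> x /VP; rewrite -WVE => /WP.
have [V _] := filW (\dim F0).+1.
by rewrite addnS ltnNge leq_addl.
Qed.

(** The levels shifted by one, so that [S] itself, of degree -1, has an index. *)
Let lev j x : Prop := if j is j'.+1 then fil j' x else x \in S.

(** A product of two [ad] matrices that raises every level is nilpotent by [fil_separated], hence
    has trace 0. *)
Lemma killing_shift z x : (forall v, br z (br x v) \in S) ->
  (forall j v, lev j v -> lev j.+1 (br z (br x v))) -> killing x z = 0.
Proof.
move=> zxS zxlev; have [N N0] := fil_separated.
(* One application lands in [S], which is [lev 0]; the other N + 1 lead to [lev N.+1], that is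
   [fil N]. *)
apply: (@nilpotent_trace _ _ _ N.+2) => v; apply: N0; rewrite -/(lev N.+1 _).
elim: N.+1 => [|k IH]; rewrite iterS mulmxA !mul_ad; first exact: zxS.
exact: zxlev.
Qed.

Lemma killing_SC s c : s \in S -> c \in C -> killing s c = 0.
Proof.
move=> sS cC; rewrite /killing; have -> : ad s *m ad c = 0; last exact: mxtrace0.
apply/row_matrixP => i; rewrite rowE mulmxA !mul_ad row0 br_anti SC ?oppr0//.
exact: ideal_r.
Qed.

(** Bracketing with [S] lowers the level by at most one and bracketing with [z] raises it by two, so
    [killing_shift] makes [z] orthogonal to [S]; it is orthogonal to [C] as well. *)
Lemma fil2_eq0 z : fil 2 z -> z = 0.
Proof.
move=> z2; have zS := fil_mem z2.
apply: killing_nondegenerate => y; have [s sS [c cC ->]] := SCdec y.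
rewrite killingDr (killing_SC zS cC) addr0 killingC.
have [_ zS1] := z2.
apply: killing_shift => [v|j v].
  by apply: ideal_r.
case: j => [|j] vj /=.
  by have [] := zS1 (br s v) (ideal_r _ Si sS).
case: j vj => [|j] vj; first by apply: zS1; exact: ideal_r.
apply: (@fil_br 2 j _ _ z2); rewrite br_anti; apply: filN.
by have [_] := vj; apply.
Qed.

Lemma killing_fil10 z x : fil 1 z -> fil 0 x -> killing z x = 0.
Proof.
move=> z1 x0; have [_ zS] := z1; rewrite killingC.
have xS := fil_mem x0.
apply: killing_shift => [v|j v].
  by apply: ideal_r => //; exact: fil_mem z1.
case: j => [|j] vj; first by apply: zS; exact: ideal_r.
by apply: (@fil_br 1 j _ _ z1); exact: (@fil_br 0 j).
Qed.

End Filtration.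

(* [e i j] plays the role of the matrix unit of [gl_m] modulo scalar matrices. *)
Definition sl_system m (e : 'I_m -> 'I_m -> g) S :=
  [/\ forall i j k l, br (e i j) (e k l) =
        (j == k)%:R *: e i l - (l == i)%:R *: e k j,
      \sum_i e i i = 0,
      forall i j, e i j \in S,
      forall x, x \in S -> exists X : 'M[F]_m, x = \sum_i \sum_j X i j *: e i j
    & forall i j, i != j -> e i j != 0].

Lemma sl2_triple_system S (x h y : g) :
  br h x = 2 *: x -> br h y = - 2 *: y -> br x y = h ->
  [/\ x \in S, h \in S & y \in S] -> x != 0 -> y != 0 ->
  (forall z, z \in S -> exists a b c, z = a *: x + b *: h + c *: y) ->
  exists e : 'I_2 -> 'I_2 -> g, sl_system e S.
Proof.
move=> hx hy xy [xS hS yS] x0 y0 span.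
pose e (i j : 'I_2) := if i == 0 then if j == 0 then 2^-1 *: h else x
  else if j == 0 then y else - 2^-1 *: h.
have xh : br x h = - 2 *: x by rewrite br_anti hx scaleNr.
have yh : br y h = 2 *: y by rewrite br_anti hy scaleNr opprK.
have yx : br y x = - h by rewrite br_anti xy.
exists e; split.
- move=> i j k l.
  case: (ord2_cases i) => ->; case: (ord2_cases j) => ->;
    case: (ord2_cases k) => ->; case: (ord2_cases l) => ->;
    rewrite /e /= ?brZl ?brZr ?hx ?hy ?xy ?xh ?yh ?yx ?(lie_alt brP);
    by apply/rowP => p; rewrite !mxE; field.
- by rewrite !big_ord_recl big_ord0 /e/= addr0 scaleNr subrr.
- by move=> i j; rewrite /e; case: ifP => _; case: ifP => _ //; exact: memvZ.
- move=> z /span[a [b [c ->]]].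
  exists (\matrix_(i, j) if i == 0 then if j == 0 then b *+ 2 else a
    else if j == 0 then c else 0).
  rewrite !big_ord_recl !big_ord0 /e !mxE/=.
  by apply/rowP => p; rewrite !mxE; field.
- by move=> i j; case: (ord2_cases i) => ->; case: (ord2_cases j) => ->.
Qed.

Lemma codim1_sl2 (S C F0 : {vspace g}) y : ideal S ->
  (forall s c, s \in S -> c \in C -> br s c = 0) ->
  (forall x, exists2 s, s \in S & exists2 c, c \in C & x = s + c) ->
  subalgebra F0 -> (F0 <= S)%VS ->
  (forall I, ideal I -> (I <= F0)%VS -> I = 0%VS) ->
  y \in S -> y \notin F0 -> (forall x, x \in S -> exists a, x - a *: y \in F0) ->
  exists e : 'I_2 -> 'I_2 -> g, sl_system e S.
Proof.
move=> Si SC SCdec F0sub F0S core0 yS yF0 ydec.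
pose fl := fil S F0.
have flmem := @fil_mem S F0 F0S.
have flbr := @fil_br S F0 Si F0sub F0S.
have fl2 := fil2_eq0 Si SC SCdec F0sub F0S core0.
have yscal a : a *: y \in F0 -> a = 0.
  move=> ayF; apply/eqP; apply: contraNT yF0 => a0.
  by rewrite -[y]scale1r -(mulVf a0) -scalerA memvZ.
have fl1 w : w \in F0 -> br w y \in F0 -> fl 1 w.
  move=> wF wy; split=> // s /ydec[a saF]; rewrite -(subrK (a *: y) s) brDr brZr.
  by rewrite /= memvD ?memvZ// F0sub.
have wt w : w \in F0 -> exists a, br w y - a *: y \in F0.
  by move=> wF; apply: ydec; exact: Si.
(* Otherwise [F0] acts faithfully on the line S / F0, so [S] has dimension at most 2 and contains a
   stable line; such a line is an abelian ideal. *)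
have [z [z1 z0]] : exists z, fl 1 z /\ z != 0.
  have [//|nz] := pselect (exists z, fl 1 z /\ z != 0); exfalso.
  have no1 z : fl 1 z -> z = 0.
    by move=> z1; apply/eqP; apply: contraT => z0; case: nz; exists z.
  have S0 : forall u, u \in S -> (forall a, a \in S -> exists b, br a u = b *: u) -> u = 0.
    move=> u uS ub; have : <[u]>%VS = 0%VS.
      apply: ss => [a v /vlineP[k ->]|v w /vlineP[k ->] /vlineP[l ->]]; last first.
        by rewrite brZl brZr (lie_alt brP) !scaler0.
      have [s sS [c cC ->]] := SCdec a.
      rewrite brZr memvZ// brDl [br c u]br_anti (SC u c)// oppr0 addr0.
      by have [b ->] := ub s sS; rewrite memvZ ?memv_line.
    by move=> u0; apply/eqP; rewrite -memv0 -u0 memv_line.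
  have [F00|] := eqVneq F0 0%VS.
    move: yF0; rewrite (S0 y yS) ?mem0v// => a /ydec[b].
    rewrite F00 memv0 subr_eq0 => /eqP ->; exists 0.
    by rewrite brZl (lie_alt brP) scaler0 scale0r.
  rewrite -vpick0; have := memv_pick F0; move: (vpick F0) => w wF w0.
  have [t wyt] := wt w wF.
  have t0 : t != 0.
    apply/eqP => t0; move: w0; rewrite (no1 w) ?eqxx//; apply: fl1 => //.
    by move: wyt; rewrite t0 scale0r subr0.
  have Fw x : x \in F0 -> exists a, x = a *: w.
    move=> xF; have [r xyr] := wt x xF; exists (r / t).
    apply/eqP; rewrite -subr_eq0; apply/eqP/no1/fl1; first by rewrite memvB// memvZ.
    have -> : br (x - (r / t) *: w) y = (br x y - r *: y) - (r / t) *: (br w y - t *: y).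
      by rewrite brBl brZl; apply/rowP => p; rewrite !mxE; field.
    by rewrite memvB// memvZ.
  have [c wyc] := Fw _ wyt.
  have wyE : br w y = t *: y + c *: w by rewrite -wyc addrC subrK.
  have : br w y = 0.
    apply: S0 => [|a /ydec[b /Fw[d abd]]]; first exact: Si.
    exists (d * t - b * c); have -> : a = d *: w + b *: y by rewrite -abd subrK.
    rewrite wyE brDl !brZl !brDr !brZr !(lie_alt brP) (br_anti y w) wyE.
    by apply/rowP => p; rewrite !mxE; ring.
  rewrite wyE => /eqP; rewrite addr_eq0 => /eqP tyw.
  by move: t0; rewrite (yscal t) ?eqxx// tyw memvN memvZ.
have zF : z \in F0 by case: z1.
pose h0 := br z y.
have h0F : h0 \in F0 by case: z1 => _; apply.
have [t h0t] := wt h0 h0F.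
(* [S] is spanned by [F0] and [y], so h0 in level 1 would put [z] in level 2, which is 0. *)
have n_fl1 : ~ fl 1 h0.
  move=> h01; move: z0; rewrite (fl2 z) ?eqxx//; split=> // s /ydec[a saF].
  rewrite -(subrK (a *: y) s) brDr brZr.
  by apply: filD; [exact: (flbr 1 0)%N|exact: filZ].
have t0 : t != 0.
  apply/eqP => t0; apply: n_fl1; apply: fl1 => //.
  by move: h0t; rewrite t0 scale0r subr0.
(* The factor makes [h] act on S / F0 by -2, the weight of the lowering element of an sl_2
   triple. *)
pose x := (- 2 / t) *: z; pose h := br x y.
have cn0 : - 2 / t != 0 :> F by rewrite mulf_neq0 ?invr_eq0// oppr_eq0 pnatr_eq0.
have hE : h = (- 2 / t) *: h0 by rewrite /h brZl.
have x1 : fl 1 x by exact: filZ.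
have xF : x \in F0 by case: x1.
have hF : h \in F0 by rewrite hE memvZ.
have x0 : x != 0 by rewrite scaler_eq0 negb_or cn0.
have xyE : br x y = h by [].
clearbody h; clearbody x.
have hyF : br h y + 2 *: y \in F0.
  have -> : br h y + 2 *: y = (- 2 / t) *: (br h0 y - t *: y).
    by rewrite hE brZl; apply/rowP => p; rewrite !mxE; field.
  by rewrite memvZ.
have fl1x w : fl 1 w -> exists a, w = a *: x.
  move=> w1; have wF : w \in F0 by case: w1.
  have wyF : br w y \in F0 by case: w1 => _; apply.
  have [r wr] := wt _ wyF; exists (- r / 2).
  have w2 : fl 1 (br (w - (- r / 2) *: x) y).
    apply: fl1; first by rewrite brBl brZl xyE memvB ?memvZ.
    have -> : br (br (w - (- r / 2) *: x) y) y =
      (br (br w y) y - r *: y) + (r / 2) *: (br h y + 2 *: y).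
      by rewrite !brBl !brZl xyE; apply/rowP => p; rewrite !mxE; field.
    by rewrite memvD ?memvZ.
  apply/eqP; rewrite -subr_eq0; apply/eqP/fl2; split=> [|s /ydec[a saF]].
    by apply: filB => //; exact: filZ.
  rewrite -(subrK (a *: y) s) brDr brZr.
  by apply: filD; [apply: (flbr 1 0)%N => //; apply: filB => //; exact: filZ|exact: filZ].
have F0E w : w \in F0 -> exists a b, w = a *: x + b *: h.
  move=> wF; have [r wr] := wt _ wF.
  have [|a wa] := fl1x (w + (r / 2) *: h).
    apply: fl1; first by rewrite memvD ?memvZ.
    have -> : br (w + (r / 2) *: h) y = (br w y - r *: y) + (r / 2) *: (br h y + 2 *: y).
      by rewrite brDl brZl; apply/rowP => p; rewrite !mxE; field.
    by rewrite memvD ?memvZ.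
  by exists a, (- (r / 2)); rewrite -wa scaleNr addrK.
have [b [a hya]] := F0E _ hyF.
have hyE : br h y = b *: x + a *: h - 2 *: y by rewrite -hya addrK.
have [c hxc] : exists c, br h x = c *: x by apply: fl1x; exact: (flbr 0 1)%N.
(* If c differed from 2, this would put [h], hence [h0], on the line of [x] and so in level 1. *)
have jac : (c - 2) *: h = (a * c) *: x.
  have := lie_jacobi brP y h x.
  rewrite (br_anti y h) hyE brNl brBl brDl !brZl hxc brZr !(br_anti y x) xyE brNr.
  rewrite !(lie_alt brP) => /rowP eq1.
  by apply/rowP => p; have := eq1 p; rewrite !mxE => E; apply: (eq_lin (-1) E); ring.
have c2 : c = 2.
  apply/eqP; rewrite -subr_eq0; apply: contraT => c20; exfalso; apply: n_fl1.
  have -> : h0 = (t / - 2) *: ((a * c / (c - 2)) *: x).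
    have -> : (a * c / (c - 2)) *: x = h.
      by rewrite mulrC -scalerA -jac scalerA mulVf// scale1r.
    by rewrite hE scalerA; apply/rowP => p; rewrite !mxE; field.
  by apply: filZ; exact: filZ.
have a0 : a = 0.
  move: jac => /esym/eqP; rewrite c2 subrr scale0r scaler_eq0 (negbTE x0) orbF.
  by rewrite mulf_eq0 pnatr_eq0 orbF => /eqP.
(* [ad h] acts by 2 on [x], so this shift removes the term [b *: x] from [br h y]; the divisor is 2
   - (-2). *)
pose y' := y - (b / 4) *: x.
apply: (@sl2_triple_system S x h y').
- by rewrite hxc c2.
- by rewrite /y' brBr brZr hxc c2 hyE a0; apply/rowP => p; rewrite !mxE; field.
- by rewrite /y' brBr brZr (lie_alt brP) scaler0 subr0.
- by split; [exact: (subvP F0S)|exact: (subvP F0S)|rewrite memvB// memvZ// (subvP F0S)].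
- by [].
- apply: contraNneq yF0 => /eqP; rewrite subr_eq0 => /eqP ->; exact: memvZ.
- move=> w /ydec[d wdF]; have [r [s wdE]] := F0E _ wdF.
  exists (r + d * b / 4), s, d; rewrite -(subrK (d *: y) w) wdE /y'.
  by apply/rowP => p; rewrite !mxE; field.
Qed.

(** * The isotropy representation on the tangent plane *)

Section Isotropy.
Variables (ev : g -> 'cV[F]_2) (K : {vspace g}).
Hypothesis ev_lin : forall a x y, ev (a *: x + y) = a *: ev x + ev y.
Hypothesis ev_surj : forall u, exists x, ev x = u.
Hypothesis KP : forall x, x \in K <-> ev x = 0.
Hypothesis Ksub : subalgebra K.
Hypothesis Kcore : forall I, ideal I -> (I <= K)%VS -> I = 0%VS.

Lemma evD x y : ev (x + y) = ev x + ev y.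
Proof. by have := ev_lin 1 x y; rewrite !scale1r. Qed.

Lemma ev0 : ev 0 = 0.
Proof. by apply/KP; rewrite mem0v. Qed.

Lemma evZ a x : ev (a *: x) = a *: ev x.
Proof. by have := ev_lin a x 0; rewrite ev0 !addr0. Qed.

Lemma evN x : ev (- x) = - ev x.
Proof. by rewrite -scaleN1r evZ scaleN1r. Qed.

Lemma evB x y : ev (x - y) = ev x - ev y.
Proof. by rewrite evD evN. Qed.

(** [ev] identifies g / K with the plane, and [A] is the map that [x] induces there; on [K] this is
    the isotropy representation. *)
Definition acts x (A : 'M[F]_2) := forall v, ev (br x v) = A *m ev v.

Lemma acts_lin a x y A B : acts x A -> acts y B -> acts (a *: x + y) (a *: A + B).
Proof. by move=> xA yB v; rewrite (lie_linl brP) ev_lin xA yB mulmxDl -scalemxAl. Qed.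

Lemma acts0 : acts 0 0.
Proof. by move=> v; rewrite br0l ev0 mul0mx. Qed.

Lemma actsZ a x A : acts x A -> acts (a *: x) (a *: A).
Proof. by move=> xA; have := acts_lin a xA acts0; rewrite !addr0. Qed.

Lemma actsD x y A B : acts x A -> acts y B -> acts (x + y) (A + B).
Proof. by move=> xA yB; have := acts_lin 1 xA yB; rewrite !scale1r. Qed.

Lemma actsN x A : acts x A -> acts (- x) (- A).
Proof. by move=> xA v; rewrite brNl evN xA mulNmx. Qed.

Lemma actsB x y A B : acts x A -> acts y B -> acts (x - y) (A - B).
Proof. by move=> xA yB; apply: actsD => //; exact: actsN. Qed.

Lemma acts_br x y A B : acts x A -> acts y B -> acts (br x y) (A *m B - B *m A).
Proof. by move=> xA yB v; rewrite jacl evB xA !yB xA mulmxBl !mulmxA. Qed.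

Lemma acts_uniq x A B : acts x A -> acts x B -> A = B.
Proof.
move=> xA xB; have E (u : 'cV_2) : A *m u = B *m u.
  by have [v <-] := ev_surj u; rewrite -xA -xB.
apply/matrixP => i j; have := E (delta_mx j 0); rewrite -!colE => /colP/(_ i).
by rewrite !mxE.
Qed.

Lemma acts_exists x : x \in K -> exists A, acts x A.
Proof.
move=> xK; have /choice[w wE] : forall j : 'I_2, exists w, ev w = delta_mx j 0.
  by move=> j; apply: ev_surj.
exists (\matrix_(i, j) ev (br x (w j)) i 0) => v.
pose v' := \sum_j (ev v j 0) *: w j.
have vv' : ev (br x (v - v')) = 0.
  apply/KP/Ksub => //; apply/KP; rewrite evB /v' big_ord2 evD !evZ !wE.
  apply/colP => i; rewrite !mxE; case: (ord2_cases i) => -> /=.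
    by rewrite !mulr1 mulr0 addr0 subrr.
  by rewrite !mulr1 mulr0 add0r subrr.
rewrite -[v in LHS](subrK v') brDr evD vv' add0r /v' big_ord2 brDr evD !brZr !evZ.
by apply/colP => i; rewrite mulmx2E !mxE mulrC; congr (_ + _); rewrite mulrC.
Qed.

Let fl := fil fullv K.
Let fullv_ideal : ideal fullv. Proof. by move=> x y _; exact: memvf. Qed.
Let br_0 s c : s \in (fullv : {vspace g}) -> c \in (0%VS : {vspace g}) -> br s c = 0.
Proof. by move=> _; rewrite memv0 => /eqP ->; exact: br0r. Qed.
Let dec_0 x : exists2 s, s \in (fullv : {vspace g}) &
  exists2 c, c \in (0%VS : {vspace g}) & x = s + c.
Proof. by exists x; rewrite ?memvf//; exists 0; rewrite ?mem0v ?addr0. Qed.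

Let fl2 z : fl 2 z -> z = 0.
Proof. exact: (fil2_eq0 fullv_ideal br_0 dec_0 Ksub (subvf K) Kcore). Qed.

Let fl_br i j x y : fl i x -> fl j y -> fl (i + j) (br x y).
Proof. exact: (fil_br fullv_ideal Ksub (subvf K)). Qed.

(** With its converse below: level 1 is the kernel of the isotropy representation. *)
Lemma acts0_fil1 x : x \in K -> acts x 0 -> fl 1 x.
Proof. by move=> xK x0; split=> // s _; apply/KP; rewrite x0 mul0mx. Qed.

Lemma fil1_acts0 x : fl 1 x -> acts x 0.
Proof. by move=> [_ xS] v; rewrite mul0mx; apply/KP/xS; exact: memvf. Qed.

Let killing_fil10 z x : fl 1 z -> x \in K -> killing z x = 0.
Proof. exact: (killing_fil10 fullv_ideal br_0 dec_0 Ksub (subvf K) Kcore). Qed.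

Hypothesis Kirr : forall u, u != 0 -> exists2 x, x \in K &
  exists2 v, ev v = u & ev (br x v) 0 0 * u 1 0 != ev (br x v) 1 0 * u 0 0.

Lemma acts_sl2 A : \tr A = 0 -> exists2 x, x \in K & acts x A.
Proof.
apply: (@irreducible_sl2 F (fun A => exists2 x, x \in K & acts x A)).
- move=> a B C [x xK xB] [y yK yC]; exists (a *: x + y); last exact: acts_lin.
  by rewrite memvD// memvZ.
- by move=> B C [x xK xB] [y yK yC]; exists (br x y); [exact: Ksub|exact: acts_br].
- move=> u /Kirr[x xK [v vu xv]]; have [B xB] := acts_exists xK.
  by exists B; [exists x|rewrite -vu -xB vu].
Qed.

Lemma killing_eigen h x y a b : br h x = a *: x -> br h y = b *: y ->
  a + b != 0 -> killing x y = 0.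
Proof.
move=> hx hy ab; apply: (mulfI ab); rewrite mulr0 mulrDl -killingZl -hx.
by rewrite br_anti killingNl killing_inv hy killingZr addNr.
Qed.

(* If the isotropy algebra acted faithfully on the tangent space, a weight
   vector of odd weight would be orthogonal to everything for the Killing
   form. *)
Lemma fil1_neq0 : exists2 z, fl 1 z & z != 0.
Proof.
have [//|nz] := pselect (exists2 z, fl 1 z & z != 0); exfalso.
have K0 x : x \in K -> acts x 0 -> x = 0.
  move=> xK x0; apply/eqP; apply: contraT => xn0; case: nz; exists x => //.
  exact: acts0_fil1.
have K0' x A : x \in K -> acts x A -> A = 0 -> x = 0.
  by move=> xK xA A0; apply: K0 => //; rewrite -A0.
have [|h hK hA] := @acts_sl2 (mx2 1 0 0 (-1)).
  by rewrite /mxtrace big_ord2 !mxE/= subrr.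
have [|e eK eA] := @acts_sl2 (mx2 0 1 0 0).
  by rewrite /mxtrace big_ord2 !mxE/= addr0.
have [|f fK fA] := @acts_sl2 (mx2 0 0 1 0).
  by rewrite /mxtrace big_ord2 !mxE/= addr0.
have K0B x y A B : x \in K -> y \in K -> acts x A -> acts y B -> A = B -> x = y.
  move=> xK yK xA yB AB; apply/eqP; rewrite -subr_eq0; apply/eqP.
  by apply: (K0' _ _ _ (actsB xA yB)); rewrite ?AB ?subrr// memvB.
have he : br h e = 2 *: e.
  apply: (K0B _ _ _ _ _ _ (acts_br hA eA) (actsZ 2 eA)); rewrite ?memvZ ?Ksub//.
  by apply: mx2P; rewrite !mx2E !mxE/=; ring.
have ef : br e f = h.
  apply: (K0B _ _ _ _ _ _ (acts_br eA fA) hA); rewrite ?Ksub//.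
  by apply: mx2P; rewrite !mx2E !mxE/=; ring.
(* [K] embeds in gl_2, where [ad h] has the eigenvalues 0, 2 and -2, so it satisfies t^3 = 4 t. *)
have h3 k : k \in K -> br h (br h (br h k)) = 4 *: br h k.
  have comm_h B : mx2 1 0 0 (-1) *m B - B *m mx2 1 0 0 (-1) =
      mx2 0 (2 * B 0 1) (- 2 * B 1 0) 0.
    by apply: mx2P; rewrite !mx2E !mxE/=; ring.
  move=> kK; have [A kA] := acts_exists kK; have hk := acts_br hA kA.
  apply: (K0B _ _ _ _ _ _ (acts_br hA (acts_br hA hk)) (actsZ 4 hk)).
  - by do !apply: Ksub => //.
  - by rewrite memvZ// Ksub.
  - by rewrite !comm_h; apply: mx2P; rewrite !mx2E !mxE/=; ring.
have hK_K k : k \in K -> br h k \in K by move=> kK; exact: Ksub.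
have hodd a k : k \in K -> br h k = a *: k -> a ^+ 3 != 4 * a -> k = 0.
  move=> kK hk a3; have := h3 k kK; rewrite hk brZr hk !brZr hk !scalerA -mulrA -expr2 -exprS.
  move/eqP; rewrite -subr_eq0 -scalerBl scaler_eq0 subr_eq0 (negbTE a3).
  by move/eqP.
have evh x : ev (br h x) = \col_i if i == 0 then ev x 0 0 else - ev x 1 0.
  rewrite hA; apply/colP => i; rewrite mulmx2E !mxE.
  by case: (ord2_cases i) => -> /=; rewrite ?mul1r ?mul0r ?addr0 ?add0r ?mulN1r.
have [v1 v1E] := ev_surj (delta_mx 0 0); have [v2 v2E] := ev_surj (delta_mx 1 0).
(* Lifts the tangent eigenvector to an exact one: k = (ad h - 1) v1 lies in [K], and modulo t^3 - 4
   t the inverse of t - 1 is (t^2 + t - 3) / 3. *)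
have [u1 u1E hu1] : exists2 u, ev u = delta_mx 0 0 & br h u = u.
  pose k := br h v1 - v1; have kK : k \in K.
    apply/KP; rewrite evB evh v1E; apply/colP => i; rewrite !mxE.
    by case: (ord2_cases i) => -> /=; ring.
  exists (v1 - 3^-1 *: (br h (br h k) + br h k - 3 *: k)).
    rewrite evB v1E; have /KP -> : 3^-1 *: (br h (br h k) + br h k - 3 *: k) \in K.
      by apply: memvZ; apply: memvB; [apply: memvD|apply: memvZ]; do ?apply: (hK_K).
    by rewrite subr0.
  rewrite brBr brZr brBr brDr brZr h3//.
  have -> : br h v1 = k + v1 by rewrite subrK.
  by apply/rowP => p; rewrite !mxE; field.
(* Likewise, the inverse of t + 1 modulo t^3 - 4 t is -(t^2 - t - 3) / 3. *)
have [u2 u2E hu2] : exists2 u, ev u = delta_mx 1 0 & br h u = - u.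
  pose k := br h v2 + v2; have kK : k \in K.
    apply/KP; rewrite evD evh v2E; apply/colP => i; rewrite !mxE.
    by case: (ord2_cases i) => -> /=; ring.
  exists (v2 + 3^-1 *: (br h (br h k) - br h k - 3 *: k)).
    rewrite evD v2E; have /KP -> : 3^-1 *: (br h (br h k) - br h k - 3 *: k) \in K.
      by apply: memvZ; apply: memvB; [apply: memvB|apply: memvZ]; do ?apply: (hK_K).
    by rewrite addr0.
  rewrite brDr brZr !brBr brZr h3//.
  have -> : br h v2 = k - v2 by rewrite addrK.
  by apply/rowP => p; rewrite !mxE; field.
(* The bracket lies in [K] and has weight 3, which does not occur there; for [eu2] the excluded
   weight is 1. *)
have eu1 : br e u1 = 0.
  apply: (hodd 3); last by rewrite -subr_eq0 (_ : _ - _ = 15%:R) ?pnatr_eq0//; ring.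
    apply/KP; rewrite eA u1E; apply/colP => i; rewrite mulmx2E !mxE/=.
    by case: (ord2_cases i) => -> /=; ring.
  by rewrite (lie_jacobi brP) he hu1 brZl; apply/rowP => p; rewrite !mxE; ring.
have eu2 : br e u2 = u1.
  apply/eqP; rewrite -subr_eq0; apply/eqP/(hodd 1).
  - apply/KP; rewrite evB eA u1E u2E; apply/colP => i; rewrite !mx2E !mxE/=.
    by case: (ord2_cases i) => -> /=; ring.
  - by rewrite brBr (lie_jacobi brP) he hu1 hu2 brZl brNr; apply/rowP => p; rewrite !mxE; ring.
  - by rewrite -subr_eq0 (_ : _ - _ = - 3%:R) ?oppr_eq0 ?pnatr_eq0//; ring.
have ew : br e (br u1 u2) = 0 by rewrite (lie_jacobi brP) eu1 eu2 br0l (lie_alt brP) addr0.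
(* Opposite weights need another argument: write [h] as [e, f] and use that [e] kills [u1, u2]. *)
have k12 : killing u1 u2 = 0.
  have <- : killing (br u1 u2) h = killing u1 u2.
    by rewrite killing_inv (br_anti u2) hu2 opprK.
  by rewrite -ef -killing_inv (br_anti _ e) ew oppr0 killing0l.
have k11 : killing u1 u1 = 0.
  apply: (@killing_eigen h _ _ 1 1); [by rewrite scale1r|by rewrite scale1r|].
  by rewrite -mulr2n pnatr_eq0.
have k1K k : k \in K -> killing u1 k = 0.
  move=> kK; have kh y : killing u1 (br h y) = - killing u1 y.
    by rewrite -killing_inv br_anti hu1 killingNl.
  have := congr1 (killing u1) (h3 k kK); rewrite killingZr !kh => E.
  apply: (mulfI (_ : 3%:R != 0)); first by rewrite pnatr_eq0.
  apply: (eq_lin 1 E); ring.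
have : u1 = 0.
  apply: killing_nondegenerate => y.
  have yK : y - (ev y 0 0 *: u1 + ev y 1 0 *: u2) \in K.
    apply/KP; rewrite evB evD !evZ u1E u2E; apply/colP => i; rewrite !mxE.
    by case: (ord2_cases i) => -> /=; ring.
  rewrite -(subrK (ev y 0 0 *: u1 + ev y 1 0 *: u2) y).
  by rewrite killingDr (k1K _ yK) killingDr !killingZr k11 k12 !mulr0 !addr0.
move=> u10; move: u1E; rewrite u10 ev0 => /matrixP/(_ 0 0)/eqP.
by rewrite !mxE eq_sym oner_eq0.
Qed.

(** * Level 1 as the dual plane, and the grading of sl_3 *)

Lemma ord3_cases (i : 'I_3) : [\/ i = 0, i = 1 | i = 2].
Proof.
by case: i => [[|[|[|//]]] ?]; [apply: Or31|apply: Or32|apply: Or33]; apply: val_inj.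
Qed.

(** In block form modulo scalars: [k] is the upper left 2x2 block, [w] the last column and [z] the
    last row up to the factor -1 / c. The corner is forced by the vanishing of the sum of the
    diagonal units. *)
Lemma sl3_grading_system (w z : 'I_2 -> g) (k : 'I_2 -> 'I_2 -> g) c : c != 0 ->
  (forall i j l m, br (k i j) (k l m) = (j == l)%:R *: k i m - (m == i)%:R *: k l j) ->
  (forall i j m, br (k i j) (w m) = (j == m)%:R *: w i) ->
  (forall i j m, br (k i j) (z m) = - (i == m)%:R *: z j) ->
  (forall i j, br (w i) (w j) = 0) -> (forall i j, br (z i) (z j) = 0) ->
  (forall i j, br (z i) (w j) = c *: ((i == j)%:R *: (k 0 0 + k 1 1) + k j i)) ->
  (forall x, exists a b (A : 'M[F]_2),
    x = \sum_i a i *: w i + \sum_i b i *: z i + \sum_i \sum_j A i j *: k i j) ->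
  (forall i, w i != 0) -> (forall i, z i != 0) -> k 0 1 != 0 -> k 1 0 != 0 ->
  exists e : 'I_3 -> 'I_3 -> g, sl_system e fullv.
Proof.
move=> c0 kk kw kz ww zz zw span w0 z0 k01 k10.
pose lo (i : 'I_3) : 'I_2 := if i == 0 then 0 else 1.
pose e (i j : 'I_3) := if i == 2 then if j == 2 then - (k 0 0 + k 1 1) else (- c^-1) *: z (lo j)
  else if j == 2 then w (lo i) else k (lo i) (lo j).
have wk i j m : br (w m) (k i j) = - (j == m)%:R *: w i by rewrite br_anti kw scaleNr.
have zk i j m : br (z m) (k i j) = (i == m)%:R *: z j by rewrite br_anti kz scaleNr opprK.
have wz i j : br (w j) (z i) = (- c) *: ((i == j)%:R *: (k 0 0 + k 1 1) + k j i).
  by rewrite br_anti zw scaleNr.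
exists e; split.
- move=> i j l m.
  case: (ord3_cases i) => ->; case: (ord3_cases j) => ->;
    case: (ord3_cases l) => ->; case: (ord3_cases m) => ->;
    rewrite /e /lo /= ?(brNl, brNr, brDl, brDr, brZl, brZr)
      ?(kk, kw, kz, ww, zz, zw, wk, zk, wz) /=;
    by apply/rowP => p; rewrite !mxE; field.
- rewrite !big_ord_recl big_ord0 /e /lo /= addr0.
  by apply/rowP => p; rewrite !mxE; ring.
- by move=> i j; exact: memvf.
- move=> x _; have [a [b [A ->]]] := span x.
  exists (\matrix_(i, j) if i == 2 then if j == 2 then 0 else - c * b (lo j)
    else if j == 2 then a (lo i) else A (lo i) (lo j)).
  rewrite !big_ord2 !big_ord_recl !big_ord0 /e /lo !mxE /=.
  by apply/rowP => p; rewrite !mxE; field.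
- move=> i j; case: (ord3_cases i) => ->; case: (ord3_cases j) => -> //= _;
    by rewrite /e /lo /= ?scaler_eq0 ?negb_or ?oppr_eq0 ?invr_eq0 ?c0 /=.
Qed.

Lemma killing_inj x y : (forall v, killing x v = killing y v) -> x = y.
Proof.
move=> xy; apply/eqP; rewrite -subr_eq0; apply/eqP/killing_nondegenerate => v.
by rewrite killingDl killingNl xy subrr.
Qed.

(** Level 1 is orthogonal to [K], so its elements are functionals on the tangent plane. One nonzero
    functional suffices, since [e] and [f] move it to multiples of both coordinates. *)
Lemma killing_dual : exists z : 'I_2 -> g,
  [/\ forall i, fl 1 (z i), forall i x, killing (z i) x = ev x i 0
    & forall y, fl 1 y -> exists a, y = \sum_i a i *: z i].
Proof.
have /choice[v vE] : forall j : 'I_2, exists v, ev v = delta_mx j 0.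
  by move=> j; apply: ev_surj.
have coord y x : fl 1 y ->
    killing y x = killing y (v 0) * ev x 0 0 + killing y (v 1) * ev x 1 0.
  move=> y1; have xK : x - (ev x 0 0 *: v 0 + ev x 1 0 *: v 1) \in K.
    apply/KP; rewrite evB evD !evZ !vE; apply/colP => i; rewrite !mxE.
    by case: (ord2_cases i) => -> /=; ring.
  rewrite -[in LHS](subrK (ev x 0 0 *: v 0 + ev x 1 0 *: v 1) x).
  rewrite killingDr (killing_fil10 y1 xK) add0r killingDr !killingZr.
  by rewrite ![_ * killing _ _]mulrC.
have [|e eK eA] := @acts_sl2 (mx2 0 1 0 0).
  by rewrite /mxtrace big_ord2 !mxE/= addr0.
have [|f fK fA] := @acts_sl2 (mx2 0 0 1 0).
  by rewrite /mxtrace big_ord2 !mxE/= addr0.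
have br1 k y : k \in K -> fl 1 y -> fl 1 (br k y) by move=> kK; exact: (@fl_br 0 1).
have ke y x : killing (br e y) x = - killing y (br e x).
  by rewrite br_anti killingNl killing_inv.
have kf y x : killing (br f y) x = - killing y (br f x).
  by rewrite br_anti killingNl killing_inv.
have [y y1 yn0] := fil1_neq0.
pose good (i : 'I_2) z := fl 1 z /\ forall x, killing z x = ev x i 0.
have good_e z : good 0 z -> good 1 (- br e z).
  move=> [z1 zE]; split=> [|x]; first by apply: filN; exact: br1.
  rewrite killingNl ke opprK zE eA mulmx2E !mxE/=; ring.
have good_f z : good 1 z -> good 0 (- br f z).
  move=> [z1 zE]; split=> [|x]; first by apply: filN; exact: br1.
  rewrite killingNl kf opprK zE fA mulmx2E !mxE/=; ring.
have [z0 [z1 [gz0 gz1]]] : exists z0 z1, good 0 z0 /\ good 1 z1.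
  suff [[z gz]|[z gz]] : (exists z, good 0 z) \/ (exists z, good 1 z).
  - by exists z, (- br e z); split=> //; exact: good_e.
  - by exists (- br f z), z; split=> //; exact: good_f.
  have [y0|y0] := eqVneq (killing y (v 0)) 0; last first.
    right; exists (- (killing y (v 0))^-1 *: br e y); split.
      by apply: filZ; exact: br1.
    move=> x; rewrite killingZl ke (coord y (br e x) y1) eA !mulmx2E !mxE/=.
    by field.
  have yv1 : killing y (v 1) != 0.
    apply: contraNneq yn0 => yv1; apply/eqP/killing_nondegenerate => x.
    by rewrite (coord _ _ y1) y0 yv1 !mul0r addr0.
  left; exists (- (killing y (v 1))^-1 *: br f y); split.
    by apply: filZ; exact: br1.
  move=> x; rewrite killingZl kf (coord y (br f x) y1) y0 fA !mulmx2E !mxE/=.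
  by field.
exists (fun i => if i == 0 then z0 else z1); split.
- by move=> i; case: (ord2_cases i) => -> /=; [case: gz0|case: gz1].
- by move=> i; case: (ord2_cases i) => -> /=; [case: gz0|case: gz1].
- move=> u u1; exists (fun i => killing u (v i)); rewrite big_ord2/=.
  apply: killing_inj => x; rewrite killingDl !killingZl (coord _ _ u1).
  by case: gz0 => _ ->; case: gz1 => _ ->.
Qed.

Lemma acts_dual k A (z : 'I_2 -> g) : acts k A -> (forall i x, killing (z i) x = ev x i 0) ->
  forall i, br k (z i) = - \sum_j A i j *: z j.
Proof.
move=> kA zE i; apply: killing_inj => x.
rewrite br_anti !killingNl killing_inv zE kA mulmx2E big_ord2 killingDl !killingZl.
by rewrite !zE.
Qed.

(* The brackets [z_i, v_j] are forced by equivariance under [sl_2]. *)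
Lemma fil1_bracket (z v : 'I_2 -> g) : (forall i, fl 1 (z i)) ->
  (forall i x, killing (z i) x = ev x i 0) -> (forall j, ev (v j) = delta_mx j 0) ->
  exists2 c, c != 0 &
    forall i j, acts (br (z i) (v j)) (c *: ((i == j)%:R *: 1%:M + delta_mx j i)).
Proof.
move=> z1 zE vE.
have zK i x : br (z i) x \in K by have [_ h] := z1 i; apply: h; exact: memvf.
have /choice[B0 B0E] : forall ij : 'I_2 * 'I_2, exists A, acts (br (z ij.1) (v ij.2)) A.
  by move=> ij; apply: acts_exists.
pose B i j := B0 (i, j); have BE i j : acts (br (z i) (v j)) (B i j) := B0E (i, j).
(* [z_i, [v_j, v_k]] lies in [K], so by Jacobi its tangent value 0 gives a symmetry in j and k. *)
have sym i j k l : B i j l k = B i k l j.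
  have : ev (br (z i) (br (v j) (v k))) = 0 by apply/KP.
  rewrite (lie_jacobi brP) evD (br_anti (v j)) evN BE BE !vE -!colE => /eqP.
  by rewrite subr_eq0 => /eqP/colP/(_ l); rewrite !mxE.
(* [br x (v j)] is known only modulo [K], which is harmless: [z_i, K] lies in level 1 and acts by
   0. *)
have equi x X : x \in K -> acts x X -> forall i j,
    X *m B i j - B i j *m X = - (X i 0 *: B 0 j + X i 1 *: B 1 j)
      + (X 0 j *: B i 0 + X 1 j *: B i 1).
  move=> xK xX i j; apply: (acts_uniq (acts_br xX (BE i j))).
  rewrite (lie_jacobi brP) (acts_dual xX zE) big_ord2 brNl brDl !brZl.
  apply: actsD.
    by apply: actsN; apply: actsD; apply: actsZ.
  have vK : br x (v j) - (X 0 j *: v 0 + X 1 j *: v 1) \in K.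
    apply/KP; rewrite evB evD !evZ xX !vE; apply/colP => l.
    rewrite !mx2E !mxE; case: (ord2_cases l) => ->; case: (ord2_cases j) => -> /=; ring.
  rewrite -(subrK (X 0 j *: v 0 + X 1 j *: v 1) (br x (v j))) brDr.
  rewrite -[X in acts _ X]add0r; apply: actsD.
    by apply: fil1_acts0; exact: (@fl_br 1 0).
  by rewrite brDr !brZr; apply: actsD; apply: actsZ.
have [|h hK hA] := @acts_sl2 (mx2 1 0 0 (-1)).
  by rewrite /mxtrace big_ord2 !mxE/= subrr.
have [|e eK eA] := @acts_sl2 (mx2 0 1 0 0).
  by rewrite /mxtrace big_ord2 !mxE/= addr0.
have entry i j a b := congr1 (fun M : 'M[F]_2 => M a b) (equi _ _ hK hA i j).
have entry' i j a b := congr1 (fun M : 'M[F]_2 => M a b) (equi _ _ eK eA i j).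
have n2 (x : F) : 2 * x = 0 -> x = 0.
  by move/eqP; rewrite mulf_eq0 pnatr_eq0/= => /eqP.
(* The equation for the diagonal [h] multiplies each entry by its weight, so entries of nonzero
   weight vanish; the equation for [e] relates the remaining ones. *)
have B00_01 : B 0 0 0 1 = 0.
  apply: n2; have := entry 0 0 0 1; rewrite !mx2E !mxE/= => E.
  by apply: (eq_lin 1 E); ring.
have B00_10 : B 0 0 1 0 = 0.
  apply: n2; have := entry 0 0 1 0; rewrite !mx2E !mxE/= => E.
  by apply: (eq_lin (-1) E); ring.
have B11_01 : B 1 1 0 1 = 0.
  apply: n2; have := entry 1 1 0 1; rewrite !mx2E !mxE/= => E.
  by apply: (eq_lin 1 E); ring.
have B11_10 : B 1 1 1 0 = 0.
  apply: n2; have := entry 1 1 1 0; rewrite !mx2E !mxE/= => E.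
  by apply: (eq_lin (-1) E); ring.
have B01_00 : B 0 1 0 0 = 0 by rewrite sym.
have B01_11 : B 0 1 1 1 = 0.
  apply: n2; have := entry 0 1 1 1; rewrite !mx2E !mxE/= => E.
  by apply: (eq_lin 1 E); ring.
have B01_01 : B 0 1 0 1 = 0.
  apply: (n2); apply: n2; have := entry 0 1 0 1; rewrite !mx2E !mxE/= => E.
  by apply: (eq_lin 1 E); ring.
have B10_11 : B 1 0 1 1 = 0 by rewrite sym.
have B10_00 : B 1 0 0 0 = 0.
  apply: n2; have := entry 1 0 0 0; rewrite !mx2E !mxE/= => E.
  by apply: (eq_lin (-1) E); ring.
have B10_10 : B 1 0 1 0 = 0.
  apply: (n2); apply: n2; have := entry 1 0 1 0; rewrite !mx2E !mxE/= => E.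
  by apply: (eq_lin (-1) E); ring.
pose c := B 1 0 0 1.
have B11_00 : B 1 1 0 0 = c by rewrite /c sym.
have B01_10 : B 0 1 1 0 = B 0 0 1 1 by rewrite sym.
have B00_00 : B 0 0 0 0 = B 0 0 1 1 + c.
  have := entry' 0 0 0 1; rewrite !mx2E !mxE/= => E.
  by apply: (eq_lin (-1) E); rewrite /c; ring.
have B11_11 : B 1 1 1 1 = 2 * c.
  have := entry' 1 1 0 1; rewrite !mx2E !mxE/= B11_00 -/c => E.
  by apply: (eq_lin 1 E); ring.
have B00_11 : B 0 0 1 1 = c.
  have := entry' 0 1 1 1; rewrite !mx2E !mxE/= B01_10 B11_11 => E.
  by apply: (eq_lin (- 2^-1) E); field.
have BF i j : B i j = c *: ((i == j)%:R *: 1%:M + delta_mx j i).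
  case: (ord2_cases i) => ->; case: (ord2_cases j) => ->; apply: mx2P;
    rewrite !mx2E !mxE/= ?(B00_01, B00_10, B11_01, B11_10, B01_00, B01_11, B01_01)
    ?(B10_11, B10_00, B10_10, B01_10, B11_11, B00_00, B11_00) ?B00_11 -/c; ring.
exists c; last by move=> i j; rewrite -BF.
(* With c = 0 all [z_0, v_j] would lie in level 1, so [z 0] would lie in level 2 and vanish. *)
apply/eqP => c0.
have : z 0 = 0.
  apply: fl2; split=> // s _.
  have sK : s - (ev s 0 0 *: v 0 + ev s 1 0 *: v 1) \in K.
    apply/KP; rewrite evB evD !evZ !vE; apply/colP => i; rewrite !mxE.
    by case: (ord2_cases i) => -> /=; ring.
  rewrite -(subrK (ev s 0 0 *: v 0 + ev s 1 0 *: v 1) s) brDr.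
  apply: filD; first exact: (@fl_br 1 0).
  have z0v j : fl 1 (br (z 0) (v j)).
    by apply: acts0_fil1; [exact: zK|have := BE 0 j; rewrite BF c0 scale0r].
  by rewrite brDr !brZr; apply: filD; apply: filZ; exact: z0v.
move=> z00; have := zE 0 (v 0); rewrite z00 killing0l vE mxE/= => /esym/eqP.
by rewrite oner_eq0.
Qed.

Lemma primitive_sl3 : exists e : 'I_3 -> 'I_3 -> g, sl_system e fullv.
Proof.
have [z [z1 zE fil1z]] := killing_dual.
have /choice[v vE] : forall j : 'I_2, exists v, ev v = delta_mx j 0.
  by move=> j; apply: ev_surj.
have [c c0 zvA] := fil1_bracket z1 zE vE.
have zK i x : br (z i) x \in K by have [_ h] := z1 i; apply: h; exact: memvf.
have c3 : 3 * c != 0 by rewrite mulf_neq0 ?pnatr_eq0.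
(* The Euler element: the matrices of [z_0, v_0] and [z_1, v_1] add up to 3 c times the identity. *)
have [E EK EA] : exists2 E, E \in K & acts E (-1 *: 1%:M).
  exists (- (3 * c)^-1 *: (br (z 0) (v 0) + br (z 1) (v 1))).
    by rewrite memvZ// memvD.
  have -> : -1 *: 1%:M = - (3 * c)^-1 *: (c *: ((0 == 0 :> 'I_2)%:R *: 1%:M + delta_mx 0 0) +
      c *: ((1 == 1 :> 'I_2)%:R *: 1%:M + delta_mx 1 1)) :> 'M[F]_2.
    by apply: mx2P; rewrite !mx2E !mxE/=; field.
  by apply: actsZ; exact: actsD.
have evE x : ev (br E x) = - ev x by rewrite EA -scalemxAl mul1mx scaleN1r.
have EK1 k : k \in K -> fl 1 (br E k).
  move=> kK; apply: acts0_fil1; first exact: Ksub.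
  have [A kA] := acts_exists kK; have := acts_br EA kA.
  by rewrite scaleN1r mulNmx mulmxN mul1mx mulmx1 opprK addNr.
have Ez i : br E (z i) = z i.
  rewrite (acts_dual EA zE) big_ord2 !mxE.
  by case: (ord2_cases i) => -> /=; apply/rowP => p; rewrite !mxE; ring.
have E1 y : fl 1 y -> br E y = y.
  by move=> /fil1z[a ->]; rewrite big_ord2 brDr !brZr !Ez.
have Ek k : k \in K -> br E (k - br E k) = 0.
  by move=> kK; rewrite brBr (E1 (br E k)) ?subrr//; exact: EK1.
(* Lifts to exact eigenvectors: on [K] the operator t = ad E satisfies t^2 = t, so the inverse of t
   + 1 is 1 - t / 2. *)
have [w wE Ew] : exists2 w : 'I_2 -> g, forall j, ev (w j) = delta_mx j 0
    & forall j, br E (w j) = - w j.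
  have vK j : br E (v j) + v j \in K by apply/KP; rewrite evD evE addNr.
  exists (fun j => v j - (br E (v j) + v j) + 2^-1 *: br E (br E (v j) + v j)) => j.
    have /KP kK := vK j; have [/KP yK _] := EK1 _ (vK j).
    by rewrite evD evB kK evZ yK scaler0 addr0 subr0.
  have := E1 _ (EK1 _ (vK j)); set y := br E (br E (v j) + v j) => Ey.
  rewrite brDr brBr brZr Ey -/y.
  by apply/rowP => p; rewrite !mxE; field.
have [|h hK hA] := @acts_sl2 (mx2 1 0 0 (-1)).
  by rewrite /mxtrace big_ord2 !mxE/= subrr.
have [|e eK eA] := @acts_sl2 (mx2 0 1 0 0).
  by rewrite /mxtrace big_ord2 !mxE/= addr0.
have [|f fK fA] := @acts_sl2 (mx2 0 0 1 0).
  by rewrite /mxtrace big_ord2 !mxE/= addr0.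
have /choice[k0 k0P] : forall ij : 'I_2 * 'I_2, exists x,
    [/\ x \in K, acts x (delta_mx ij.1 ij.2) & br E x = 0].
  (* [E, x] lies in level 1: subtracting it keeps the isotropy matrix and puts [x] in weight 0. *)
  have lift A x : x \in K -> acts x A -> exists x, [/\ x \in K, acts x A & br E x = 0].
    move=> xK xA; exists (x - br E x); split; last exact: Ek.
      by rewrite memvB// Ksub.
    by rewrite -[A]subr0; apply: actsB => //; apply: fil1_acts0; exact: EK1.
  move=> [i j]; case: (ord2_cases i) => ->; case: (ord2_cases j) => -> /=.
  - apply: (lift _ (2^-1 *: (h - E))); first by rewrite memvZ// memvB.
    rewrite (_ : delta_mx _ _ = 2^-1 *: (mx2 1 0 0 (-1) - (-1 *: 1%:M))).
      by apply: actsZ; exact: actsB.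
    by apply: mx2P; rewrite !mx2E !mxE/=; field.
  - apply: (lift _ e) => //; rewrite (_ : delta_mx _ _ = mx2 0 1 0 0)//.
    by apply: mx2P; rewrite !mxE.
  - apply: (lift _ f) => //; rewrite (_ : delta_mx _ _ = mx2 0 0 1 0)//.
    by apply: mx2P; rewrite !mxE.
  - apply: (lift _ (- 2^-1 *: (h + E))); first by rewrite memvZ// memvD.
    rewrite (_ : delta_mx _ _ = - 2^-1 *: (mx2 1 0 0 (-1) + (-1 *: 1%:M))).
      by apply: actsZ; exact: actsD.
    by apply: mx2P; rewrite !mx2E !mxE/=; field.
pose k i j := k0 (i, j).
have kK i j : k i j \in K by have [] := k0P (i, j).
have kA i j : acts (k i j) (delta_mx i j) by have [] := k0P (i, j).
have Ekij i j : br E (k i j) = 0 by have [] := k0P (i, j).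
(* [K] carries only the weights 0 and 1, and level 1 only the weight 1. Identities below are checked
   on tangent values or isotropy matrices, then completed by their weight. *)
have wt0 x A : x \in K -> acts x A -> A = 0 -> br E x = 0 -> x = 0.
  by move=> xK xA A0 <-; rewrite E1//; apply: acts0_fil1 => //; rewrite -A0.
have wtN x : ev x = 0 -> br E x = - x -> x = 0.
  move=> /KP xK Ex; have := EK1 x xK; rewrite Ex => /E1; rewrite brNr Ex opprK.
  move/eqP; rewrite -addr_eq0 -mulr2n -scaler_nat scaler_eq0 pnatr_eq0/=.
  by move/eqP.
have span x : exists a b (A : 'M[F]_2),
    x = \sum_i a i *: w i + \sum_i b i *: z i + \sum_i \sum_j A i j *: k i j.
  pose xw := \sum_i ev x i 0 *: w i.
  have xK : x - xw \in K.
    apply/KP; rewrite evB /xw big_ord2 evD !evZ !wE; apply/colP => i; rewrite !mxE.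
    by case: (ord2_cases i) => -> /=; ring.
  have [A xA] := acts_exists xK; pose xk := \sum_i \sum_j A i j *: k i j.
  have xkK : xk \in K by apply: memv_suml => i _; apply: memv_suml => j _; exact: memvZ.
  have xkA : acts xk A.
    rewrite [A]matrix_sum_delta /xk !big_ord2.
    by apply: actsD; apply: actsD; apply: actsZ; exact: kA.
  have [|b xb] := fil1z (x - xw - xk).
    apply: acts0_fil1; first by rewrite memvB.
    by rewrite -[0](subrr A); exact: actsB.
  exists (fun i => ev x i 0), b, A.
  have xE : x = xw + (x - xw - xk) + xk by rewrite [xw + _]addrC addrAC !subrK.
  by rewrite xb in xE.
have kw i j m : br (k i j) (w m) = (j == m)%:R *: w i.
  apply/eqP; rewrite -subr_eq0; apply/eqP/wtN.
    rewrite evB evZ kA !wE; apply/colP => l; rewrite !mx2E !mxE.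
    case: (ord2_cases i) => ->; case: (ord2_cases j) => ->;
      case: (ord2_cases l) => ->; case: (ord2_cases m) => -> /=; ring.
  rewrite brBr brZr (lie_jacobi brP) Ekij br0l add0r !Ew brNr.
  by apply/rowP => p; rewrite !mxE; ring.
apply: (sl3_grading_system (w := w) (z := z) (k := k) c0) => //.
- move=> i j l m; apply/eqP; rewrite -subr_eq0; apply/eqP.
  apply: (wt0 _ _ _ (actsB (acts_br (kA i j) (kA l m))
    (actsB (actsZ (j == l)%:R (kA i m)) (actsZ (m == i)%:R (kA l j))))).
  + by rewrite memvB ?Ksub// memvB// memvZ.
  + by rewrite !mul_delta_mx_cond !scaler_nat subrr.
  + by rewrite brBr (lie_jacobi brP) brBr !brZr !Ekij br0l br0r !scaler0 addr0 !subrr.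
- move=> i j m; rewrite (acts_dual (kA i j) zE) big_ord2 !mxE eq_sym.
  by case: (ord2_cases i) => ->; case: (ord2_cases j) => ->; case: (ord2_cases m) => -> /=;
     apply/rowP => p; rewrite !mxE; ring.
(* The weight -2 does not occur: on g / K the weight is -1, so the bracket lies in [K], then in
   level 1, where the weight is 1. *)
- move=> i j; have Eww : br E (br (w i) (w j)) = - 2 *: br (w i) (w j).
    rewrite (lie_jacobi brP) !Ew brNl brNr.
    by apply/rowP => p; rewrite !mxE; ring.
  have wwK : br (w i) (w j) \in K.
    apply/KP; have := congr1 ev Eww; rewrite evE evZ => /eqP.
    rewrite -scaleN1r -subr_eq0 -scalerBl (_ : -1 - -2 = 1) ?scale1r; last by ring.
    by move/eqP.
  have := EK1 _ wwK; rewrite Eww => h1.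
  have : fl 1 (br (w i) (w j)).
    rewrite -[br _ _]scale1r (_ : 1 = - 2^-1 * -2 :> F); last by field.
    by rewrite -scalerA; exact: filZ.
  move/E1; rewrite Eww => /eqP; rewrite -[X in _ == X]scale1r -subr_eq0 -scalerBl.
  rewrite scaler_eq0 (_ : -2 - 1 = - 3%:R :> F) ?oppr_eq0 ?pnatr_eq0/=; last by ring.
  by move/eqP.
- by move=> i j; apply: fl2; exact: (@fl_br 1 1).
- move=> i j; apply/eqP; rewrite -subr_eq0; apply/eqP.
  have zwA : acts (br (z i) (w j)) (c *: ((i == j)%:R *: 1%:M + delta_mx j i)).
    rewrite -(subrK (v j) (w j)) brDr -[X in acts _ X]add0r; apply: actsD => //.
    by apply: fil1_acts0; apply: (@fl_br 1 0) => //; apply/KP; rewrite evB wE vE subrr.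
  apply: (wt0 _ _ _ (actsB zwA (actsZ c (actsD (actsZ (i == j)%:R (actsD (kA 0 0) (kA 1 1)))
    (kA j i))))).
  + by rewrite memvB// memvZ// memvD// memvZ// memvD.
  + rewrite (_ : delta_mx 0 0 + delta_mx 1 1 = 1%:M) ?subrr//.
    by apply: mx2P; rewrite !mx2E !mxE/=; ring.
  + rewrite brBr (lie_jacobi brP) Ez Ew brNr subrr brZr brDr brZr brDr !Ekij.
    by rewrite !(addr0, scaler0, subr0).
- move=> i; apply/eqP => wi; have := wE i; rewrite wi ev0 => /colP/(_ i).
  by rewrite !mxE !eqxx => /esym/eqP; rewrite oner_eq0.
- move=> i; apply/eqP => zi; have := zE i (v i); rewrite zi killing0l vE mxE !eqxx.
  by move=> /esym/eqP; rewrite oner_eq0.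
- apply/eqP => k01; have := acts_uniq acts0; rewrite -k01 => /(_ _ (kA 0 1)).
  by move=> /matrixP/(_ 0 1); rewrite !mxE/= => /esym/eqP; rewrite oner_eq0.
- apply/eqP => k10; have := acts_uniq acts0; rewrite -k10 => /(_ _ (kA 1 0)).
  by move=> /matrixP/(_ 1 0); rewrite !mxE/= => /esym/eqP; rewrite oner_eq0.
Qed.

End Isotropy.

Lemma codim1_split M y : subalgebra M -> y \notin M ->
  (forall x, exists a, x - a *: y \in M) ->
  exists J S, [/\ ideal J, (J <= M)%VS, exists e : 'I_2 -> 'I_2 -> g, sl_system e S,
    (forall s x, s \in S -> x \in J -> br s x = 0) /\
    (forall x, x \in J -> x \in S -> x = 0)
    & forall x, exists2 s, s \in S & exists2 i, i \in J & x = s + i].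
Proof.
move=> Msub yM ydec; have [J [Ji JM Jmax]] := ideal_core M.
have [S [Si SJ JS0 dec]] := ideal_complement Ji.
exists J, S; split=> //; have [s sS [i iJ yE]] := dec y.
have iM := subvP JM _ iJ.
(* As [J] lies in [M], the [S]-component [s] of [y] still spans the quotient of [S] by [M :&: S]. *)
apply: (@codim1_sl2 S J (M :&: S) s) => //.
- move=> u v; rewrite !memv_cap => /andP[uM uS] /andP[vM vS].
  by rewrite Msub// Si.
- exact: capvSr.
- move=> I Ii; rewrite subv_cap => /andP[IM IS].
  apply/eqP; rewrite -subv0; apply/subvP => x xI; rewrite memv0; apply/eqP.
  by apply: JS0; [exact: (subvP (Jmax I Ii IM))|exact: (subvP IS)].
- rewrite memv_cap sS andbT; apply: contra yM => sM.
  by rewrite yE memvD.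
- move=> x xS; have [a xa] := ydec x; exists a.
  rewrite memv_cap; apply/andP; split; last by rewrite memvB// memvZ.
  have -> : x - a *: s = x - a *: y + a *: i.
    by rewrite yE; apply/rowP => p; rewrite !mxE; ring.
  by rewrite memvD// memvZ.
Qed.

Lemma transitive_classification (ev : g -> 'cV[F]_2) (K : {vspace g}) :
  (forall a x y, ev (a *: x + y) = a *: ev x + ev y) ->
  (forall u, exists x, ev x = u) -> (forall x, x \in K <-> ev x = 0) ->
  subalgebra K -> (forall I, ideal I -> (I <= K)%VS -> I = 0%VS) ->
  [\/ exists e : 'I_2 -> 'I_2 -> g, sl_system e fullv,
      exists e : 'I_3 -> 'I_3 -> g, sl_system e fullv
    | exists (S T : {vspace g}) (e f : 'I_2 -> 'I_2 -> g),
      [/\ sl_system e S, sl_system f T, forall s t, s \in S -> t \in T -> br s t = 0,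
        forall x, x \in S -> x \in T -> x = 0
      & forall x, exists2 s, s \in S & exists2 t, t \in T & x = s + t]].
Proof.
move=> ev_lin ev_surj KP Ksub Kcore.
have evZ := evZ ev_lin KP; have evD := evD ev_lin; have evB := evB ev_lin KP.
have ev0 := ev0 KP.
have [Kirr|nirr] := pselect (forall u, u != 0 -> exists2 x, x \in K &
  exists2 v, ev v = u & ev (br x v) 0 0 * u 1 0 != ev (br x v) 1 0 * u 0 0).
  by apply: Or32; exact: (primitive_sl3 ev_lin ev_surj KP Ksub Kcore Kirr).
have [u [u0 uK]] : exists u, u != 0 /\ forall x v, x \in K -> ev v = u ->
    ev (br x v) 0 0 * u 1 0 = ev (br x v) 1 0 * u 0 0.
  have [//|nu] := pselect (exists u, u != 0 /\ forall x v, x \in K -> ev v = u ->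
    ev (br x v) 0 0 * u 1 0 = ev (br x v) 1 0 * u 0 0); exfalso; apply: nirr => u u0.
  have [//|nx] := pselect (exists2 x, x \in K & exists2 v, ev v = u &
    ev (br x v) 0 0 * u 1 0 != ev (br x v) 1 0 * u 0 0); exfalso; apply: nu.
  exists u; split=> // x v xK vu; apply/eqP; apply: contraT => xv; case: nx.
  by exists x => //; exists v.
(* [u] spans a line stable under the isotropy representation. [det] vanishes exactly on that line,
   and [M] below is its preimage, hence a subalgebra. *)
pose det (w : 'cV[F]_2) := w 0 0 * u 1 0 - w 1 0 * u 0 0.
have det_lin a (v w : 'cV[F]_2) : det (a *: v + w) = a * det v + det w.
  by rewrite /det !mx2E; ring.
have [||M MP] := @vspace_of_pred F g (fun x => det (ev x) = 0).
- by rewrite ev0 /det !mxE !mul0r subr0.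
- by move=> a x y x0 y0; rewrite ev_lin det_lin x0 y0 mulr0 addr0.
have KM x : x \in K -> x \in M.
  by move=> /KP xK; apply/MP; rewrite xK /det !mxE !mul0r subr0.
have [y1 y1u] := ev_surj u.
have Mdec x : x \in M -> exists a, x - a *: y1 \in K.
  move=> /MP /eqP; rewrite /det subr_eq0 => /eqP xu.
  have [u10|u10] := eqVneq (u 1 0) 0.
    have u00 : u 0 0 != 0.
      apply: contraNneq u0 => u00; apply/eqP/colP => i; rewrite mxE.
      by case: (ord2_cases i) => ->.
    exists (ev x 0 0 / u 0 0); apply/KP; rewrite evB evZ y1u; apply/colP => i.
    rewrite !mxE; case: (ord2_cases i) => ->; first by field.
    move/eqP: xu; rewrite u10 mulr0 eq_sym mulf_eq0 (negbTE u00) orbF => /eqP ->.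
    by rewrite mulr0 subr0.
  exists (ev x 1 0 / u 1 0); apply/KP; rewrite evB evZ y1u; apply/colP => i.
  rewrite !mxE; case: (ord2_cases i) => ->; last by field.
  by apply: (eq_lin (u 1 0)^-1 xu); field.
have Ky1 x : x \in K -> br x y1 \in M.
  by move=> xK; apply/MP; rewrite /det (uK x y1 xK y1u) subrr.
have Msub : subalgebra M.
  move=> x y /Mdec[a xa] /Mdec[b yb].
  move: (subrK (a *: y1) x) (subrK (b *: y1) y) xa yb.
  move: (x - a *: y1) (y - b *: y1) => k l <- <- kK lK.
  rewrite brDl !brDr !brZl !brZr (lie_alt brP) !scaler0 addr0.
  apply: memvD; first by apply: memvD; [apply: KM; exact: Ksub|apply: memvZ; exact: Ky1].
  by apply: memvZ; rewrite br_anti memvN; exact: Ky1.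
have [y2 y2u] : exists y, det (ev y) != 0.
  have [u10|u10] := eqVneq (u 1 0) 0.
    have [y yE] := ev_surj (delta_mx 1 0); exists y; rewrite yE /det !mxE/=.
    rewrite mul0r mul1r sub0r oppr_eq0; apply: contraNneq u0 => u00.
    by apply/eqP/colP => i; rewrite mxE; case: (ord2_cases i) => ->.
  have [y yE] := ev_surj (delta_mx 0 0); exists y; rewrite yE /det !mxE/=.
  by rewrite mul0r mul1r subr0.
have [J [S [Ji JM [e eS] [SJ JS0] dec]]] : exists J S, [/\ ideal J, (J <= M)%VS,
    exists e : 'I_2 -> 'I_2 -> g, sl_system e S,
    (forall s x, s \in S -> x \in J -> br s x = 0) /\
    (forall x, x \in J -> x \in S -> x = 0)
    & forall x, exists2 s, s \in S & exists2 i, i \in J & x = s + i].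
  apply: (@codim1_split M y2) => //; first by apply/negP => /MP y20; rewrite y20 eqxx in y2u.
  move=> x; exists (det (ev x) / det (ev y2)); apply/MP.
  by rewrite addrC -scaleNr ev_lin det_lin; field.
have [JK|/subvPn[j jJ jK]] := boolP (J <= K)%VS.
  apply: Or31; exists e; have -> // : fullv = S.
  apply/eqP; rewrite eqEsubv subvf andbT; apply/subvP => x _.
  have [s sS [i iJ ->]] := dec x; move: iJ.
  by rewrite (Kcore J Ji JK) memv0 => /eqP ->; rewrite addr0.
apply: Or33; have [f fJ] : exists e : 'I_2 -> 'I_2 -> g, sl_system e J.
  apply: (@codim1_sl2 J S (K :&: J) j) => //.
  - by move=> x s xJ sS; rewrite br_anti SJ ?oppr0.
  - by move=> x; have [s sS [i iJ ->]] := dec x; exists i => //; exists s => //; rewrite addrC.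
  - move=> x y; rewrite !memv_cap => /andP[xK xJ] /andP[yK yJ].
    by rewrite Ksub// Ji.
  - exact: capvSr.
  - by move=> I Ii; rewrite subv_cap => /andP[IK _]; exact: Kcore.
  - by rewrite memv_cap (negbTE jK).
  (* M / K is the line of [y1]: modulo [K] both [x] and [j] are multiples of it, and [j] is a
     nonzero one. *)
  - move=> x xJ; have [a xa] := Mdec x (subvP JM _ xJ).
    have [b jb] := Mdec j (subvP JM _ jJ).
    have b0 : b != 0.
      by apply: contraNneq jK => b0; move: jb; rewrite b0 scale0r subr0.
    exists (a / b); rewrite memv_cap; apply/andP; split; last by rewrite memvB// memvZ.
    have -> : x - (a / b) *: j = (x - a *: y1) - (a / b) *: (j - b *: y1).
      by apply/rowP => p; rewrite !mxE; field.
    by rewrite memvB// memvZ.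
exists S, J, e, f; split=> //.
by move=> x xS xJ; exact: JS0.
Qed.

End LieTheory.

(** * Analytic functions and vector fields *)

Section Analytic.
Variable K : numFieldType.
Hypothesis Kc : absolutely_complete K.
Implicit Types (f g : 'rV[K]_2 -> K) (p q z : 'rV[K]_2) (U : set 'rV[K]_2).

Lemma nbhs_polydisc p (r : K) : 0 < r -> nbhs p (polydisc p r).
Proof.
move=> r0; apply/nbhs_ballP; exists r => // z [_ pz] i /=.
by have := pz 0 i; rewrite /ball/= distrC.
Qed.

(** On the polydisc of radius s r / 2 every nonconstant term is at most s times its size at the
    point with both offsets r / 2, where the absolute sums are bounded by [M]. *)
Lemma analytic_continuous f p : analytic_at f p ->
  forall e, 0 < e -> \forall z \near p, `|f z - f p| < e.
Proof.
move=> [c [r r0 fc]] e e0.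
have r20 : 0 < r / 2 by rewrite divr_gt0.
have r2r : r / 2 < r by rewrite ltr_pdivrMr// ltr_pMr// ltr1n.
have [|[M HM] _] := fc (p + const_mx (r / 2)).
  by move=> i; rewrite !mxE addrAC subrr add0r ger0_norm// ltW.
have M0 : 0 <= M by have := HM 0; rewrite /double_sum big_ord0.
(* Chosen to give both s <= 1 and s M < e. *)
pose t := e / (M + 1); pose s := t / (1 + t).
have t0 : 0 < t by rewrite divr_gt0// ltr_wpDl.
have t1 : 0 < 1 + t by rewrite addr_gt0.
have s0 : 0 < s by rewrite divr_gt0.
have s1 : s <= 1 by rewrite ler_pdivrMr// mul1r lerDr.
have sM : s * M < e.
  apply: (@le_lt_trans _ _ (t * M)).
    by rewrite ler_wpM2r// ler_pdivrMr// ler_peMr ?lerDl// ltW.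
  by rewrite mulrAC ltr_pdivrMr ?ltr_wpDl// ltr_pM2l// ltrDl.
apply: filterS (nbhs_polydisc p (mulr_gt0 s0 r20)) => z pz.
apply: le_lt_trans sM.
have pzr : polydisc p r z.
  move=> i; apply: lt_trans (pz i) _; apply: le_lt_trans r2r.
  by rewrite ler_piMl// ltW.
have [_ fz] := fc z pzr.
rewrite (power_series_center r0 fc).
have fz' : (double_sum (monomial c p z) n.+1 - c 0 0) @[n --> \oo] --> f z - c 0 0.
  apply: cvgB; last exact: cvg_cst.
  by rewrite (cvg_shiftS (double_sum (monomial c p z))).
apply: (cvg_norm_bound _ fz') => n.
pose u i j := if (i == 0%N) && (j == 0%N) then 0 else monomial c p z i j.
have -> : double_sum (monomial c p z) n.+1 - c 0 0 = double_sum u n.+1.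
  pose w i j := if (i == 0%N) && (j == 0%N) then c 0 0 else 0.
  have -> : c 0 0 = double_sum w n.+1.
    by rewrite /double_sum !big_ord_recl /w/= !big1 ?addr0.
  rewrite -double_sumB; apply: eq_double_sum => i j; rewrite /w /u.
  case: ifP => [/andP[/eqP-> /eqP->]|_]; last by rewrite subr0.
  by rewrite /monomial !expr0 !mulr1 subrr.
rewrite (le_trans (ler_norm_double_sum _ _))// (le_trans _ (ler_wpM2l (ltW s0) (HM n.+1)))//.
rewrite -double_sumZ; apply: ler_double_sum => i j; rewrite /u.
case: ifPn => [_|ij]; first by rewrite normr0 mulr_ge0// ltW.
have H1 (k : 'I_2) m : `|z 0 k - p 0 k| ^+ m <= (r / 2) ^+ m.
  apply: lerXn2r; rewrite ?nnegrE ?(ltW r20)//.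
  by rewrite (le_trans (ltW (pz k)))// ler_piMl// ltW.
have H2 (k : 'I_2) m : (0 < m)%N -> `|z 0 k - p 0 k| ^+ m <= s * (r / 2) ^+ m.
  case: m => // m _; rewrite !exprS mulrA ler_pM ?exprn_ge0 ?H1//.
  by rewrite ltW//; exact: pz.
have E (k : 'I_2) : (p + const_mx (r / 2)) 0 k - p 0 k = r / 2.
  by rewrite !mxE addrAC subrr add0r.
rewrite /monomial !E !normrM !normrX (ger0_norm (ltW r20)).
move: ij; rewrite negb_and -!lt0n => /orP[i0|j0].
  rewrite mulrA ler_pM ?mulr_ge0 ?exprn_ge0 ?H1//.
  by rewrite mulrCA ler_wpM2l// H2.
rewrite mulrCA; apply: ler_pM; rewrite ?mulr_ge0 ?exprn_ge0 ?H2//.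
by rewrite ler_wpM2l// H1.
Qed.

Lemma continuous_neq0 f p : analytic_at f p -> f p != 0 -> \forall z \near p, f z != 0.
Proof.
move=> fa fp; have fp0 : 0 < `|f p| by rewrite normr_gt0.
apply: filterS (analytic_continuous fa fp0) => z; apply: contraTneq => ->.
by rewrite sub0r normrN ltxx.
Qed.

(** * Zeros of infinite order and the identity theorem *)

Fixpoint vanishing (n : nat) f p : Prop :=
  f p = 0 /\ (if n is m.+1 then forall k, vanishing m (partial k f) p else True).

Lemma vanishing_at n f p : vanishing n f p -> f p = 0.
Proof. by case: n => [|n] []. Qed.

(** Up to factorials the coefficient is an iterated derivative at [p]; derivatives in the first
    variable reduce [i] to 0, then those in the second reduce [j]. *)
Lemma vanishing_coef f c p (r : K) : 0 < r -> power_series_at f p c r ->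
  (forall n, vanishing n f p) -> forall i j, c i j = 0.
Proof.
move=> r0.
have vp n k h : vanishing n.+1 h p -> vanishing n (partial k h) p by move=> [_ /(_ k)].
have H0 j : forall h c, power_series_at h p c r -> (forall n, vanishing n h p) -> c 0 j = 0.
  elim: j => [|j IH] h d hd hv.
    by rewrite -(power_series_center r0 hd); case: (hv 0%N).
  have [_ /IH] := power_series_partial1 Kc hd.
  move=> /(_ (fun n => vp n 1 h (hv n.+1)))/eqP.
  by rewrite mulrn_eq0 => /eqP.
move=> + + i; elim: i f c => [|i IH] f c fc fv j; first exact: H0 fc fv.
have [_ /IH] := power_series_partial0 Kc fc.
move=> /(_ (fun n => vp n 0 f (fv n.+1)) j)/eqP.
by rewrite mulrn_eq0 => /eqP.
Qed.

Lemma vanishing_near f p : analytic_at f p -> (forall n, vanishing n f p) ->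
  \forall z \near p, f z = 0.
Proof.
move=> [c [r r0 fc]] fv; apply: filterS (nbhs_polydisc p r0) => z /fc[_ fz].
apply/eqP; rewrite -normr_le0; apply: (cvg_norm_bound _ fz) => n.
rewrite /double_sum big1 ?normr0// => i _; rewrite big1// => j _.
by rewrite /monomial (vanishing_coef r0 fc fv) !mul0r.
Qed.

Lemma near0_partial f p k : (\forall z \near p, f z = 0) ->
  \forall z \near p, partial k f z = 0.
Proof.
move=> /near_join; apply: filterS => z fz; rewrite /partial.
by rewrite (@near_eq_derive _ _ _ f (cst 0)) ?derive_cst.
Qed.

(** The partial derivatives of [f] are again locally zero on [B], and continuity carries their
    vanishing to limit points. *)
Lemma vanishing_closure n f p (B : set 'rV[K]_2) : analytic_at f p ->
  (forall z, B z -> \forall y \near z, f y = 0) -> closure B p -> vanishing n f p.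
Proof.
move=> + + clB; elim: n f => [|n IH] f fa fB.
  split=> //; apply/eqP; apply: contraT => fp.
  have [q [Bq]] := clB _ (continuous_neq0 fa fp).
  by move=> /=; rewrite (nbhs_singleton (fB q Bq)) eqxx.
split; first exact: vanishing_at (IH f fa fB).
move=> k; apply: IH; first exact: analytic_partial.
by move=> z /fB; exact: near0_partial.
Qed.

Lemma identity_theorem U f p : open U -> connected U -> analytic_on U f ->
  U p -> (\forall z \near p, f z = 0) -> forall q, U q -> f q = 0.
Proof.
move=> Uo Uc fa Up fp.
(* [B] is nonempty and open, and closed in [U]: at a limit point all derivatives vanish, hence the
   power series does. *)
pose B := U `&` [set q | \forall z \near q, f z = 0].
suff BU : B = U by move=> q; rewrite -BU => -[_ /nbhs_singleton].
apply: Uc; first by exists p.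
  exists [set q | \forall z \near q, f z = 0] => //.
  by rewrite openE => q /near_join.
exists (closure B); first exact: closed_closure.
rewrite eqEsubset; split=> [q Bq|q [Uq clBq]].
  by split; [case: Bq|exact: subset_closure].
split=> //=; apply: vanishing_near; first exact: fa.
by move=> n; apply: (@vanishing_closure n f q B) => //; [exact: fa|move=> z []].
Qed.

(* A class of functions, containing the analytic ones and closed under partial
   derivatives, in which products can be formed without multiplying power
   series. *)
Inductive smooth U : ('rV[K]_2 -> K) -> Prop :=
| smooth_analytic f : analytic_on U f -> smooth U f
| smoothB f g : smooth U f -> smooth U g -> smooth U (f - g)
| smoothD f g : smooth U f -> smooth U g -> smooth U (f + g)
| smoothM f g : smooth U f -> smooth U g -> smooth U (f * g)
| smooth_eq f g : (forall p, U p -> f p = g p) -> smooth U f -> smooth U g.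

Lemma near_eq_on U f g p : open U -> U p -> (forall p, U p -> f p = g p) ->
  \forall z \near p, f z = g z.
Proof. by move=> Uo Up fg; apply: filterS (open_nbhs_nbhs (conj Uo Up)). Qed.

Lemma smooth_derivable U f p k : open U -> smooth U f -> U p ->
  derivable f p (delta_mx 0 k).
Proof.
move=> Uo fs Up; elim: fs => {f} [f fa|f g _ df _ dg|f g _ df _ dg|f g _ df _ dg|f g fg _ df].
- by apply: (analytic_derivable Kc); exact: fa.
- exact: derivableB.
- exact: derivableD.
- exact: derivableM.
- exact: near_eq_derivable (near_eq_on Uo Up fg) df.
Qed.

Lemma smooth_partialM U f g p k : open U -> smooth U f -> smooth U g -> U p ->
  partial k (f * g) p = f p * partial k g p + g p * partial k f p.
Proof. by move=> Uo fs gs Up; apply: deriveM; exact: (smooth_derivable Uo). Qed.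

Lemma smooth_partialD U f g p k : open U -> smooth U f -> smooth U g -> U p ->
  partial k (f + g) p = partial k f p + partial k g p.
Proof. by move=> Uo fs gs Up; apply: deriveD; exact: (smooth_derivable Uo). Qed.

Lemma smooth_partialB U f g p k : open U -> smooth U f -> smooth U g -> U p ->
  partial k (f - g) p = partial k f p - partial k g p.
Proof. by move=> Uo fs gs Up; apply: deriveB; exact: (smooth_derivable Uo). Qed.

Lemma partial_eq_on U f g p k : open U -> U p -> (forall p, U p -> f p = g p) ->
  partial k f p = partial k g p.
Proof. by move=> Uo Up fg; apply: near_eq_derive; exact: near_eq_on Uo Up fg. Qed.

Lemma smooth_partial U f k : open U -> smooth U f -> smooth U (partial k f).
Proof.
move=> Uo; elim=> {f} [f fa|f g fs df gs dg|f g fs df gs dg|f g fs df gs dg|f g fg _ df].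
- by apply: smooth_analytic => p Up; apply: analytic_partial => //; exact: fa.
- apply: (smooth_eq (f := partial k f - partial k g)); last exact: smoothB.
  by move=> p Up; rewrite (smooth_partialB k Uo fs gs Up).
- apply: (smooth_eq (f := partial k f + partial k g)); last exact: smoothD.
  by move=> p Up; rewrite (smooth_partialD k Uo fs gs Up).
- apply: (smooth_eq (f := f * partial k g + g * partial k f)).
    by move=> p Up; rewrite (smooth_partialM k Uo fs gs Up).
  by apply: smoothD; exact: smoothM.
- by apply: smooth_eq df => p Up; exact: partial_eq_on Uo Up fg.
Qed.

Section Vanishing.
Variables (U : set 'rV[K]_2) (p : 'rV[K]_2).
Hypotheses (Uo : open U) (Up : U p).

Lemma vanishing_le n f : vanishing n.+1 f p -> vanishing n f p.
Proof.
elim: n f => [|n IH] f [fp fd]; split=> // k.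
by apply: IH; exact: fd.
Qed.

Lemma vanishing_eq n f g : (forall p, U p -> f p = g p) -> vanishing n f p ->
  vanishing n g p.
Proof.
elim: n f g => [|n IH] f g fg [fp fd]; split=> //; rewrite -?fg// => k.
by apply: IH (fd k) => q Uq; exact: partial_eq_on Uo Uq fg.
Qed.

Lemma vanishingD n f g : smooth U f -> smooth U g ->
  vanishing n f p -> vanishing n g p -> vanishing n (f + g) p.
Proof.
elim: n f g => [|n IH] f g fs gs [fp fd] [gp gd]; split; rewrite ?fctE ?fp ?gp ?addr0//.
move=> k; apply: (@vanishing_eq _ (partial k f + partial k g)).
  by move=> q Uq; rewrite (smooth_partialD k Uo fs gs Uq).
by apply: IH; [exact: smooth_partial|exact: smooth_partial|exact: fd|exact: gd].
Qed.

Lemma vanishingB n f g : smooth U f -> smooth U g ->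
  vanishing n f p -> vanishing n g p -> vanishing n (f - g) p.
Proof.
elim: n f g => [|n IH] f g fs gs [fp fd] [gp gd]; split; rewrite ?fctE ?fp ?gp ?subr0//.
move=> k; apply: (@vanishing_eq _ (partial k f - partial k g)).
  by move=> q Uq; rewrite (smooth_partialB k Uo fs gs Uq).
by apply: IH; [exact: smooth_partial|exact: smooth_partial|exact: fd|exact: gd].
Qed.

Lemma vanishingM n f g : smooth U f -> smooth U g ->
  vanishing n f p -> vanishing n (f * g) p.
Proof.
elim: n f g => [|n IH] f g fs gs fv.
  by split=> //; rewrite fctE (vanishing_at fv) mul0r.
split=> [|k]; first by rewrite fctE (vanishing_at fv) mul0r.
apply: (@vanishing_eq _ (f * partial k g + partial k f * g)).
  by move=> q Uq; rewrite (smooth_partialM k Uo fs gs Uq) [X in _ + X]mulrC.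
have [_ fd] := fv; have fs' := smooth_partial k Uo fs; have gs' := smooth_partial k Uo gs.
apply: vanishingD; [exact: smoothM|exact: smoothM| |].
  by apply: IH => //; exact: vanishing_le.
by apply: IH => //; exact: fd.
Qed.

(** By Leibniz, g times a derivative of f is the derivative of f g minus f times the derivative of
    g, where [f] already vanishes to the preceding order by induction. *)
Lemma vanishing_cancel n f g : smooth U f -> smooth U g -> g p != 0 ->
  vanishing n (f * g) p -> vanishing n f p.
Proof.
move=> fs gs g0; elim: n f fs => [|n IH] f fs [fgp fgd].
  by split=> //; move/eqP: fgp; rewrite fctE mulf_eq0 (negbTE g0) orbF => /eqP.
have fs' k := smooth_partial k Uo fs; have gs' k := smooth_partial k Uo gs.
have fv : vanishing n f p by apply: IH => //; apply: vanishing_le.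
split; first exact: vanishing_at fv.
move=> k; apply: IH => //.
apply: (@vanishing_eq _ (partial k (f * g) - f * partial k g)).
  by move=> q Uq; rewrite !fctE (smooth_partialM k Uo fs gs Uq) addrC addKr mulrC.
apply: vanishingB; [|exact: smoothM|exact: fgd|exact: vanishingM].
by apply: smooth_partial => //; exact: smoothM.
Qed.
End Vanishing.
End Analytic.

(** * Brackets of vector fields *)

Section Fields.
Variable K : numFieldType.
Hypothesis Kc : absolutely_complete K.
Variable U : set 'rV[K]_2.
Hypothesis Uo : open U.
Implicit Types (V W X Y Z : 'rV[K]_2 -> 'rV[K]_2) (p : 'rV[K]_2).

Definition component V (i : 'I_2) : 'rV[K]_2 -> K := fun p => V p 0 i.

Lemma bracketE V W p i : bracket V W p 0 i =
  act V (component W i) p - act W (component V i) p.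
Proof. by rewrite /bracket mxE !act_coordinate. Qed.

Lemma bracket_component V W i : component (bracket V W) i =
  act V (component W i) - act W (component V i).
Proof. by apply/funext => p; exact: bracketE. Qed.

Lemma actE V (f : 'rV[K]_2 -> K) p :
  act V f p = V p 0 0 * partial 0 f p + V p 0 1 * partial 1 f p.
Proof. by rewrite /act big_ord2. Qed.

Lemma act_funE V (f : 'rV[K]_2 -> K) :
  act V f = component V 0 * partial 0 f + component V 1 * partial 1 f.
Proof. by apply/funext => p; rewrite actE. Qed.

Lemma bracket_out V W p : V p = 0 -> W p = 0 -> bracket V W p = 0.
Proof.
move=> V0 W0; apply/rowP => i; rewrite bracketE !actE V0 W0 !mxE.
by rewrite !mul0r !addr0 subrr.
Qed.

Lemma bracket_anti V W : bracket V W = - bracket W V.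
Proof.
apply/funext => p; apply/rowP => i; rewrite -[RHS]/((- (bracket W V p)) 0 i) mxoppE.
by rewrite !bracketE opprB.
Qed.

Lemma smooth_component V i : vector_field U V -> smooth U (component V i).
Proof. by move=> [Va _]; apply: smooth_analytic; exact: Va. Qed.

Lemma smooth_act V f : vector_field U V -> smooth U f -> smooth U (act V f).
Proof.
move=> Vf fs; rewrite act_funE.
by apply: smoothD; apply: smoothM; [exact: smooth_component|exact: smooth_partial|
  exact: smooth_component|exact: smooth_partial].
Qed.

Lemma act_sub V f g p : U p -> smooth U f -> smooth U g ->
  act V (f - g) p = act V f p - act V g p.
Proof.
move=> Up fs gs; rewrite !actE !(smooth_partialB Kc _ Uo fs gs Up); ring.
Qed.

Lemma bracket_linl (a : K) V V' W : vector_field U V -> vector_field U V' ->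
  vector_field U W ->
  bracket (a *: V + V') W = a *: bracket V W + bracket V' W.
Proof.
move=> Vf V'f Wf; apply/funext => p.
rewrite -[RHS]/(a *: bracket V W p + bracket V' W p).
have [Up|nUp] := pselect (U p); last first.
  have V0 : V p = 0 by case: Vf => _; apply.
  have V'0 : V' p = 0 by case: V'f => _; apply.
  have W0 : W p = 0 by case: Wf => _; apply.
  rewrite !bracket_out// ?scaler0 ?addr0//.
  by rewrite -[LHS]/(a *: V p + V' p) V0 V'0 scaler0 addr0.
apply/rowP => i; rewrite mxaddE mxscaleE !bracketE !actE.
have d V1 k : vector_field U V1 -> derivable (component V1 i) p (delta_mx 0 k).
  by move=> V1f; apply: (smooth_derivable Kc Uo) => //; exact: smooth_component.
have E k : partial k (component (a *: V + V') i) p =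
    a * partial k (component V i) p + partial k (component V' i) p.
  rewrite (_ : component _ i = a \*: component V i + component V' i).
    by rewrite /partial deriveD ?deriveZ//; [exact: d|apply: derivableZ; exact: d|exact: d].
  by apply/funext => q; rewrite /component !mxE.
rewrite !E -![(a *: V + V') p]/(a *: V p + V' p) !mxaddE !mxscaleE; ring.
Qed.

Lemma bracket_jacobi X Y Z : vector_field U X -> vector_field U Y -> vector_field U Z ->
  bracket X (bracket Y Z) = bracket (bracket X Y) Z + bracket Y (bracket X Z).
Proof.
move=> Xf Yf Zf; apply/funext => p.
rewrite -[RHS]/(bracket (bracket X Y) Z p + bracket Y (bracket X Z) p).
have [Up|nUp] := pselect (U p); last first.
  have X0 : X p = 0 by case: Xf => _; apply.
  have Y0 : Y p = 0 by case: Yf => _; apply.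
  have Z0 : Z p = 0 by case: Zf => _; apply.
  by rewrite !bracket_out ?addr0// bracket_out.
have s V i : vector_field U V -> smooth U (component V i) by exact: smooth_component.
apply/rowP => i; rewrite [RHS]mxaddE !bracketE !bracket_component.
rewrite !act_sub//; try by apply: smooth_act => //; exact: s.
have a V i' : vector_field U V -> analytic_at (component V i') p.
  by move=> [Va _]; exact: Va.
(* Once brackets act as commutators, the identity is formal in the iterated actions on a
   component. *)
rewrite !(act_bracket_at Kc) //; try by move=> ?; apply: a.
all: try exact: a.
move: (act X (act Y _) p) (act X (act Z _) p) (act Y (act X _) p) => xy xz yx.
move: (act Y (act Z _) p) (act Z (act X _) p) (act Z (act Y _) p) => yz zx zy.
ring.
Qed.

Lemma vector_field_eq0 X p : connected U -> vector_field U X -> U p ->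
  (forall i, \forall z \near p, component X i z = 0) -> X = 0.
Proof.
move=> Uc [Xa X0] Up Xp; apply/funext => q.
have [Uq|] := pselect (U q); last exact: X0.
apply/rowP => i; rewrite mxE; exact: (identity_theorem Kc Uo Uc (Xa i) Up (Xp i)).
Qed.

(* The equations [Y_j, X] = 0 express the first derivatives of [X] linearly in
   terms of [X], so a zero of [X] has infinite order. *)
Lemma commuting_frame_eq0 X (Y : 'I_2 -> 'rV[K]_2 -> 'rV[K]_2) p : connected U ->
  vector_field U X -> (forall j, vector_field U (Y j)) -> U p -> X p = 0 ->
  (forall j, Y j p = delta_mx 0 j) -> (forall j, bracket (Y j) X = 0) -> X = 0.
Proof.
move=> Uc Xf Yf Up X0 Yp YX; apply: (vector_field_eq0 Uc Xf Up) => i.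
apply: (vanishing_near Kc); first by case: Xf => Xa _; exact: Xa.
move=> n; elim: n i => [|n IH] i; first by split; rewrite /component ?X0 ?mxE.
split; first by rewrite /component X0 mxE.
have s j i' : smooth U (component (Y j) i') by exact: smooth_component.
have sX i' : smooth U (component X i') by exact: smooth_component.
have sd k : smooth U (partial k (component X i)) by exact: smooth_partial.
(* Commutation says that [h j] is also [X] applied to a component of [Y j], so it is a combination
   of components of [X] and vanishes to order [n]. *)
pose h j := act (Y j) (component X i).
have sh j : smooth U (h j) by exact: smooth_act.
have hE j : h j = component X 0 * partial 0 (component (Y j) i)
    + component X 1 * partial 1 (component (Y j) i).
  apply/funext => q; have := congr1 (fun V => V q 0 i) (YX j).
  by rewrite bracketE !mxE => /eqP; rewrite subr_eq0 -act_funE => /eqP.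
have hv j : vanishing n (h j) p.
  have sp k : smooth U (partial k (component (Y j) i)) by exact: smooth_partial.
  rewrite hE; apply: (vanishingD Kc Uo Up); [exact: smoothM|exact: smoothM| |];
    by apply: (vanishingM Kc Uo Up).
(* Cramer's rule expresses [D] times a derivative of the component of [X] through [h 0] and [h 1];
   [D] is 1 at [p] and can be cancelled. *)
pose D := component (Y 0) 0 * component (Y 1) 1 - component (Y 0) 1 * component (Y 1) 0.
have sD : smooth U D by apply: smoothB; apply: smoothM.
have D0 : D p != 0.
  by rewrite /D !fctE /component !Yp !mxE/= mulr1 mulr0 subr0 oner_eq0.
apply: ord2P; apply: (vanishing_cancel Kc Uo Up (sd _) sD D0).
  rewrite (_ : _ * D = h 0 * component (Y 1) 1 - h 1 * component (Y 0) 1).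
    apply: (vanishingB Kc Uo Up); [exact: smoothM|exact: smoothM| |];
    by apply: (vanishingM Kc Uo Up).
  by apply/funext => q; rewrite /h /D !fctE !actE /component; ring.
rewrite (_ : _ * D = h 1 * component (Y 0) 0 - h 0 * component (Y 1) 0).
  apply: (vanishingB Kc Uo Up); [exact: smoothM|exact: smoothM| |];
  by apply: (vanishingM Kc Uo Up).
by apply/funext => q; rewrite /h /D !fctE !actE /component; ring.
Qed.

(* Writing parallel fields as multiples of one of them, this is the Pluecker
   relation between 2x2 Wronskians. *)
Lemma parallel_bracket X Y Z p i j :
  (forall k, X p 0 k * Y p 0 j = Y p 0 k * X p 0 j) ->
  (forall k, Y p 0 k * Z p 0 j = Z p 0 k * Y p 0 j) ->
  (forall k, Z p 0 k * X p 0 j = X p 0 k * Z p 0 j) ->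
  bracket X Y p 0 i * Z p 0 j + bracket Y Z p 0 i * X p 0 j
    + bracket Z X p 0 i * Y p 0 j = 0.
Proof.
move=> XY YZ ZX; rewrite !bracketE !actE.
have := (XY 0, XY 1, YZ 0, YZ 1, ZX 0, ZX 1).
move: (X p 0 j) (Y p 0 j) (Z p 0 j) (X p 0 0) (Y p 0 0) (Z p 0 0).
move: (X p 0 1) (Y p 0 1) (Z p 0 1).
move: (partial 0 (component X i) p) (partial 0 (component Y i) p).
move: (partial 0 (component Z i) p) (partial 1 (component X i) p).
move: (partial 1 (component Y i) p) (partial 1 (component Z i) p).
move=> dY1 dZ1 dZ0 dX1 dX0 dY0 x1 y1 z1 x y z x0 y0 z0 [[[[[xy0 xy1] yz0] yz1] zx0] zx1].
(* Each summand contains the difference of the two sides of one proportionality relation. *)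
transitivity (- dY0 * (z0 * x - x0 * z) - dY1 * (z1 * x - x1 * z)
  - dX0 * (y0 * z - z0 * y) - dX1 * (y1 * z - z1 * y)
  - dZ0 * (x0 * y - y0 * x) - dZ1 * (x1 * y - y1 * x)); first by ring.
by rewrite xy0 xy1 yz0 yz1 zx0 zx1 !subrr !mulr0 !subr0.
Qed.
End Fields.

(** * Isomorphisms with matrix Lie algebras *)

(** The explicit maps go from matrices to fields, opposite to the direction required. *)
Lemma lie_isomorphic_inv (K : fieldType) (E1 E2 : lmodType K)
    (br1 : E1 -> E1 -> E1) (L1 : set E1) (br2 : E2 -> E2 -> E2) (L2 : set E2)
    (psi : E2 -> E1) :
  lie_subalgebra br2 L2 ->
  (forall a u v, L2 u -> L2 v -> psi (a *: u + v) = a *: psi u + psi v) ->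
  (forall u v, L2 u -> L2 v -> psi (br2 u v) = br1 (psi u) (psi v)) ->
  (forall u v, L2 u -> L2 v -> psi u = psi v -> u = v) ->
  (forall u, L2 u -> L1 (psi u)) -> (forall x, L1 x -> exists2 u, L2 u & psi u = x) ->
  lie_isomorphic br1 L1 br2 L2.
Proof.
move=> [[L20 L2lin] L2br] psi_lin psi_br psi_inj psi_L1 psi_surj.
pose phi x := xget 0 [set u | L2 u /\ psi u = x].
have phiP x : L1 x -> L2 (phi x) /\ psi (phi x) = x.
  by move=> /psi_surj[u L2u ux]; apply: (@xgetPex _ 0 [set u | L2 u /\ psi u = x]); exists u.
have phi_eq x u : L2 u -> L1 x -> psi u = x -> phi x = u.
  by move=> L2u L1x ux; have [L2x xE] := phiP x L1x; apply: psi_inj; rewrite ?xE.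
exists phi; split.
- move=> a u v /phiP[L2u uE] /phiP[L2v vE]; apply: phi_eq.
  + exact: L2lin.
  + by rewrite -uE -vE -psi_lin//; apply: psi_L1; exact: L2lin.
  + by rewrite psi_lin// uE vE.
- move=> u v /phiP[L2u uE] /phiP[L2v vE]; apply: phi_eq.
  + exact: L2br.
  + by rewrite -uE -vE -psi_br//; apply: psi_L1; exact: L2br.
  + by rewrite psi_br// uE vE.
- split=> [x /phiP[]//|x y|u L2u].
    rewrite !inE => /phiP[_ {2}<-] /phiP[_ {2}<-] -> //.
  by exists (psi u); [exact: psi_L1|apply: phi_eq => //; exact: psi_L1].
Qed.

Section SlSystem.
Variables (F : numClosedFieldType) (n : nat).
Local Notation g := 'rV[F]_n.+1.
Variable br : g -> g -> g.
Hypothesis brP : lie_axioms br.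
Variables (m : nat) (e : 'I_m.+1 -> 'I_m.+1 -> g) (S : {vspace g}).
Hypothesis eP : sl_system br e S.
Implicit Types X Y : 'M[F]_m.+1.

(** Sends matrix units to the [e i j]; scalar matrices go to 0, and the restriction to traceless
    matrices is the isomorphism sought. *)
Definition unit_comb X : g := \sum_i \sum_j X i j *: e i j.

Lemma unit_comb_lin a X Y : unit_comb (a *: X + Y) = a *: unit_comb X + unit_comb Y.
Proof.
rewrite /unit_comb scaler_sumr -big_split; apply: eq_bigr => i _.
rewrite scaler_sumr -big_split; apply: eq_bigr => j _.
by rewrite !mx2E scalerDl scalerA.
Qed.

Lemma unit_combB X Y : unit_comb (X - Y) = unit_comb X - unit_comb Y.
Proof. by rewrite -scaleN1r addrC unit_comb_lin scaleN1r addrC. Qed.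

Lemma unit_combZ a X : unit_comb (a *: X) = a *: unit_comb X.
Proof.
have -> : a *: X = (a - 1) *: X + X by rewrite scalerBl scale1r subrK.
by rewrite unit_comb_lin scalerBl scale1r subrK.
Qed.

Lemma unit_comb_delta i j : unit_comb (delta_mx i j) = e i j.
Proof.
rewrite /unit_comb (bigD1 i)//= (bigD1 j)//= !mxE !eqxx scale1r.
rewrite !big1 ?addr0// => [k ki|k ki]; last by rewrite mxE (negbTE ki) andbF scale0r.
by rewrite big1// => l _; rewrite mxE (negbTE ki) scale0r.
Qed.

Lemma br_sumr (I : finType) (f : I -> g) x : br x (\sum_i f i) = \sum_i br x (f i).
Proof. exact: (big_morph (br x) (fun u v => brDr brP u v x) (br0r brP x)). Qed.

Lemma br_suml (I : finType) (f : I -> g) x : br (\sum_i f i) x = \sum_i br (f i) x.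
Proof. exact: (big_morph (br^~ x) (fun u v => brDl brP u v x) (br0l brP x)). Qed.

Lemma br_unit_comb X Y : br (unit_comb X) (unit_comb Y) = unit_comb (X *m Y - Y *m X).
Proof.
have [eb _ _ _ _] := eP.
have brY i j : br (e i j) (unit_comb Y) =
    \sum_l Y j l *: e i l - \sum_k Y k i *: e k j.
  rewrite /unit_comb br_sumr.
  under eq_bigr => k _.
    rewrite br_sumr.
    under eq_bigr => l _ do rewrite (brZr brP) eb scalerBr !scalerA.
    rewrite sumrB.
    rewrite [X in _ - X](bigD1 i)//= eqxx mulr1 [X in _ - (_ + X)]big1 ?addr0; last first.
      by move=> l li; rewrite (negbTE li) mulr0 scale0r.
    over.
  rewrite sumrB; congr (_ - _); rewrite (bigD1 j)//= [X in _ + X]big1 ?addr0.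
    by apply: eq_bigr => l _; rewrite eqxx mulr1.
  by move=> k kj; rewrite big1// => l _; rewrite eq_sym (negbTE kj) mulr0 scale0r.
rewrite unit_combB [in LHS]/unit_comb br_suml.
under eq_bigr => i _.
  rewrite br_suml.
  under eq_bigr => j _ do rewrite (brZl brP) brY scalerBr !scaler_sumr.
  rewrite sumrB; over.
rewrite sumrB; congr (_ - _).
  apply: eq_bigr => i _; rewrite exchange_big; apply: eq_bigr => l _ /=.
  by rewrite mxE scaler_suml; apply: eq_bigr => j _; rewrite scalerA.
rewrite /unit_comb.
under eq_bigr => i _ do rewrite exchange_big /=.
rewrite exchange_big /=; apply: eq_bigr => k _.
rewrite exchange_big /=; apply: eq_bigr => j _.
by rewrite mxE scaler_suml; apply: eq_bigr => i _; rewrite scalerA mulrC.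
Qed.

Lemma delta_mulE (i j : 'I_m.+1) X a b : (delta_mx i j *m X) a b = (a == i)%:R * X j b.
Proof.
rewrite mxE (bigD1 j)//= big1 ?addr0 => [|k kj]; first by rewrite mxE eqxx andbT.
by rewrite mxE (negbTE kj) andbF mul0r.
Qed.

Lemma mul_deltaE (i j : 'I_m.+1) X a b : (X *m delta_mx i j) a b = X a i * (b == j)%:R.
Proof.
rewrite mxE (bigD1 i)//= big1 ?addr0 => [|k ki]; first by rewrite mxE eqxx.
by rewrite mxE (negbTE ki) mulr0.
Qed.

(** The kernel is stable under brackets. Bracketing [X] twice with a unit E_ij leaves -2 X_ji E_ij,
    so [X] is diagonal; one more bracket shows that it is scalar, and the trace makes it 0. *)
Lemma unit_comb_inj X : \tr X = 0 -> unit_comb X = 0 -> X = 0.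
Proof.
have [_ _ _ _ e0] := eP => trX X0.
have comm0 Y i j : unit_comb Y = 0 ->
    unit_comb (delta_mx i j *m Y - Y *m delta_mx i j) = 0.
  by move=> Y0; rewrite -br_unit_comb Y0 (br0r brP).
have off i j : i != j -> X j i = 0.
  move=> ij; have := comm0 _ i j (comm0 _ i j X0).
  have -> : delta_mx i j *m (delta_mx i j *m X - X *m delta_mx i j) -
      (delta_mx i j *m X - X *m delta_mx i j) *m delta_mx i j =
      (- 2 * X j i) *: delta_mx i j.
    apply/matrixP => a b; rewrite !(mxaddE, mxoppE, mxscaleE, delta_mulE, mul_deltaE) mxE.
    by rewrite (negbTE ij) [j == i]eq_sym (negbTE ij) -mulnb natrM /=; ring.
  rewrite unit_combZ unit_comb_delta => /eqP.
  rewrite scaler_eq0 (negbTE (e0 _ _ ij)) orbF mulf_eq0 oppr_eq0 pnatr_eq0/=.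
  by move=> /eqP.
have diag i j : i != j -> X i i = X j j.
  move=> ij; have := comm0 _ i j X0.
  have -> : delta_mx i j *m X - X *m delta_mx i j = (X j j - X i i) *: delta_mx i j.
    apply/matrixP => a b; rewrite !(mxaddE, mxoppE, mxscaleE, delta_mulE, mul_deltaE) mxE.
    have [->|ai] := eqVneq a i; have [->|bj] := eqVneq b j; rewrite /=.
    - by ring.
    - by rewrite (off b j bj); ring.
    - by rewrite (off i a) 1?eq_sym//; ring.
    - by ring.
  rewrite unit_combZ unit_comb_delta => /eqP.
  by rewrite scaler_eq0 (negbTE (e0 _ _ ij)) orbF subr_eq0 => /eqP.
have diag0 i : X i i = X 0 0.
  by have [->//|i0] := eqVneq i 0; rewrite (diag i 0).
have X00 : X 0 0 = 0.
  move: trX; rewrite /mxtrace (eq_bigr (fun=> X 0 0)) // sumr_const card_ord => /eqP.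
  by rewrite mulrn_eq0 => /eqP.
apply/matrixP => i j; rewrite mxE.
by have [->|ij] := eqVneq i j; [rewrite diag0|apply: off; rewrite eq_sym].
Qed.

Lemma unit_comb_surj x : x \in S -> exists2 X, \tr X = 0 & unit_comb X = x.
Proof.
have [_ e0 _ span _] := eP => /span[X ->].
exists (X - (\tr X / m.+1%:R)%:M).
  rewrite mxtraceB mxtrace_scalar -[X in _ - X]mulr_natr divfK ?pnatr_eq0//.
  by rewrite subrr.
rewrite unit_combB -[RHS]subr0; congr (_ - _).
rewrite -scalemx1 unit_combZ -[RHS](scaler0 _ (\tr X / m.+1%:R)); congr (_ *: _).
rewrite -[RHS]e0 /unit_comb; apply: eq_bigr => i _.
rewrite (bigD1 i)//= big1 ?addr0 => [|j ji]; first by rewrite mxE eqxx scale1r.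
by rewrite mxE eq_sym (negbTE ji) scale0r.
Qed.

Lemma unit_comb_mem X : unit_comb X \in S.
Proof.
have [_ _ eS _ _] := eP.
by apply: memv_suml => i _; apply: memv_suml => j _; exact: memvZ.
Qed.
End SlSystem.

Lemma sl_subalgebra (K : fieldType) m : lie_subalgebra (@mx_bracket K m) (sl K m).
Proof.
split; last by move=> A B _ _; rewrite /sl/= /mx_bracket mxtraceB mxtrace_mulC subrr.
split=> [|a A B]; rewrite /sl/= ?mxtrace0// mxtraceD mxtraceZ => -> ->.
by rewrite mulr0 addr0.
Qed.

Section Transport.
Variables (F : numClosedFieldType) (n : nat) (E : lmodType F) (brE : E -> E -> E).
Local Notation g := 'rV[F]_n.+1.
Variables (br : g -> g -> g) (phi : g -> E) (L : set E).
Hypothesis brP : lie_axioms br.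
Hypothesis phi_lin : forall a x y, phi (a *: x + y) = a *: phi x + phi y.
Hypothesis phi_inj : forall x, phi x = 0 -> x = 0.
Hypothesis phi_L : forall z, L z <-> exists x, phi x = z.
Hypothesis phi_br : forall x y, phi (br x y) = brE (phi x) (phi y).

Lemma phiB x y : phi (x - y) = phi x - phi y.
Proof. by rewrite -[- y]scaleN1r [x + _]addrC phi_lin scaleN1r addrC. Qed.

Lemma phi_injective x y : phi x = phi y -> x = y.
Proof.
move=> xy; apply/eqP; rewrite -subr_eq0; apply/eqP/phi_inj.
by rewrite phiB xy subrr.
Qed.

Lemma sl_system_isomorphic m (e : 'I_m.+1 -> 'I_m.+1 -> g) :
  sl_system br e fullv -> lie_isomorphic brE L (@mx_bracket F m.+1) (sl F m.+1).
Proof.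
move=> eP; apply: (@lie_isomorphic_inv _ _ _ _ _ _ _ (fun X => phi (unit_comb e X))).
- exact: sl_subalgebra.
- by move=> a X Y _ _; rewrite unit_comb_lin phi_lin.
- by move=> X Y _ _; rewrite -(br_unit_comb brP eP) phi_br.
- move=> X Y X0 Y0 /phi_injective/eqP; rewrite -subr_eq0 -unit_combB => /eqP XY.
  apply/eqP; rewrite -subr_eq0; apply/eqP/(unit_comb_inj brP eP) => //.
  by rewrite mxtraceB (X0 : \tr X = 0) (Y0 : \tr Y = 0) subrr.
- by move=> X _; apply/phi_L; exists (unit_comb e X).
- move=> z /phi_L[x <-]; have [X X0 <-] := unit_comb_surj eP (memvf x).
  by exists X.
Qed.

Lemma sl_system_prod_isomorphic m p (e : 'I_m.+1 -> 'I_m.+1 -> g)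
    (f : 'I_p.+1 -> 'I_p.+1 -> g) (S T : {vspace g}) :
  sl_system br e S -> sl_system br f T ->
  (forall s t, s \in S -> t \in T -> br s t = 0) ->
  (forall x, x \in S -> x \in T -> x = 0) ->
  (forall x, exists2 s, s \in S & exists2 t, t \in T & x = s + t) ->
  lie_isomorphic brE L (prod_bracket (@mx_bracket F m.+1) (@mx_bracket F p.+1))
    (sl F m.+1 `*` sl F p.+1).
Proof.
move=> eP fP ST ST0 dec.
have memE := unit_comb_mem eP; have memF := unit_comb_mem fP.
apply: (@lie_isomorphic_inv _ _ _ _ _ _ _
  (fun XY => phi (unit_comb e XY.1 + unit_comb f XY.2))).
- have [[s0 sl1] sl2] := sl_subalgebra F m.+1; have [[t0 tl1] tl2] := sl_subalgebra F p.+1.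
  split; last by move=> [A B] [A' B'] [/= a b] [/= a' b']; split; [exact: sl2|exact: tl2].
  split=> [|a [A B] [A' B'] [/= Aa Bb] [/= A'a B'b]]; first by split.
  by split; [exact: sl1|exact: tl1].
- move=> a [A B] [A' B'] _ _ /=; rewrite !unit_comb_lin -phi_lin; congr phi.
  by rewrite scalerDr addrACA.
- move=> [A B] [A' B'] _ _ /=; rewrite -phi_br; congr phi.
  rewrite (brDl brP) !(brDr brP) -(br_unit_comb brP eP) -(br_unit_comb brP fP).
  rewrite (ST _ _ (memE A) (memF B')) (br_anti brP (unit_comb f B) (unit_comb e A')).
  by rewrite (ST _ _ (memE A') (memF B)) oppr0 addr0 add0r.
- move=> [A B] [A' B'] [/= a b] [/= a' b'] /phi_injective/eqP.
  rewrite -subr_eq0 opprD addrACA -!unit_combB addr_eq0 => /eqP AB.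
  have A0 : unit_comb e (A - A') = 0.
    apply: ST0; first exact: memE.
    by rewrite AB memvN; exact: memF.
  have B0 : unit_comb f (B - B') = 0 by apply/eqP; rewrite -oppr_eq0 -AB A0.
  have tr0 k (X Y : 'M[F]_k) : sl F k X -> sl F k Y -> \tr (X - Y) = 0.
    by rewrite /sl/= mxtraceB => -> ->; rewrite subrr.
  congr pair; apply/eqP; rewrite -subr_eq0; apply/eqP.
    by apply: (unit_comb_inj brP eP) => //; exact: tr0.
  by apply: (unit_comb_inj brP fP) => //; exact: tr0.
- by move=> X _; apply/phi_L; eexists; reflexivity.
- move=> z /phi_L[x <-]; have [s sS [t tT ->]] := dec x.
  have [A A0 <-] := unit_comb_surj eP sS; have [B B0 <-] := unit_comb_surj fP tT.
  by exists (A, B).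
Qed.

Lemma no_abelian_ideal_of_semisimple : lie_semisimple brE L -> no_abelian_ideal br.
Proof.
move=> Lss I Ii Iab; apply/eqP; rewrite -subv0; apply/subvP => x xI.
rewrite memv0; apply/eqP/phi_inj.
have phi0 : phi 0 = 0 by rewrite -(subrr 0) phiB subrr.
apply: (Lss (phi @` [set x | x \in I])); last by exists x.
- split.
  + split; first by exists 0; rewrite ?phi0//=; exact: mem0v.
    move=> a _ _ [u uI <-] [v vI <-]; exists (a *: u + v); rewrite ?phi_lin//=.
    by rewrite memvD// memvZ.
  + by move=> _ [u uI <-]; apply/phi_L; exists u.
  + move=> z _ /phi_L[y <-] [u uI <-]; exists (br y u); last exact: phi_br.
    exact: Ii.
- exists 1%N => /=; apply: smallest_sub.
    split=> // a u v -> ->; by rewrite scaler0 addr0.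
  move=> _ [_ [u uI <-] [_ [v vI <-] <-]] /=.
  by rewrite -phi_br Iab.
Qed.
End Transport.

(** The spanning list is processed one vector at a time, and a vector already in the image is
    skipped, which keeps [phi] injective. *)
Lemma finite_dimensional_basis (F : fieldType) (E : lmodType F) (L : set E) :
  finite_dimensional L -> exists n (phi : 'rV[F]_n -> E),
  [/\ forall a x y, phi (a *: x + y) = a *: phi x + phi y,
      forall x, phi x = 0 -> x = 0
    & forall z, L z <-> exists x, phi x = z].
Proof.
move=> [s ->].
suff [n [phi [phi_lin phi_inj phi_s phi_span]]] : exists n (phi : 'rV[F]_n -> E),
  [/\ forall a x y, phi (a *: x + y) = a *: phi x + phi y,
      forall x, phi x = 0 -> x = 0,
      forall u, u \in s -> exists x, phi x = u
    & forall V x, Defs.subspace V -> [set` s] `<=` V -> V (phi x)].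
  exists n, phi; split=> // z; split=> [|[x <-] V [Vs sV]]; last exact: phi_span.
  move=> zs; have [|x _ xz] := zs (range phi); last by exists x.
    split; last by move=> u /phi_s[x <-]; exists x.
    split; last by move=> a _ _ [x _ <-] [y _ <-]; exists (a *: x + y).
    exists (0 *: 0 + 0) => //; have := phi_lin (-1) 0 0.
    by rewrite !scaler0 !addr0 scaleN1r addNr.
elim: s => [|u s [n [phi [phi_lin phi_inj phi_s phi_span]]]].
  exists 0%N, (fun=> 0); split.
  - by move=> a x y; rewrite scaler0 addr0.
  - by move=> x _; apply/rowP => -[].
  - by move=> u; rewrite in_nil.
  - by move=> V x Vs _; exact: (proj1 Vs).
have phi_span' V x : Defs.subspace V -> [set` u :: s] `<=` V -> V (phi x).
  by move=> Vs sV; apply: phi_span => // w ws; apply: sV; rewrite /= in_cons ws orbT.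
have [[x xu]|nu] := pselect (exists x, phi x = u).
  exists n, phi; split=> [//|//|w|//]; rewrite in_cons => /predU1P[->|]; last exact: phi_s.
  by exists x.
pose psi (x : 'rV[F]_(1 + n)) := lsubmx x 0 0 *: u + phi (rsubmx x).
have phiZ a x : phi (a *: x) = a *: phi x.
  have phi0 : phi 0 = 0 by have := phi_lin (-1) 0 0; rewrite !scaler0 !addr0 scaleN1r addNr.
  by have := phi_lin a x 0; rewrite phi0 !addr0.
exists (1 + n)%N, psi; split.
- move=> a x y.
  have lE : lsubmx (a *: x + y) = a *: lsubmx x + lsubmx y by exact: linearP.
  have rE : rsubmx (a *: x + y) = a *: rsubmx x + rsubmx y by exact: linearP.
  by rewrite /psi lE rE phi_lin mxaddE mxscaleE scalerDl scalerDr scalerA addrACA.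
- move=> x; rewrite /psi; have [l0|l0] := eqVneq (lsubmx x 0 0) 0.
    rewrite l0 scale0r add0r => /phi_inj r0; rewrite -[x]hsubmxK r0.
    rewrite (_ : lsubmx x = 0) ?row_mx0//.
    by apply/matrixP => i j; rewrite !ord1 l0 mxE.
  move=> xu; case: nu; exists (- (lsubmx x 0 0)^-1 *: rsubmx x).
  rewrite phiZ; move/eqP: xu; rewrite addrC addr_eq0 => /eqP ->.
  by rewrite scalerN scaleNr opprK scalerA mulVf// scale1r.
- have psiE a x : psi (row_mx a%:M x) = a *: u + phi x.
    by rewrite /psi row_mxKl row_mxKr mxE eqxx mulr1n.
  move=> w; rewrite in_cons => /predU1P[->|/phi_s[x <-]].
    exists (row_mx 1%:M 0); rewrite psiE scale1r.
    by rewrite -(scale0r 0) phiZ scale0r addr0.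
  by exists (row_mx 0%:M x); rewrite psiE scale0r add0r.
- move=> V x Vs sV; rewrite /psi; apply: (proj2 Vs).
    by apply: sV; rewrite /= mem_head.
  exact: phi_span'.
Qed.

(** * The classification *)

Section Classification.
Variables (F : numClosedFieldType) (n : nat).
Hypothesis Fc : absolutely_complete F.
Local Notation g := 'rV[F]_n.+1.
Local Notation field := ('rV[F]_2 -> 'rV[F]_2).
Variables (U : set 'rV[F]_2) (br : g -> g -> g) (phi : g -> field).
Hypotheses (Uo : open U) (Uc : connected U).
Hypothesis brP : lie_axioms br.
Hypothesis phi_lin : forall a x y, phi (a *: x + y) = a *: phi x + phi y.
Hypothesis phi_inj : forall x, phi x = 0 -> x = 0.
Hypothesis phi_br : forall x y, phi (br x y) = bracket (phi x) (phi y).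
Hypothesis phi_field : forall x, vector_field U (phi x).
Hypothesis ss : no_abelian_ideal br.

Lemma phi_at a x y p : phi (a *: x + y) p = a *: phi x p + phi y p.
Proof. by rewrite phi_lin. Qed.

Lemma phi_0 : phi 0 = 0.
Proof. by rewrite -(subrr 0) (phiB phi_lin) subrr. Qed.

Lemma isotropy_exists p : exists K : {vspace g}, (forall x, x \in K <-> phi x p = 0) /\
  subalgebra br K.
Proof.
have [||K KP] := @vspace_of_pred F g (fun x => phi x p = 0).
- by rewrite phi_0.
- by move=> a x y x0 y0; rewrite phi_at x0 y0 scaler0 addr0.
exists K; split=> // x y /KP x0 /KP y0; apply/KP.
by rewrite phi_br bracket_out.
Qed.

Lemma transitive_case p : U p -> (forall u : 'rV[F]_2, exists x, phi x p = u) ->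
  [\/ exists e : 'I_2 -> 'I_2 -> g, sl_system br e fullv,
      exists e : 'I_3 -> 'I_3 -> g, sl_system br e fullv
    | exists (S T : {vspace g}) (e f : 'I_2 -> 'I_2 -> g),
      [/\ sl_system br e S, sl_system br f T, forall s t, s \in S -> t \in T -> br s t = 0,
        forall x, x \in S -> x \in T -> x = 0
      & forall x, exists2 s, s \in S & exists2 t, t \in T & x = s + t]].
Proof.
move=> Up surj; have [K [KP Ksub]] := isotropy_exists p.
(* Tangent vectors become columns, on which the isotropy matrices act from the left. *)
apply: (@transitive_classification F n br brP ss (fun x => (phi x p)^T) K) => //.
- by move=> a x y; rewrite phi_at linearP.
- by move=> u; have [x xu] := surj u^T; exists x; rewrite xu trmxK.
- move=> x; split=> [/KP ->|/(congr1 trmx)]; first exact: trmx0.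
  by rewrite trmxK trmx0 => /KP.
- move=> I Ii IK; have [S [_ SI _ dec]] := ideal_complement brP ss Ii.
  apply/eqP; rewrite -subv0; apply/subvP => x xI; rewrite memv0; apply/eqP/phi_inj.
  have /choice[s sP] : forall j : 'I_2, exists s, s \in S /\ phi s p = delta_mx 0 j.
    move=> j; have [y yj] := surj (delta_mx 0 j); have [s sS [i iI yE]] := dec y.
    have /KP ip := subvP IK _ iI.
    by exists s; split=> //; have := phi_at 1 s i p; rewrite !scale1r ip addr0 -yE yj.
  apply: (@commuting_frame_eq0 _ Fc U Uo (phi x) (fun j => phi (s j)) p) => //.
  + by apply/KP; exact: (subvP IK).
  + by move=> j; have [] := sP j.
  + by move=> j; have [sS _] := sP j; rewrite -phi_br SI// phi_0.
Qed.

Lemma intransitive_case p x0 : U p -> phi x0 p != 0 ->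
  (forall x y q k l, phi x q 0 k * phi y q 0 l = phi y q 0 k * phi x q 0 l) ->
  exists e : 'I_2 -> 'I_2 -> g, sl_system br e fullv.
Proof.
move=> Up x0p par; have [K [KP Ksub]] := isotropy_exists p.
have [|x|J [S [Ji JK [e eP] [SJ JS0] dec]]] := @codim1_split F n br brP ss K x0 Ksub.
- by apply/negP => /KP x0p0; rewrite x0p0 eqxx in x0p.
- have [l x0l] : exists l, phi x0 p 0 l != 0.
    apply/existsP; rewrite -negb_forall; apply: contra x0p => /forallP x0l.
    by apply/eqP/rowP => l; rewrite mxE; apply/eqP/x0l.
  exists (phi x p 0 l / phi x0 p 0 l); apply/KP.
  rewrite addrC -scaleNr phi_at; apply/rowP => k; rewrite !mxE.
  by apply: (eq_lin (phi x0 p 0 l)^-1 (par x x0 p k l)); field.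
have J0 c : c \in J -> c = 0.
  move=> cJ; apply: phi_inj.
  have [eb _ eS _ e0] := eP.
  (* A bracket of two fields that both commute with [c]; it is nonzero because its bracket with
     [e 0 1] is twice [e 0 1]. *)
  pose h := br (e 0 1) (e 1 0).
  have h0 : h != 0.
    apply: contraNneq (e0 0 1 isT) => h0.
    have : br h (e 0 1) = 2 *: e 0 1.
      rewrite /h eb /= !scale1r (brBl brP) !eb /=.
      by apply/rowP => k; rewrite !mxE; ring.
    rewrite h0 (br0l brP) => /esym/eqP.
    by rewrite scaler_eq0 pnatr_eq0.
  have [q [i hq]] : exists q i, phi h q 0 i != 0.
    have [//|nq] := pselect (exists q i, phi h q 0 i != 0); exfalso.
    move/eqP: h0; apply; apply: phi_inj; apply/funext => q; apply/rowP => i.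
    by apply/eqP; rewrite mxE; apply: contraT => hq; case: nq; exists q, i.
  have Uq : U q.
    have [//|nUq] := pselect (U q); have [_ /(_ q nUq) hq0] := phi_field h.
    by rewrite hq0 mxE eqxx in hq.
  have comm0 z : z \in S -> bracket (phi z) (phi c) = 0.
    by move=> zS; rewrite -phi_br SJ// phi_0.
  apply: (vector_field_eq0 Fc Uo Uc (phi_field c) Uq) => j.
  have ha : analytic_at (component (phi h) i) q by have [ha _] := phi_field h; exact: ha.
  apply: filterS (continuous_neq0 ha hq) => z hz; apply: (mulfI hz); rewrite mulr0.
  (* Two of the three brackets vanish, leaving the product of a component of [h] and one of [c]; the
     former is nonzero near [q]. *)
  have := @parallel_bracket _ (phi (e 0 1)) (phi (e 1 0)) (phi c) z i j.
  rewrite -phi_br (comm0 (e 1 0))// [bracket (phi c) _]bracket_anti comm0//.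
  rewrite oppr0 !mxE !mul0r !addr0; apply=> k; exact: par.
exists e; have -> // : fullv = S.
apply/eqP; rewrite eqEsubv subvf andbT; apply/subvP => x _.
by have [s sS [i /J0 -> ->]] := dec x; rewrite addr0.
Qed.
End Classification.

Theorem semisimple_vector_fields (F : numClosedFieldType) (U : set 'rV[F]_2)
    (L : set ('rV[F]_2 -> 'rV[F]_2)) : absolutely_complete F ->
  open U -> connected U -> L `<=` vector_field U -> lie_subalgebra (@bracket F) L ->
  finite_dimensional L -> (exists2 V, L V & V <> 0) -> lie_semisimple (@bracket F) L ->
  [\/ lie_isomorphic (@bracket F) L (@mx_bracket F 2) (sl F 2),
      lie_isomorphic (@bracket F) L (@mx_bracket F 3) (sl F 3)
    | lie_isomorphic (@bracket F) L
        (prod_bracket (@mx_bracket F 2) (@mx_bracket F 2)) (sl F 2 `*` sl F 2)].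
Proof.
move=> Fc Uo Uc LU [Lsub Lbr] /finite_dimensional_basis[n [phi [phi_lin phi_inj phi_L]]].
move=> [V0 LV0 V00] Lss.
(* Dimension 0 contradicts the nonzero field [V0]; the Lie theory is stated in dimension [n.+1]. *)
case: n phi phi_lin phi_inj phi_L => [|n] phi phi_lin phi_inj phi_L.
  have [x xV] := (phi_L V0).1 LV0; case: V00.
  have x0 : x = 0 by apply/rowP => -[].
  have := phi_lin (-1) 0 0; rewrite !scaler0 !addr0 scaleN1r addNr => phi0.
  by rewrite -xV x0.
have phi_field x : vector_field U (phi x) by apply: LU; apply/phi_L; exists x.
have phi0 : phi 0 = 0 by rewrite -(subrr 0) (phiB phi_lin) subrr.
(* The bracket of coordinate vectors is chosen through [phi], whose injectivity pulls the Lie axioms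
   back. *)
have /choice[br0 br0P] : forall xy, exists z, phi z = bracket (phi xy.1) (phi xy.2).
  by move=> xy; apply/phi_L; apply: Lbr; apply/phi_L; eexists; reflexivity.
pose br x y := br0 (x, y).
have phi_br x y : phi (br x y) = bracket (phi x) (phi y) by exact: br0P (x, y).
have phiI := phi_injective phi_lin phi_inj.
have br_linl a x y z : br (a *: x + y) z = a *: br x z + br y z.
  by apply: phiI; rewrite phi_lin !phi_br phi_lin (bracket_linl Fc Uo).
have phiN x : phi (- x) = - phi x by rewrite -[- x]add0r (phiB phi_lin) phi0 sub0r.
have br_neg x y : br x y = - br y x.
  by apply: phiI; rewrite phiN !phi_br bracket_anti.
have brP : lie_axioms br.
  split=> //.
  - by move=> a x y z; rewrite br_neg br_linl (br_neg z x) (br_neg z y) scalerN -opprD.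
  - move=> x; apply: phiI; rewrite phi_br phi0; apply/funext => p; apply/rowP => i.
    by rewrite bracketE subrr mxE.
  - move=> x y z; apply: phiI; rewrite -[br (br x y) z]scale1r phi_lin scale1r !phi_br.
    exact: (bracket_jacobi Fc Uo).
have ss := no_abelian_ideal_of_semisimple phi_lin phi_inj phi_L phi_br Lss.
have iso m e := @sl_system_isomorphic F n _ _ br phi L brP phi_lin phi_inj phi_L phi_br m e.
have [[p [Up surj]]|nsurj] := pselect (exists p, U p /\ forall u, exists x, phi x p = u).
  have [[e eP]|[e eP]|[S [T [e [f [eP fP ST ST0 dec]]]]]] :=
    transitive_case Fc Uo Uc brP phi_lin phi_inj phi_br phi_field ss Up surj.
  - by apply: Or31; exact: iso eP.
  - by apply: Or32; exact: iso eP.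
  - apply: Or33.
    exact: (sl_system_prod_isomorphic brP phi_lin phi_inj phi_L phi_br eP fP ST ST0 dec).
have par01 x y q : phi x q 0 0 * phi y q 0 1 = phi y q 0 0 * phi x q 0 1.
  apply/eqP; apply: contraT; rewrite -subr_eq0 => d0; case: nsurj; exists q; split.
    have [//|nUq] := pselect (U q); have [_ /(_ q nUq) xq] := phi_field x.
    by rewrite xq !mxE mul0r mulr0 subrr eqxx in d0.
  move=> u; pose d := phi x q 0 0 * phi y q 0 1 - phi y q 0 0 * phi x q 0 1.
  (* Cramer's rule: independent values of two fields at [q] would reach every tangent vector [u]. *)
  exists (((u 0 0 * phi y q 0 1 - u 0 1 * phi y q 0 0) / d) *: x
    + (((u 0 1 * phi x q 0 0 - u 0 0 * phi x q 0 1) / d) *: y + 0)).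
  rewrite !phi_lin phi0; apply/rowP => k; rewrite !mxE.
  by case: (ord2_cases k) => ->; rewrite /d; field.
have par x y q k l : phi x q 0 k * phi y q 0 l = phi y q 0 k * phi x q 0 l.
  case: (ord2_cases k) => ->; case: (ord2_cases l) => ->.
  - exact: mulrC.
  - exact: par01.
  - by rewrite mulrC -par01 mulrC.
  - exact: mulrC.
have [x0 x0V] := (phi_L V0).1 LV0.
have [p x0p] : exists p, phi x0 p != 0.
  have [//|np] := pselect (exists p, phi x0 p != 0); exfalso; apply: V00.
  apply/funext => p; rewrite -x0V; apply/eqP; apply: contraT => x0p.
  by case: np; exists p.
have Up : U p.
  have [//|nUp] := pselect (U p); have [_ /(_ p nUp) x0p0] := phi_field x0.
  by rewrite x0p0 eqxx in x0p.
have [e eP] := intransitive_case Fc Uo Uc brP phi_lin phi_inj phi_br phi_field ss Up x0p par.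
by apply: Or31; exact: iso eP.
Qed.

Theorem proposition3p1 (R : realType) (U : set 'rV[R[i]^o]_2)
    (L : set ('rV[R[i]]_2 -> 'rV[R[i]]_2)) :
  U !=set0 -> open U -> connected U ->
  L `<=` vector_field U ->
  lie_subalgebra (@bracket R[i]) L ->
  finite_dimensional L ->
  (exists2 V, L V & V <> 0) ->
  lie_semisimple (@bracket R[i]) L ->
  [\/ lie_isomorphic (@bracket R[i]) L (@mx_bracket R[i] 2) (sl R[i] 2),
      lie_isomorphic (@bracket R[i]) L (@mx_bracket R[i] 3) (sl R[i] 3)
    | lie_isomorphic (@bracket R[i]) L
        (prod_bracket (@mx_bracket R[i] 2) (@mx_bracket R[i] 2))
        (sl R[i] 2 `*` sl R[i] 2)].
Proof.
move=> _ Uo Uc.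
exact: (semisimple_vector_fields (@complex_absolutely_convergent R) Uo Uc).
Qed.
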